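(* Let $\Gamma$ be a connected negative definite plumbing graph of a rational homology $3$-sphere $\Sigma=\partial\widetilde X(\Gamma)$. Let $v$ be a vertex of $\Gamma$, and let $\Gamma_i$ be the connected components of $\Gamma\setminus v$. Let $\widetilde\sigma$ be a $\mathrm{Spin}^c$ structure of $\widetilde X(\Gamma)$ satisfying $$-1<\left(\frac{c_1(\widetilde\sigma)-c_1(\widetilde{\sigma_{\mathrm{can}}})}{2},\,E_v^*\right)\le 0 .$$ Let $\sigma$, $\widetilde\sigma_i$ and $\sigma_i$ denote the restriction of $\widetilde\sigma$ to $\Sigma$, $\widetilde X(\Gamma_i)$ and $\Sigma_i:=\partial\widetilde X(\Gamma_i)$, respectively. Then $$\mathrm{sw}_\sigma(\Sigma)+\frac{c_1(\widetilde\sigma)^2+|\mathcal V(\Gamma)|}{8}=-\mathcal H^{\mathrm{pol}}_{\sigma,v}(1)+\sum_i\left(\mathrm{sw}_{\sigma_i}(\Sigma_i)+\frac{c_1(\widetilde\sigma_i)^2+|\mathcal V(\Gamma_i)|}{8}\right).$$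
   Context: **Plumbing data.** $\Gamma$ is a finite connected graph with vertex set $\mathcal V(\Gamma)$, each vertex $w$ decorated by an integer $b_w$. $\widetilde X(\Gamma)$ is the oriented $4$-manifold with boundary obtained by plumbing: a tubular neighbourhood of oriented $2$-spheres $E_w$ ($w\in\mathcal V(\Gamma)$), where $b_w$ is the Euler number of the normal bundle of $E_w$, the spheres of two adjacent vertices meet transversally at one point, and there are no other intersections. $\Sigma:=\partial\widetilde X(\Gamma)$ is assumed to be a rational homology sphere (equivalently, $\Gamma$ is a tree). $L:=H_2(\widetilde X(\Gamma);\mathbb Z)$ is free with basis the classes $E_w$; its intersection form is $(E_w,E_w)=b_w$, and for $u\neq w$, $(E_u,E_w)=1$ if $u,w$ are adjacent and $0$ otherwise; its matrix is $I$. $\Gamma$ is negative definite if this form is. $L':=H^2(\widetilde X(\Gamma);\mathbb Z)$ is the dual lattice, with basis $E^*_w$ where $(E^*_w,E_u)=\delta_{wu}$ (Kronecker delta); $L\subset L'\subset L\otimes\mathbb Q$ and the form extends to $L'$; $x^2:=(x,x)$. $H:=L'/L\cong H_1(\Sigma;\mathbb Z)$, $[l']$ is the class of $l'\in L'$, $\widehat H:=\mathrm{Hom}(H,\mathbb C^* )$. $d:=\det(\Gamma):=\det(-I)=|H|$. $a_{uw}:=-|H|\,(E^*_u,E^*_w)$ (positive integers). $\delta_w$ is the degree of $w$ in $\Gamma$. **$\mathrm{Spin}^c$ structures.** $\mathrm{Spin}^c$ structures of $\widetilde X(\Gamma)$ form a torsor over $L'$ (action $*$), with $c_1(l'*\widetilde\sigma)=c_1(\widetilde\sigma)+2l'$;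 the canonical one $\widetilde{\sigma_{\mathrm{can}}}$ is characterized by $(c_1(\widetilde{\sigma_{\mathrm{can}}}),E_w)=b_w+2$ for all $w$. $\mathrm{Spin}^c$ structures of $\Sigma$ form an $H$-torsor; restriction to $\Sigma$ is compatible with $L'\to H$; $\sigma_{\mathrm{can}}$ is the restriction of $\widetilde{\sigma_{\mathrm{can}}}$. For $\sigma\in\mathrm{Spin}^c(\Sigma)$, $h_\sigma\in H$ is defined by $h_\sigma*\sigma_{\mathrm{can}}=\sigma$. The restriction of $l'*\widetilde{\sigma_{\mathrm{can}}}$ to $\widetilde X(\Gamma_i)\subset\widetilde X(\Gamma)$ is $R_i(l')*\widetilde{\sigma_{\mathrm{can},i}}$, where $R_i:L'\to L_i'$ is the cohomological restriction ($R_i(E_w^* )=E^*_{w,i}$ if $w\in\mathcal V(\Gamma_i)$, $0$ otherwise). All objects with index $i$ refer to the graph $\Gamma_i$. **Rational functions.** For $\rho\in\widehat H$ and $u\in\mathcal V(\Gamma)$, $$P_{\rho,u}(t):=\prod_{w\in\mathcal V(\Gamma)}\bigl(1-\rho([E^*_w])\,t^{a_{wu}}\bigr)^{\delta_w-2},\qquad \mathcal H_{\sigma,u}(t):=\frac1{|H|}\sum_{\rho\in\widehat H}\rho(h_\sigma)^{-1}P_{\rho,u}(t).$$ $\mathcal H^{\mathrm{pol}}_{\sigma,v}$ is the polynomial part: the unique polynomial such that $\mathcal H_{\sigma,v}-\mathcal H^{\mathrm{pol}}_{\sigma,v}$ is $0$ or has negative degree (degree of numerator less than degree of denominator). **Seiberg–Witten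 invariant.** With the paper's sign convention, $\mathrm{sw}_\sigma(\Sigma)=\dfrac{\lambda(\Sigma)}{|H|}-\mathcal T_\sigma(\Sigma)$, where $\lambda$ is the Casson–Walker invariant in Lescop's normalization, given for plumbed manifolds by $$-24\frac{\lambda(\Sigma)}{|H|}=\sum_{w}b_w+3|\mathcal V(\Gamma)|+\frac1{|H|}\sum_w(\delta_w-2)a_{ww},$$ and $\mathcal T_\sigma(\Sigma)$ is the Reidemeister–Turaev torsion (coefficient at $0\in H$), given by $\mathcal T_\sigma(\Sigma)=\frac1{|H|}\sum_{\rho\in\widehat H\setminus\{1\}}\widehat{\mathcal T_\sigma}(\rho)$ with $\widehat{\mathcal T_\sigma}(\rho)=\rho(h_\sigma)^{-1}\lim_{t\to1}P_{\rho,u_\rho}(t)$, where $u_\rho$ is any vertex such that $\rho([E^*_{u_\rho}])\ne1$ or $\rho([E^*_u])\neq 1$ for some vertex $u$ adjacent to $u_\rho$. *)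

(* Defs.v *)
From HB Require Import structures.
From mathcomp Require Import all_boot all_order all_algebra.
From mathcomp Require Import all_classical all_reals all_analysis.
From mathcomp Require Import fraction ring_quotient.

Set Implicit Arguments.
Unset Strict Implicit.
Unset Printing Implicit Defensive.

Import Order.TTheory GRing.Theory Num.Theory.
Import numFieldNormedType.Exports.

Local Open Scope classical_set_scope.
Local Open Scope ring_scope.

(* The 4-manifold X(G), its boundary, their Spin^c structures and the
   Seiberg-Witten invariant are all represented through the plumbing graph. *)
Record plumbing := Plumbing {
  vert :> finType;
  adj : rel vert;
  euler : vert -> int;
  adj_sym : symmetric adj;
  adj_irr : irreflexive adj }.

Section Lattices.
Variable G : plumbing.

Definition degree (w : G) : nat := #|[pred u | adj w u]|.

Definition connected_graph := forall u w : G, connect (@adj G) u w.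

(* For a connected graph: the boundary is a rational homology sphere
   (for negative definite G) iff G is a tree. *)
Definition acyclic_graph :=
  forall s : seq G, ucycle (@adj G) s -> (size s <= 2)%N.

Definition inter (u w : G) : int :=
  if u == w then euler u else (adj u w)%:R.

(* Bilinear extension of the intersection form, for coefficients in K with
   respect to the basis (E_w). *)
Definition iform (K : pzRingType) (x y : {ffun G -> K}) : K :=
  \sum_u \sum_w x u * y w * (inter u w)%:~R.

Definition negative_definite :=
  forall x : {ffun G -> int}, x != 0 -> iform x x < 0.

Definition inter_mx : 'M[int]_#|G| :=
  \matrix_(i, j) inter (enum_val i) (enum_val j).

(* det G = det (- I), which is the order of H when G is negative definite. *)
Definition detG : int := \det (- inter_mx).

(* L' = H^2(X(G); Z) = Hom(L, Z): the class l' is the function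
   w |-> (l', E_w), i.e. l' has coordinates l' w in the basis (E*_w). *)
Definition dual_lattice : Type := {ffun G -> int}.
HB.instance Definition _ := GRing.Zmodule.on dual_lattice.

Definition Estar (w : G) : dual_lattice := [ffun u => (u == w)%:R].

(* L' -> L (x) Q, in the basis (E_w): the x with (x, E_u) = l' u for all u. *)
Definition toLQ (l : dual_lattice) : {ffun G -> rat} :=
  [ffun u => \sum_w
     invmx (map_mx intr inter_mx) (enum_rank u) (enum_rank w) * (l w)%:~R].

Definition dual_form (l m : dual_lattice) : rat := iform (toLQ l) (toLQ m).

Definition L_to_dual (x : {ffun G -> int}) : dual_lattice :=
  [ffun u => \sum_w x w * inter w u].

Definition in_L : {pred dual_lattice} :=
  fun l => `[< exists x, l = L_to_dual x >].

Lemma in_L_zmod : zmod_closed in_L.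
Proof.
split; first by apply/asboolP; exists 0; apply/ffunP => u;
  rewrite !ffunE big1 // => w _; rewrite ffunE mul0r.
move=> _ _ /asboolP[x ->] /asboolP[y ->]; apply/asboolP; exists (x - y).
apply/ffunP => u; rewrite !ffunE -sumrB; apply: eq_bigr => w _.
by rewrite !ffunE mulrBl.
Qed.

HB.instance Definition _ := GRing.isZmodClosed.Build dual_lattice in_L in_L_zmod.

(* H = L' / L; the library's notation for the quotient of a zmodType by a
   subgroup is shared with that for quotients by ideals. *)
Definition discr : zmodType := {ideal_quot in_L}.

Definition discr_class (l : dual_lattice) : discr :=
  (\pi_{ideal_quot in_L} l)%qT.

(* a_{uw} = - |H| (E*_u, E*_w); on a negative definite connected graph this
   rational number is a positive integer, so the truncation is exact. *)
Definition acoef (u w : G) : nat :=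
  Num.truncn (- detG%:~R * dual_form (Estar u) (Estar w)).

(* A Spin^c structure l' * can of X(G) is recorded by l'. *)
Record spincX := SpincX { spincX_coord : dual_lattice }.
Definition spincX_act (l : dual_lattice) (s : spincX) :=
  SpincX (l + spincX_coord s).
Definition spincX_can := SpincX 0.

(* c_1(l' * can) = c_1(can) + 2 l', where (c_1(can), E_w) = b_w + 2. *)
Definition c1 (s : spincX) : dual_lattice :=
  [ffun w => euler w + 2] + spincX_coord s *+ 2.

(* A Spin^c structure h * can of the boundary is recorded by h. *)
Record spincM := SpincM { hclass : discr }.
Definition spincM_act (h : discr) (s : spincM) := SpincM (h + hclass s).
Definition spincM_can := SpincM 0.

Definition spinc_boundary (s : spincX) : spincM :=
  spincM_act (discr_class (spincX_coord s)) spincM_can.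

End Lattices.

Section RationalFunctions.
Variables (C : numClosedFieldType) (G : plumbing).

Definition dual_group : set (discr G -> C) :=
  [set rho | rho 0 = 1 /\ forall x y, rho (x + y) = rho x * rho y].

Definition trivial_char : discr G -> C := fun=> 1.

(* P_{rho,u}(t) at an element t of a field F over C: evaluation at a complex
   number for F = C, the rational function itself for F = C(t). *)
Definition Prat (F : fieldType) (iota : C -> F) (rho : discr G -> C) (u : G)
    (t : F) : F :=
  \prod_(w : G) (1 - iota (rho (discr_class (Estar w))) * t ^+ acoef w u)
                  ^ ((degree w)%:Z - 2).

Definition ratfun_const (c : C) : {fraction {poly C}} := tofrac c%:P.

Definition Hrat (s : spincM G) (u : G) : {fraction {poly C}} :=
  ratfun_const (detG G)%:~R^-1 *
  \sum_(rho \in dual_group)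
    ratfun_const (rho (hclass s))^-1 * Prat ratfun_const rho u (tofrac 'X).

(* As size is degree + 1, with size 0 = 0, the case f = p is that of n = 0. *)
Definition is_polynomial_part (f : {fraction {poly C}}) (p : {poly C}) :=
  exists n d : {poly C}, [/\ d != 0, (size n < size d)%N &
    f - tofrac p = tofrac n / tofrac d].

Definition polynomial_part (f : {fraction {poly C}}) : {poly C} :=
  xget 0 [set p | is_polynomial_part f p].

(* u rho is a vertex that may serve as u_rho, for all nontrivial rho. *)
Definition torsion_choice (u : (discr G -> C) -> G) :=
  forall rho, dual_group rho -> rho <> trivial_char ->
    rho (discr_class (Estar (u rho))) <> 1 \/
    exists2 w, adj (u rho) w & rho (discr_class (Estar w)) <> 1.

Definition torsion_hat (u : (discr G -> C) -> G) (s : spincM G)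
    (rho : discr G -> C) : C :=
  (rho (hclass s))^-1 * lim (Prat id rho (u rho) t @[t --> (1 : C)^']).

Definition torsion (u : (discr G -> C) -> G) (s : spincM G) : C :=
  (detG G)%:~R^-1 *
  \sum_(rho \in dual_group `\ trivial_char) torsion_hat u s rho.

(* Casson-Walker invariant in Lescop's normalization. *)
Definition casson_walker : rat :=
  - (detG G)%:~R / 24 *
  ((\sum_(w : G) euler w)%:~R + 3 * #|G|%:R +
   (detG G)%:~R^-1 *
     \sum_(w : G) ((degree w)%:R - 2) * (acoef w w)%:R).

(* The vertices u_rho that enter the torsion are the argument u. *)
Definition sw (u : (discr G -> C) -> G) (s : spincM G) : C :=
  ratr (casson_walker / (detG G)%:~R) - torsion u s.

End RationalFunctions.

Definition c1_term (G : plumbing) (s : spincX G) : rat :=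
  (dual_form (c1 s) (c1 s) + #|G|%:R) / 8.

Section Subgraphs.
Variable G : plumbing.

Section Induced.
Variable A : {set G}.

Definition sub_vert : finType := {x : G | x \in A}.
Definition sub_adj : rel sub_vert := fun x y => adj (val x) (val y).
Lemma sub_adj_sym : symmetric sub_adj.
Proof. by move=> x y; apply: adj_sym. Qed.
Lemma sub_adj_irr : irreflexive sub_adj.
Proof. by move=> x; apply: adj_irr. Qed.

Definition subplumbing : plumbing :=
  Plumbing (fun x : sub_vert => euler (val x)) sub_adj_sym sub_adj_irr.

(* R_i(E*_w) is E*_{w,i} if w is in A and 0 otherwise: in the coordinates of
   dual_lattice, this is the restriction of functions. *)
Definition dual_restrict (l : dual_lattice G) : dual_lattice subplumbing :=
  [ffun x : sub_vert => l (val x)].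

Definition spincX_restrict (s : spincX G) : spincX subplumbing :=
  spincX_act (dual_restrict (spincX_coord s)) (spincX_can subplumbing).

End Induced.

Variable v : G.

Definition del_adj : rel G := [rel x y | [&& x != v, y != v & adj x y]].

Definition components : {set {set G}} :=
  equivalence_partition (connect del_adj) [set~ v]%SET.

Definition component : finType := {A : {set G} | A \in components}.

Definition comp_plumbing (i : component) : plumbing := subplumbing (val i).

End Subgraphs.

(* Main.v *)
Require Import Defs.
From HB Require Import structures.
From mathcomp Require Import all_boot all_order all_algebra.
From mathcomp Require Import all_classical all_reals all_analysis.
From mathcomp Require Import complex.
From mathcomp Require Import fraction finmap fingroup perm.
From mathcomp Require Import zify ring lra.
Import Order.TTheory GRing.Theory Num.Theory.
Import numFieldNormedType.Exports.
Local Open Scope ring_scope.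
Set Implicit Arguments.
Unset Strict Implicit.
Unset Printing Implicit Defensive.

(** Write d for the determinant of the tree, and a_uw = d m_uw, where m = - I^-1
    is the matrix of the numbers - (E*_u, E*_w). A character rho of L'/L is the
    same as the function x_w = rho([E*_w]), subject to one relation
    prod_w x_w ^ (E_u, E_w) = 1 for each vertex u. All of the proof is read off
    from the poles of the rational function
      H = (1/d) sum_x x(l')^-1 prod_w (1 - x_w X ^ a_wv) ^ (degree w - 2).

    Poles of H. At p != 0 put z_w = x_w p ^ a_wv and use the coordinate T = X / p:
    the term of x becomes the product attached to z near T = 1, whose order is
    the sum of degree w - 2 over S = {w | z_w = 1}. The function z satisfies the
    relations of a character at all vertices but v. A relation at a vertex of S
    forbids that exactly one neighbour lies outside S, and in a rooted tree this
    local condition makes the order nonnegative unless S is everything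
    (ord_ge0). It can fail at v only, and therefore the term has a pole only if
    z = 1, or if z is 1 outside one component G_i of G minus v and restricts to
    a character y of G_i with y_u != 1 at the neighbour u of v in G_i
    (pole_cases). Put k = - d (l', E*_v), where 2 l' is the difference between
    c_1 and its canonical value. The hypothesis on the spin^c structure is
    0 <= k < d, and this inequality makes the fractions
      X^k (A + B (1 - X^d)) / (1 - X^d)^2   and   c_y X^k / (1 - y_u X^d),
    which have the polar parts just found (double_pole, simple_pole), of
    negative degree. Hence the polynomial part of H is H minus these fractions,
    and its value at 1 can be computed term by term (polynomial_part_at_1): it
    is a number V from the expansion of the trivial term to second order, plus
    the values of the other terms at X = 1 regularised with base vertex v, minus
    one term for each y with y_u != 1.

    Torsions. The torsion of G is a sum of the same regularised values, but with
    base vertex u_rho in place of v. For two vertices admissible as u_rho the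
    value is the same: it is zero unless the order is zero, and then the quotient
    of the two Green functions m_wu is constant along the edges inside S
    (pval_good). If v is not admissible for x and the value is not zero, then x
    is 1 outside a component G_i, and the change of the base vertex costs the
    torsion term of the restriction y of x to G_i, with y_u = 1
    (torsion_difference). The y with y_u != 1 are those that occur in the value
    of the polynomial part, so all torsion terms cancel.

    Rational part. What remains is that the Casson-Walker and c_1^2 terms of
    the components exceed those of G by V (rat_part_drop). It follows from the
    formula m_ab - m_av m_bv / m_vv for the Green function of G minus v
    (green_sub), the Laplace equation at v, and the product formula
    prod_w m_wv ^ (degree w - 2) = d / m_vv (prod_green_deg2), which is Gaussian
    elimination from the leaves to the root of the tree. *)

(** * Rooted trees *)

Section RootedTrees.
Variable G : plumbing.

(** The depth serves for inductions towards the root. *)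
Definition rooted (r : G) (par : G -> G) (dep : G -> nat) :=
  [/\ dep r = 0%N,
      forall w, w != r -> dep w = (dep (par w)).+1 &
      forall x y, adj x y =
     ((x != r) && (par x == y)) || ((y != r) && (par y == x))].

(** A path from x to z that avoids y would close up to a cycle through y. *)
Lemma acyclic_neighbour_unique (y x z : G) : acyclic_graph G ->
  adj y x -> adj y z -> connect (del_adj y) x z -> x = z.
Proof.
move=> acyc yx yz /connectP[p]; case/shortenP=> q qpath quniq _ zE {p}.
have yq : y \notin x :: q.
  rewrite inE negb_or; apply/andP; split.
    by apply/eqP => yE; move: yx; rewrite yE adj_irr.
  elim: q x qpath {quniq zE yx} => //= a q IH x /andP[/and3P[_ ay _] qpath].
  by rewrite inE negb_or eq_sym ay (IH _ qpath).
have : (size (y :: x :: q) <= 2)%N.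
  apply: acyc; rewrite /ucycle cons_uniq yq quniq andbT /= yx rcons_path.
  have sq : path (@adj G) x q by apply: (@sub_path _ (del_adj y)) qpath => a b /and3P[].
  by rewrite -zE (adj_sym z) yz sq.
by case: q {qpath quniq yq} zE => //=.
Qed.

(** The depth is the distance to r. Each vertex w has at most one neighbour that
    is not deeper: two of them would be joined through r by a path avoiding w,
    along which the depth decreases. *)
Lemma rooted_exists (r : G) : connected_graph G -> acyclic_graph G ->
  exists par dep, rooted r par dep.
Proof.
move=> conn acyc.
pose P w n := `[< exists p, [/\ path (@adj G) w p, last w p = r & size p = n] >].
have exP w : exists n, P w n.
  have /connectP[p pp lp] := conn w r.
  by exists (size p); apply/asboolP; exists p.
pose dep w := ex_minn (exP w).
have depP w : P w (dep w) by rewrite /dep; case: ex_minnP.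
have dep_min w n : P w n -> (dep w <= n)%N.
  by rewrite /dep; case: ex_minnP => m _ mmin /mmin.
have dep_adj x y : adj x y -> (dep x <= (dep y).+1)%N.
  move=> xy; apply: dep_min; have /asboolP[p [pp lp sp]] := depP y.
  by apply/asboolP; exists (y :: p); rewrite /= xy lp sp.
have dep0 w : dep w = 0%N -> w = r.
  by move=> w0; have /asboolP[p [_ <-]] := depP w; rewrite w0 => /size0nil->.
have depr : dep r = 0%N.
  by apply/eqP; rewrite -leqn0; apply: dep_min; apply/asboolP; exists [::].
pose par w := odflt w [pick x | adj w x && (dep w == (dep x).+1)].
have parP w : w != r -> adj w (par w) /\ dep w = (dep (par w)).+1.
  move=> wr; rewrite /par; case: pickP => [x /andP[-> /eqP]//|none].
  have /asboolP[[|x p] [/= + lp sp]] := depP w; first by rewrite lp eqxx in wr.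
  move=> /andP[wx pp]; have := none x; rewrite wx /= -sp eqSS => /negP[].
  have := dep_adj _ _ wx; rewrite -sp ltnS eqn_leq => -> /=.
  by apply: dep_min; apply/asboolP; exists p.
have to_root w y : y != w -> (dep y <= dep w)%N -> connect (del_adj w) y r.
  have [n] := ubnP (dep y); elim: n y => // n IH y dyn yw dyw.
  have [->|yr] := eqVneq y r; first exact: connect0.
  have [ypy dy] := parP _ yr.
  have pw : par y != w by apply/eqP => pE; rewrite dy pE ltnn in dyw.
  apply: (connect_trans (y := par y)).
    by apply: connect1; apply/and3P.
  by apply: IH => //; lia.
have symd w : connect_sym (del_adj w).
  apply: symmetric_from_pre.
  move=> x y /connectP[p pp ->]; elim: p x pp => [|a p IH] x /=.
    by move=> _; exact: connect0.
  move=> /andP[/and3P[xw aw xa] /IH pa]; apply: connect_trans pa _.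
  by apply: connect1; apply/and3P; rewrite adj_sym.
have neq_adj x y : adj x y -> x != y.
  by move=> xy; apply/eqP => xE; rewrite xE adj_irr in xy.
have uniq_low w x y : adj w x -> adj w y -> (dep x <= dep w)%N ->
    (dep y <= dep w)%N -> x = y.
  move=> wx wy dx dy; apply: (acyclic_neighbour_unique acyc wx wy).
  apply: (connect_trans (y := r)); first by rewrite to_root // eq_sym neq_adj.
  by rewrite symd to_root // eq_sym neq_adj.
have low_par w x : adj w x -> (dep x <= dep w)%N -> w != r /\ par w = x.
  move=> wx dx; have wr : w != r.
    apply/eqP => wr; move: dx; rewrite wr depr leqn0 => /eqP /dep0 xr.
    by rewrite wr xr adj_irr in wx.
  split=> //; have [wp dw] := parP _ wr.
  by apply: uniq_low wp wx _ dx; lia.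
exists par, dep; split=> [//|w /parP[]//|x y].
apply/idP/orP => [xy|[]/andP[nr /eqP<-]].
- case: (leqP (dep x) (dep y)) => d; last first.
    by left; have [-> ->] := low_par _ _ xy (ltnW d); rewrite eqxx.
  by right; move: xy; rewrite adj_sym => xy; have [-> ->] := low_par _ _ xy d; rewrite eqxx.
- by have [] := parP _ nr.
- by rewrite adj_sym; have [] := parP _ nr.
Qed.

End RootedTrees.

(** * The order of a balanced set in a rooted tree *)

Lemma prodr_exprz (F : fieldType) (I : Type) (r : seq I) (P : pred I) (e : I -> int)
    (a : F) : a != 0 ->
  \prod_(i <- r | P i) a ^ e i = a ^ (\sum_(i <- r | P i) e i).
Proof. by move=> a0; rewrite (big_morph _ (fun m n => expfzDr m n a0) (expr0z _)). Qed.

Definition deg2 (G : plumbing) (w : G) : int := (degree w)%:Z - 2.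

Section Order.
Variable G : plumbing.
Implicit Types (S : {set G}) (r u v w x : G).

(** The condition that the relations of a character x impose on the set S of the
    vertices where x is 1: in the relation at w only the neighbours outside S
    contribute, and a product with a single factor other than 1 is not 1. *)
Definition balanced S := forall w, w \in S ->
  #|[set x | adj w x & x \notin S]| != 1%N.

(** The condition for u to serve as u_rho in the torsion. *)
Definition good S u := (u \notin S) || [exists x, adj u x && (x \notin S)].

Definition adj_within S : rel G := [rel x y | [&& x \in S, y \in S & adj x y]].

Section AtRoot.
Variables (r : G) (par : G -> G) (dep : G -> nat).
Hypothesis rootP : rooted r par dep.

Let depr : dep r = 0%N. Proof. by case: rootP. Qed.
Let depS w : w != r -> dep w = (dep (par w)).+1. Proof. by case: rootP => _ + _; apply. Qed.
Let adjE x y : adj x y = ((x != r) && (par x == y)) || ((y != r) && (par y == x)).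
Proof. by case: rootP. Qed.

Definition children w : {set G} := [set x | x != r & par x == w].

Definition below c x := c \in traject par x (dep x).+1.

Lemma below_root c : below c r = (c == r).
Proof. by rewrite /below depr /= inE. Qed.

Lemma belowE c x : x != r -> below c x = (c == x) || below c (par x).
Proof. by move=> xr; rewrite /below depS // trajectS inE. Qed.

Lemma below_refl x : below x x.
Proof. by rewrite /below trajectS inE eqxx. Qed.

Lemma below_dep c x : below c x -> (dep c <= dep x)%N.
Proof.
have [n] := ubnP (dep x); elim: n x => // n IH x dx.
have [->|xr] := eqVneq x r; first by rewrite below_root => /eqP ->.
rewrite belowE // => /orP[/eqP->//|/IH]; rewrite (depS xr) in dx *; lia.
Qed.

Lemma adj_par x : x != r -> adj x (par x).
Proof. by move=> xr; rewrite adjE xr eqxx. Qed.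

Lemma degree_children w : degree w = (#|children w| + (w != r))%N.
Proof.
rewrite /degree; have [->|wr] := eqVneq w r.
  by rewrite addn0; apply: eq_card => x; rewrite !inE adjE eqxx.
rewrite (cardD1 (par w) [pred u | adj w u]) !inE adj_par // addnC; congr (_ + _)%N.
apply: eq_card => x; rewrite !inE adjE wr /=.
have [->|xp] := eqVneq x (par w); last by rewrite orFb eq_sym.
rewrite /=; apply/esym/negbTE/negP => /andP[pr /eqP pp].
by have := depS wr; have := depS pr; rewrite pp; lia.
Qed.

(** The exponent of f w that is left in the product of the f w ^ deg2 w over S
    when a factor f (par x) / f x is taken out for each edge inside S. *)
Definition excess S w : int :=
  #|children w :\: S|%:Z - ((w != r) && (par w \notin S))%:Z - 2 * (w == r)%:Z.

(** The number deg2 w counts the children of w, with a correction - 1 for the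
    parent, or - 2 at the root. The children in S, and the parent if it is in S,
    are the exponents that the edges inside S account for. *)
Lemma prod_deg2 (F : fieldType) S (f : G -> F) :
  (forall w, w \in S -> f w != 0) ->
  \prod_(w in S) f w ^ deg2 w = \prod_(w in S) f w ^ excess S w *
    \prod_(x in S | (x != r) && (par x \in S)) (f (par x) / f x).
Proof.
move=> f0; rewrite big_split /=.
rewrite (partition_big (P := fun x => (x \in S) && ((x != r) && (par x \in S)))
  par (mem S)) /=; last first.
  by move=> x /and3P[].
rewrite [X in _ * (_ * X)]big_mkcondr /=.
rewrite -!big_split /=; apply: eq_bigr => w wS.
have -> : \prod_(x | [&& x \in S, x != r & par x \in S] && (par x == w)) f (par x) =
    f w ^ (#|children w :&: S|%:Z).
  rewrite -exprnP -prodr_const; apply: eq_big => [x|x /andP[_ /eqP->]//].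
  rewrite !inE; have [->|_] := eqVneq (par x) w; last by rewrite !andbF.
  by rewrite wS !andbT andbC.
have -> : (if (w != r) && (par w \in S) then (f w)^-1 else 1) =
    f w ^ (- ((w != r) && (par w \in S))%:Z).
  by case: ifP => _; rewrite ?expr0z // exprN1.
rewrite -!expfzDr ?f0 //; congr (_ ^ _).
rewrite /deg2 /excess degree_children -(cardsID S).
by case: eqP => _ /=; rewrite ?eqxx; case: (par w \in S) => /=; lia.
Qed.

Lemma sum_deg2 S : \sum_(w in S) deg2 w = \sum_(w in S) excess S w.
Proof.
(* The powers of 2 recover the sums of the exponents. *)
have two0 : (2 : rat) != 0 by [].
have H := @prod_deg2 rat S (fun=> 2) (fun _ _ => two0).
rewrite (big1 _ _ (fun x => _ / _)) ?mulr1 in H; last by move=> x _; rewrite divff.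
have E (e : G -> int) : \prod_(w in S) (2 : rat) ^ e w = 2 ^ \sum_(w in S) e w.
  by rewrite -(prodr_exprz _ _ _ two0).
by rewrite !E in H; apply: (@ieexprIz rat 2) H.
Qed.

Lemma nonS_neighbours S w : w \in S ->
  #|[set x | adj w x & x \notin S]| =
  (#|children w :\: S| + ((w != r) && (par w \notin S)))%N.
Proof.
move=> wS; have [->|wr] := eqVneq w r.
  by rewrite addn0; apply: eq_card => x; rewrite !inE adjE eqxx /= andbC.
rewrite (cardsD1 (par w) [set x | adj w x & x \notin S]) !inE adj_par // addnC; congr (_ + _)%N.
apply: eq_card => x; rewrite !inE adjE wr /=.
have [->|xp] := eqVneq x (par w); last by rewrite /= andbC.
rewrite /=; apply/esym/negbTE/negP => /and3P[_ pr /eqP pp].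
by have := depS wr; have := depS pr; rewrite pp; lia.
Qed.

(** If the parent of w is outside S, balancedness forces a child outside S as
    well. At the root, goodness gives one child outside S, and then
    balancedness a second one. *)
Lemma excess_ge0 S w : balanced S -> good S r -> w \in S -> 0 <= excess S w.
Proof.
move=> bal gd wS; have := bal w wS; rewrite nonS_neighbours // /excess.
have [wE|wr] /= := eqVneq w r; last by case: (par w \in S) => /=; lia.
have : (0 < #|children w :\: S|)%N.
  move: gd; rewrite /good -wE wS /= => /existsP[x /andP[wx xS]].
  apply/card_gt0P; exists x; rewrite !inE xS.
  by move: wx; rewrite adjE wE eqxx.
by lia.
Qed.

Lemma ord_ge0_root S : balanced S -> good S r -> 0 <= \sum_(w in S) deg2 w.
Proof. by move=> bal gd; rewrite sum_deg2; apply: sumr_ge0 => w; exact: excess_ge0. Qed.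

Lemma excess0 S : balanced S -> good S r -> \sum_(w in S) deg2 w = 0 ->
  forall w, w \in S -> excess S w = 0.
Proof.
move=> bal gd; rewrite sum_deg2 => /eqP.
rewrite psumr_eq0 => [/allP H w wS|w]; last exact: excess_ge0.
by apply/eqP; have := H w (mem_index_enum w); rewrite wS.
Qed.

Section NoExcess.
Variable S : {set G}.
Hypothesis ex0 : forall w, w \in S -> excess S w = 0.

(** Without excess, a vertex of S whose parent is in S has all its children in S.
    So the whole subtree below c lies in S. *)
Lemma not_below_good c u : c \in S -> c != r -> par c \in S -> good S u ->
  ~~ below c u.
Proof.
move=> cS cr pS gu; apply/negP => cu.
have inS x : below c x -> [/\ x \in S, x != r & par x \in S].
  have [n] := ubnP (dep x); elim: n x => // n IH x dx.
  have [->|xr] := eqVneq x r; first by rewrite below_root (negbTE cr).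
  rewrite belowE // => /orP[/eqP<-//|]; rewrite (depS xr) in dx => /IH[//|pxS pr ppS].
  split=> //; have := ex0 pxS; rewrite /excess pr ppS /= (negbTE pr) !subr0.
  move=> /eqP; rewrite eqz_nat cards_eq0 => /eqP/setP/(_ x).
  by rewrite !inE xr eqxx !andbT => /negbFE.
have [uS ur pu] := inS u cu; move: gu; rewrite /good uS /=.
move=> /existsP[x /andP[]]; rewrite adjE ur /= => /orP[/eqP<-|/andP[xr /eqP pE]].
  by rewrite pu.
have bx : below c x by rewrite belowE // pE cu orbT.
by have [->] := inS x bx.
Qed.

Lemma prod_deg2_const (F : fieldType) (h : G -> F) :
  (forall w, w \in S -> h w != 0) ->
  (forall x, x \in S -> x != r -> par x \in S -> h (par x) = h x) ->
  \prod_(w in S) h w ^ deg2 w = 1.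
Proof.
move=> h0 hp; rewrite prod_deg2 // big1 => [|w wS]; last by rewrite ex0.
rewrite mul1r big1 // => x /and3P[xS xr pS].
by rewrite hp // divff ?h0.
Qed.

Lemma telescope_to_root (F : fieldType) (h : G -> F) v :
  (forall w, h w != 0) ->
  \prod_(x | (x != r) && below x v) (h (par x) / h x) = h r / h v.
Proof.
move=> h0; have [n] := ubnP (dep v); elim: n v => // n IH v dv.
have [->|vr] := eqVneq v r.
  rewrite divff // big1 // => x; rewrite below_root.
  by case: eqP.
rewrite (bigD1 v) ?vr ?below_refl //=.
rewrite (eq_bigl (fun x => (x != r) && below x (par v))) => [|x].
  rewrite IH; last by rewrite (depS vr) in dv.
  by rewrite mulrC mulrA mulfVK.
rewrite belowE //; have [->|] := eqVneq x v; last by rewrite andbT.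
rewrite andbF vr /=; apply/esym/negbTE/negP => /below_dep.
by rewrite (depS vr) ltnn.
Qed.

(** The edges on the path from v to the root contribute a telescoping product,
    the other edges contribute 1. *)
Lemma prod_deg2_path (F : fieldType) (h : G -> F) v :
  (forall w, h w != 0) ->
  (forall c, below c v -> c \in S) ->
  (forall x, x \in S -> x != r -> par x \in S -> ~~ below x v -> h (par x) = h x) ->
  \prod_(w in S) h w ^ deg2 w = h r / h v.
Proof.
move=> h0 vS hp; rewrite prod_deg2 // big1 => [|w wS]; last by rewrite ex0.
rewrite mul1r -(telescope_to_root v h0) big_mkcond [RHS]big_mkcond /=.
apply: eq_bigr => x _; case bx : (below x v).
  rewrite vS // andbT /=; have [//|xr] := eqVneq x r.
  rewrite vS //; move: bx; have [n] := ubnP (dep v); elim: n v {vS hp} => // n IH v dv.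
  have [->|vr] := eqVneq v r; first by rewrite below_root (negbTE xr).
  rewrite (belowE _ vr) => /orP[/eqP->|bx].
    by rewrite belowE // below_refl orbT.
  by rewrite (depS vr) in dv; rewrite belowE // IH ?orbT.
rewrite andbF; case: ifP => // /and3P[xS xr pS].
by rewrite hp ?bx // divff.
Qed.

End NoExcess.

Lemma below_within S v : r \in S -> connect (adj_within S) v r ->
  forall c, below c v -> c \in S.
Proof.
move=> rS /connectP[p pp lp] c cv; apply/negP => /negP cS.
have : below c (last v p).
  elim: p v pp cv {lp} => //= b p IH a /andP[/and3P[aS bS]].
  rewrite adjE => ab pp ca; apply: IH pp _.
  case/orP: ab => /andP[nr /eqP pE].
    by move: ca; rewrite belowE // pE => /orP[/eqP cE|//]; rewrite -cE (negbTE cS) in aS.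
  by rewrite belowE // pE ca orbT.
by rewrite -lp below_root => /eqP cE; rewrite cE rS in cS.
Qed.

End AtRoot.

(** Rooted at a vertex outside S, the tree has no negative excess. *)
Lemma ord_ge0 S : connected_graph G -> acyclic_graph G -> balanced S ->
  S != [set: G] -> 0 <= \sum_(w in S) deg2 w.
Proof.
move=> conn acyc bal; rewrite finset.eqEsubset finset.subsetT /= => /fintype.subsetPn[r _ rS].
have [par [dep rootP]] := rooted_exists r conn acyc.
by apply: (ord_ge0_root rootP) => //; rewrite /good rS.
Qed.

Lemma sum_deg2_tree : connected_graph G -> acyclic_graph G ->
  forall r : G, \sum_(w : G) deg2 w = - 2.
Proof.
move=> conn acyc r; have [par [dep rootP]] := rooted_exists r conn acyc.
have := sum_deg2 rootP [set: G].
rewrite (eq_bigl predT) => [->|w]; last by rewrite inE.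
rewrite (bigD1 r) ?inE //= big1 => [|w /andP[_ wr]].
  by rewrite /excess finset.setDT cards0 !inE eqxx.
by rewrite /excess finset.setDT cards0 !inE (negbTE wr) andbF.
Qed.

(** c is the last vertex before a path from v leaves S for the first time. *)
Lemma exists_good S v : connected_graph G -> S != [set: G] -> v \in S ->
  exists c, [/\ c \in S, connect (adj_within S) v c & exists2 x, adj c x & x \notin S].
Proof.
move=> conn; rewrite finset.eqEsubset finset.subsetT /= => /fintype.subsetPn[z _ zS] vS.
have /connectP[p pp lp] := conn v z.
move: zS; rewrite lp {lp}; elim: p v vS pp => [|b p IH] v vS /=; first by rewrite vS.
move=> /andP[vb pp] lS; have [bS|bS] := boolP (b \in S); last first.
  by exists v; split=> //; exists b.
have [c [cS bc cx]] := IH b bS pp lS; exists c; split=> //.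
by apply: connect_trans bc; apply: connect1; apply/and3P.
Qed.

End Order.

(** * The Green function of the intersection form *)

Section Green.
Variable G : plumbing.
Implicit Types (f g : G -> rat) (u v w x z : G) (A : {set G}).

(** The number - (E*_u, E*_w). *)
Definition green u w : rat :=
  - invmx (map_mx intr (inter_mx G)) (enum_rank u) (enum_rank w).

(** The intersection form as an operator on functions. Its diagonal part takes
    the place of the degree in a graph Laplacian. *)
Definition lap f u : rat := \sum_w (inter u w)%:~R * f w.

Lemma inter_sym u w : inter u w = inter w u.
Proof. by rewrite /inter eq_sym adj_sym; case: eqP => [->|]. Qed.

Lemma lapE f u : lap f u = (euler u)%:~R * f u + \sum_(w | adj u w) f w.
Proof.
rewrite /lap (bigD1 u) //= /inter eqxx; congr (_ + _).
rewrite [RHS]big_mkcond [LHS]big_mkcond /=; apply: eq_bigr => w _.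
rewrite eq_sym; have [->|_] := eqVneq u w; first by rewrite adj_irr.
by case: (adj u w); rewrite ?mul1r ?mul0r.
Qed.

Lemma lapD f g (c : rat) u : lap (fun w => f w + c * g w) u = lap f u + c * lap g u.
Proof.
rewrite /lap mulr_sumr -big_split /=; apply: eq_bigr => w _; ring.
Qed.

Lemma sum_enum_rank (F : 'I_#|G| -> rat) : \sum_i F i = \sum_(w : G) F (enum_rank w).
Proof. by rewrite (reindex enum_rank) //; apply: onW_bij; exact: enum_rank_bij. Qed.

Lemma iform_lap (x y : {ffun G -> rat}) : iform x y = \sum_u x u * lap y u.
Proof.
rewrite /iform; apply: eq_bigr => u _; rewrite /lap mulr_sumr.
by apply: eq_bigr => w _; ring.
Qed.

Hypothesis Gneg : negative_definite G.

(** Negative definiteness over the integers passes to rational functions by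
    clearing denominators. *)
Lemma lap_form_lt0 f z : f z != 0 -> \sum_u f u * lap f u < 0.
Proof.
move=> fz; pose D : int := \prod_w denq (f w).
have D0 : (0 < D%:~R :> rat).
  by rewrite ltr0z; apply: prodr_gt0 => w _; exact: denq_gt0.
have fD w : exists n : int, n%:~R = f w * D%:~R.
  rewrite /D (bigD1 w) //=; exists (numq (f w) * \prod_(i | i != w) denq (f i)).
  by rewrite !intrM mulrA -{2}(divq_num_den (f w)) mulfVK // intr_eq0 denq_neq0.
have [n nE] := boolp.choice fD.
have n0 : [ffun w => n w] != 0.
  apply/eqP => /ffunP/(_ z); rewrite !ffunE => nz; have := nE z.
  by rewrite nz => /esym/eqP; rewrite mulf_eq0 (negbTE fz) (gt_eqF D0).
have := Gneg n0; rewrite -(ltr_int rat) /iform raddf_sum /=.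
have -> : \sum_u (\sum_w [ffun w => n w] u * [ffun w => n w] w * (inter u w)%:~R)%:~R
   = (\sum_u f u * lap f u) * (D%:~R * D%:~R) :> rat.
  rewrite mulr_suml; apply: eq_bigr => u _; rewrite raddf_sum /lap mulr_sumr mulr_suml.
  by apply: eq_bigr => w _; rewrite /= !ffunE !intrM !nE intz; ring.
by rewrite pmulr_llt0 ?mulr_gt0.
Qed.

(** The form vanishes on f, since f u * lap f u does so for each u. *)
Lemma lap_uniq A f : (forall u, u \notin A -> f u = 0) ->
  (forall u, u \in A -> lap f u = 0) -> forall u, f u = 0.
Proof.
move=> fA lA z; apply/eqP; apply: contraT => /lap_form_lt0.
rewrite big1 ?ltxx // => u _; case uA: (u \in A); first by rewrite lA ?mulr0.
by rewrite fA ?mul0r ?uA.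
Qed.

Let Imx : 'M[rat]_#|G| := map_mx intr (inter_mx G).

Lemma inter_unitmx : Imx \in unitmx.
Proof.
rewrite unitmxE unitfE; apply/negP => /det0P[v v0 vI].
have : exists w, v 0 (enum_rank w) != 0.
  apply/existsP; apply: contraR v0 => /existsPn H; apply/eqP/rowP => i.
  by rewrite mxE -(enum_valK i); apply/eqP; move: (H (enum_val i)); rewrite negbK.
case=> w; apply/negP; rewrite negbK; apply/eqP.
suff H : forall u, (fun w => v 0 (enum_rank w)) u = 0 by exact: H.
apply: (@lap_uniq [set: G]%SET) => u; first by rewrite inE.
move=> _; have := congr1 (fun M : 'rV[rat]_#|G| => M 0 (enum_rank u)) vI.
rewrite !mxE => E; rewrite -[RHS]E sum_enum_rank; apply: eq_bigr => x _.
by rewrite !mxE !enum_rankK inter_sym mulrC.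
Qed.

Lemma lap_green z u : lap (fun x => green x z) u = - (u == z)%:R.
Proof.
have := congr1 (fun M : 'M[rat]_#|G| => M (enum_rank u) (enum_rank z)) (mulmxV inter_unitmx).
rewrite !mxE sum_enum_rank (inj_eq enum_rank_inj) => <-; rewrite /lap -sumrN.
by apply: eq_bigr => w _; rewrite /green !mxE !enum_rankK mulrN.
Qed.

Lemma lap_sym f g : \sum_u f u * lap g u = \sum_u g u * lap f u.
Proof.
rewrite /lap (eq_bigr (fun u => \sum_w f u * ((inter u w)%:~R * g w))) => [|u _].
  rewrite exchange_big; apply: eq_bigr => u _; rewrite mulr_sumr.
  by apply: eq_bigr => w _; rewrite inter_sym; ring.
by rewrite mulr_sumr.
Qed.

Lemma green_sym u z : green u z = green z u.
Proof.
have E a b : \sum_x green x a * lap (fun x => green x b) x = - green b a.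
  rewrite (bigD1 b) //= lap_green eqxx mulrN1 big1 ?addr0 // => x xb.
  by rewrite lap_green (negbTE xb) oppr0 mulr0.
by have := lap_sym (fun x => green x u) (fun x => green x z); rewrite !E => /oppr_inj.
Qed.

(** Maximum principle: the form would be nonnegative on the negative part of
    green _ z. *)
Lemma green_ge0 u z : 0 <= green u z.
Proof.
pose f x := green x z; pose neg x := Num.max 0 (- f x).
have neg_ge0 x : 0 <= neg x by rewrite le_max lexx.
have fneg x : 0 <= f x + neg x by rewrite /neg; case: (lerP 0 (- f x)) => ?; lra.
have fneg0 x : (f x + neg x) * neg x = 0 by rewrite /neg; case: (lerP 0 (- f x)) => ?; ring.
have [n0|n0] := eqVneq (neg u) 0; first by have := fneg u; rewrite n0 addr0.
have := lap_form_lt0 n0.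
have E : \sum_x neg x * lap f x = - neg z.
  rewrite (bigD1 z) //= lap_green eqxx mulrN1 big1 ?addr0 // => x xb.
  by rewrite lap_green (negbTE xb) oppr0 mulr0.
have : 0 <= \sum_x neg x * lap (fun w => f w + 1 * neg w) x.
  apply: sumr_ge0 => x _; rewrite lapE mulrDr addr_ge0 //.
    by rewrite mul1r mulrCA (mulrC (neg x)) fneg0 mulr0.
  by rewrite mulr_ge0 // sumr_ge0 // => w _; rewrite mul1r fneg.
rewrite (eq_bigr (fun x => neg x * lap f x + neg x * lap neg x)) => [|x _].
  by rewrite big_split /= E; have := neg_ge0 z; lra.
by rewrite lapD mul1r mulrDr.
Qed.

Hypothesis Gconn : connected_graph G.

(** A zero of green _ z spreads to the neighbours and so to the whole graph,
    which contradicts the equation at z. *)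
Lemma green_gt0 u z : 0 < green u z.
Proof.
rewrite lt0r green_ge0 andbT; apply/eqP => u0.
have step x y : adj x y -> green x z = 0 -> green y z = 0.
  move=> xy x0; have := lap_green z x; rewrite lapE x0 mulr0 add0r => E.
  have : \sum_(w | adj x w) green w z <= 0 by rewrite E oppr_le0 ler0n.
  rewrite (bigD1 y) //= => S0; apply/eqP; rewrite eq_le green_ge0 andbT.
  by apply: le_trans S0; rewrite lerDl sumr_ge0 // => w _; exact: green_ge0.
have z0 : forall y, green y z = 0.
  move=> y; have /connectP[p pp ->] := Gconn u y.
  elim: p u u0 pp => //= a p IH b b0 /andP[ba]; apply: IH; exact: step ba b0.
have := lap_green z z; rewrite /lap big1 => [|w _]; last by rewrite z0 mulr0.
by rewrite eqxx.
Qed.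

Lemma green_neq0 u z : green u z != 0.
Proof. by rewrite gt_eqF ?green_gt0. Qed.

(** The combination of f and g that vanishes at p solves the Dirichlet problem on
    A with boundary value 0. *)
Lemma harmonic_proportional A p f g :
  p \notin A ->
  (forall u w, u \in A -> adj u w -> w \in A \/ w = p) ->
  (forall u, u \in A -> lap f u = 0) -> (forall u, u \in A -> lap g u = 0) ->
  forall u, u \in A -> f u * g p = g u * f p.
Proof.
move=> pA nbr hf hg u uA.
pose h w := if w \in A then f w * g p + (- f p) * g w else 0.
have : h u = 0.
  apply: (@lap_uniq A) => [x /negbTE xA|x xA]; first by rewrite /h xA.
  have <- : lap (fun w => (fun y => 0 + g p * f y) w + (- f p) * g w) x = 0.
    rewrite lapD (lapD (fun=> 0)) hf ?hg // !mulr0 !addr0.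
    by rewrite /lap big1 // => w _; rewrite mulr0.
  rewrite !lapE /h xA; congr (_ + _); first by ring.
  apply: eq_bigr => w xw; have [->|->] := nbr _ _ xA xw; first by ring.
  by rewrite (negbTE pA); ring.
by rewrite /h uA => /eqP; rewrite mulNr subr_eq0 mulrC => /eqP; rewrite mulrC => ->; ring.
Qed.

Lemma toLQ_green (l : dual_lattice G) u : toLQ l u = - \sum_w green u w * (l w)%:~R.
Proof. by rewrite ffunE -sumrN; apply: eq_bigr => w _; rewrite /green mulNr opprK. Qed.

Lemma lap_toLQ (l : dual_lattice G) u : lap (toLQ l) u = (l u)%:~R.
Proof.
have E z : \sum_w (inter u w)%:~R * green w z = - (u == z)%:R by exact: lap_green.
rewrite /lap (eq_bigr (fun w => - \sum_z (inter u w)%:~R * green w z * (l z)%:~R)).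
  rewrite sumrN exchange_big /= (bigD1 u) //= [X in _ + X]big1 => [|z zu].
    by rewrite -mulr_suml E eqxx addr0 mulN1r opprK.
  by rewrite -mulr_suml E eq_sym (negbTE zu) mulNr mul0r oppr0.
move=> w _; rewrite toLQ_green mulrN mulr_sumr; congr (- _).
by apply: eq_bigr => z _; rewrite mulrA.
Qed.

Lemma iform_toLQ (x : {ffun G -> rat}) (l : dual_lattice G) :
  iform x (toLQ l) = \sum_u x u * (l u)%:~R.
Proof. by rewrite iform_lap; apply: eq_bigr => u _; rewrite lap_toLQ. Qed.

Lemma dual_formE (l m : dual_lattice G) :
  dual_form l m = - \sum_u \sum_w green u w * (l w)%:~R * (m u)%:~R.
Proof.
rewrite /dual_form iform_toLQ -sumrN; apply: eq_bigr => u _.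
by rewrite toLQ_green mulNr mulr_suml.
Qed.

Lemma dual_form_Estar u w : dual_form (Estar u) (Estar w) = - green u w.
Proof.
rewrite dual_formE (bigD1 w) //= [X in _ + X]big1 => [|x /negbTE xw]; last first.
  by rewrite big1 // => y _; rewrite [Estar w x]ffunE xw mulr0.
rewrite addr0 (bigD1 u) //= [X in _ + X]big1 => [|x /negbTE xw]; last first.
  by rewrite [Estar u x]ffunE xw mulr0 mul0r.
by rewrite !ffunE !eqxx addr0 !mulr1 green_sym.
Qed.

(** The product is an entry of the adjugate of - I. *)
Lemma detG_green_int u w : (detG G)%:~R * green u w \is a Num.int.
Proof.
have -> : (detG G)%:~R * green u w = ((\adj (- inter_mx G)) (enum_rank u) (enum_rank w))%:~R.
  have E : map_mx intr (- inter_mx G) = - Imx :> 'M[rat]_#|G| by rewrite map_mxN.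
  have U : - Imx \in unitmx by rewrite -scaleN1r unitmxZ ?unitrN1 ?inter_unitmx.
  have gE : green u w = invmx (- Imx) (enum_rank u) (enum_rank w).
    rewrite -scaleN1r in U *; rewrite invmxZ // invrN1 scaleN1r mxE //.
  rewrite gE /invmx U mxE mulrA -E det_map_mx mulfV ?mul1r.
    by rewrite -map_mx_adj mxE.
  by rewrite -det_map_mx E -unitfE -unitmxE.
by rewrite intr_int.
Qed.

End Green.

(** * The determinant of a tree *)

(** A permutation other than 1 with a nonzero product would strictly increase the
    sum of h over all indices. *)
Lemma det_triangular (F : fieldType) n (M : 'M[F]_n) (h : 'I_n -> nat) :
  (forall i j, i != j -> M i j != 0 -> (h i < h j)%N) ->
  \det M = \prod_i M i i.
Proof.
move=> tri; rewrite /determinant (bigD1 1%g) //= odd_perm1 expr0 mul1r.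
rewrite [X in _ + X]big1 ?addr0 => [|s s1]; first by apply: eq_bigr => i _; rewrite perm1.
suff [i Mi] : exists i, M i (s i) = 0.
  by rewrite (bigD1 i) //= Mi mul0r mulr0.
have [i si] : exists i, s i != i.
  apply/existsP; apply: contraR s1 => /existsPn H; apply/eqP/permP => i.
  by rewrite perm1; apply/eqP; have := H i; rewrite negbK.
have [/existsP[j /eqP Mj]|/existsPn N] := boolP [exists j, M j (s j) == 0].
  by exists j.
have le j : (h j <= h (s j))%N.
  by have [<-//|sj] := eqVneq j (s j); apply/ltnW/tri.
have E : (\sum_j h j = \sum_j h (s j))%N by rewrite (reindex_inj (@perm_inj _ s)).
have : (\sum_j h j < \sum_j h (s j))%N.
  rewrite (bigD1 i) //= [X in (_ < X)%N](bigD1 i) //= -addSn leq_add //.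
    by apply: tri; rewrite // eq_sym.
  by apply: leq_sum => j _.
by rewrite E ltnn.
Qed.

Section TreeDeterminant.
Variable G : plumbing.
Hypothesis Gneg : negative_definite G.
Hypothesis Gconn : connected_graph G.

Section AtRoot.
Variables (r : G) (par : G -> G) (dep : G -> nat).
Hypothesis rootP : rooted r par dep.
Let depS w : w != r -> dep w = (dep (par w)).+1. Proof. by case: rootP => _ + _; apply. Qed.
Let adjE x y : adj x y = ((x != r) && (par x == y)) || ((y != r) && (par y == x)).
Proof. by case: rootP. Qed.

Let f w := green w r.
Let f0 w : f w != 0. Proof. exact: green_neq0. Qed.
(** Elimination from the leaves to the root gives - I = L U with pivots q w. Their
    quotient form comes from the solution f of I f = - delta_r: below the root,
    the pivot equations say that f solves the homogeneous equation. *)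
Let q w := if w == r then (f r)^-1 else f (par w) / f w.
Let L z w : rat := (z == w)%:R * q w - ((w != r) && (par w == z))%:R.
Let U w y : rat := (w == y)%:R - ((w != r) && (par w == y))%:R * (q w)^-1.

Let q0 w : q w != 0.
Proof. by rewrite /q; case: ifP => _; rewrite ?invr_eq0 // mulf_neq0 ?invr_eq0. Qed.

Let par_neq w : w != r -> (par w == w) = false.
Proof. by move=> wr; apply/eqP => E; have := depS wr; rewrite E; lia. Qed.

Lemma adj_sum (F : G -> rat) z : \sum_(w | adj z w) F w =
  (if z != r then F (par z) else 0) + \sum_(w in children r par z) F w.
Proof.
have [->|zr] /= := eqVneq z r.
  by rewrite add0r; apply: eq_bigl => w; rewrite !inE adjE eqxx.
rewrite (bigD1 (par z)) /=; last by rewrite adjE zr eqxx.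
congr (_ + _); apply: eq_bigl => w; rewrite !inE adjE zr /=.
have [->|wp] /= := eqVneq w (par z); last by rewrite andbT.
apply/esym/negbTE/negP => /andP[pr /eqP pp].
by have := depS zr; have := depS pr; rewrite pp; lia.
Qed.

Lemma pivot_sum z : q z + \sum_(w in children r par z) (q w)^-1 = - (euler z)%:~R.
Proof.
have := lap_green Gneg r z; rewrite lapE adj_sum -/(f z) => E.
apply: (mulIf (f0 z)); rewrite mulrDl mulr_suml.
rewrite (eq_bigr (fun w => f w)) => [|w]; last first.
  by rewrite inE /q => /andP[/negbTE-> /eqP->]; rewrite invf_div divfK.
move: E; rewrite /q; have [->|zr] /= := eqVneq z r; first by rewrite mulVf // => ?; lra.
by rewrite divfK // => ?; lra.
Qed.

Lemma LU_entry z y : \sum_w L z w * U w y = - (inter z y)%:~R.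
Proof.
rewrite (bigD1 z) //= {1}/L eqxx mul1r.
have -> : (z != r) && (par z == z) = false by case: eqVneq => //= /par_neq.
rewrite subr0 (eq_bigr (fun w => if w \in children r par z then
    (z == y)%:R * (q w)^-1 - (w == y)%:R else 0)); last first.
  move=> w wz; rewrite /L /U inE eq_sym (negbTE wz) mul0r sub0r.
  case: andP => [[wr /eqP wE]|]; last by rewrite mulNr mul0r oppr0.
  by rewrite wr wE /= (eq_sym z) (eq_sym w); ring.
rewrite -big_mkcondr /= (eq_bigl (mem (children r par z))); last first.
  move=> w; rewrite /= inE; have [->|//] := eqVneq w z.
  by apply/esym/negbTE; case: eqVneq => //= /par_neq ->.
rewrite big_split /= -mulr_sumr sumrN.
have -> : \sum_(w in children r par z) (w == y)%:R = (y \in children r par z)%:R :> rat.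
  case yc: (y \in _); first by rewrite (bigD1 y) //= eqxx big1 ?addr0 // => w /andP[_ /negbTE->].
  by rewrite big1 // => w wc; have [wy|//] := eqVneq w y; rewrite -wy wc in yc.
rewrite /U /inter; have [<-|zy] := eqVneq z y.
  have -> : (z != r) && (par z == z) = false by case: eqVneq => //= /par_neq.
  have -> : (z \in children r par z) = false.
    by rewrite inE; case: eqVneq => //= /par_neq.
  by rewrite -pivot_sum (_ : true%:R = 1) // (_ : false%:R = 0) //; ring.
rewrite inE adjE sub0r mul0r sub0r mulrN mulrCA mulfV // mulr1.
have [[zr /eqP pz]|_] := andP; last by rewrite oppr0 add0r; case: (_ && _).
rewrite /=; case: andP => [[yr /eqP py]|_]; last by rewrite subr0.
by have := depS zr; have := depS yr; rewrite pz py; lia.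
Qed.

Lemma detG_pivots : (detG G)%:~R = \prod_w q w.
Proof.
pose LM : 'M[rat]_#|G| := \matrix_(i, j) L (enum_val i) (enum_val j).
pose UM : 'M[rat]_#|G| := \matrix_(i, j) U (enum_val i) (enum_val j).
have -> : (detG G)%:~R = \det (LM *m UM).
  rewrite /detG -det_map_mx; congr (\det _); apply/matrixP => i j.
  rewrite !mxE rmorphN /= -LU_entry sum_enum_rank.
  by apply: eq_bigr => w _; rewrite !mxE enum_rankK.
rewrite det_mulmx (@det_triangular _ _ LM (fun i => dep (enum_val i))); last first.
  move=> i j ij; rewrite mxE /L (inj_eq enum_val_inj) (negbTE ij) mul0r sub0r.
  by case: andP => [[jr /eqP <-] _|]; [rewrite (depS jr)|rewrite oppr0 eqxx].
rewrite -(det_tr UM) (@det_triangular _ _ UM^T (fun i => dep (enum_val i))); last first.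
  move=> i j ij; rewrite !mxE /U (inj_eq enum_val_inj) (eq_sym j) (negbTE ij).
  by case: andP => [[jr /eqP <-] _|]; [rewrite (depS jr)|rewrite mul0r subr0 eqxx].
have diag w : (w != r) && (par w == w) = false by case: eqVneq => //= /par_neq.
rewrite (eq_bigr (fun i => q (enum_val i))) => [|i _]; last first.
  by rewrite mxE /L eqxx diag mul1r subr0.
rewrite [X in _ * X]big1 ?mulr1 => [|i _]; last by rewrite !mxE /U eqxx diag mul0r subr0.
rewrite (reindex (@enum_rank G)) /=; last exact/onW_bij/enum_rank_bij.
by apply: eq_bigr => w _; rewrite enum_rankK.
Qed.

End AtRoot.

Variable r : G.
Hypothesis Gtree : acyclic_graph G.

Lemma detG_gt0 : 0 < detG G.
Proof.
have [par [dep rootP]] := rooted_exists r Gconn Gtree.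
rewrite -(ltr_int rat) (detG_pivots rootP); apply: prodr_gt0 => w _.
by case: ifP => _; rewrite ?invr_gt0 ?divr_gt0 ?green_gt0.
Qed.

(** Only the root has an excess when S is the whole tree, and the edges
    contribute the pivots. *)
Lemma prod_green_deg2 :
  \prod_w green w r ^ deg2 w = (detG G)%:~R / green r r.
Proof.
have [par [dep rootP]] := rooted_exists r Gconn Gtree.
have g0 w : green w r != 0 by exact: green_neq0.
have := @prod_deg2 _ _ _ _ rootP rat [set: G]%SET (fun w => green w r) (fun w _ => g0 w).
rewrite (eq_bigl predT) => [->|w]; last by rewrite inE.
rewrite (detG_pivots rootP) (bigD1 r) //= [in RHS](bigD1 r) //= eqxx.
rewrite [X in _ * X * _]big1 => [|w]; last first.
  by rewrite /excess finset.setDT cards0 !inE => /= /negbTE->; rewrite andbF.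
rewrite /excess finset.setDT cards0 !inE eqxx /= mulr1.
rewrite (eq_bigl (fun w => w != r)) => [|w]; last by rewrite !inE andbT.
rewrite [X in _ = _ * X / _](eq_bigr (fun w => green (par w) r / green w r)) => [|w /negbTE->//].
have -> : green r r ^ (0%Z - 0%Z - 2 * 1%Z) = (green r r ^+ 2)^-1 by [].
by rewrite expr2 invfM mulrAC.
Qed.

Lemma acoefE (u w : G) : (acoef u w)%:R = (detG G)%:~R * green u w :> rat.
Proof.
rewrite /acoef dual_form_Estar // mulrNN truncnK // natrEint detG_green_int //=.
by rewrite mulr_ge0 ?green_ge0 // ler0z ltW ?detG_gt0.
Qed.

Lemma acoef_gt0 (u w : G) : (0 < acoef u w)%N.
Proof.
by rewrite -(ltr_nat rat) acoefE mulr_gt0 ?green_gt0 // ltr0z detG_gt0.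
Qed.

End TreeDeterminant.

(** * Branches at a vertex *)

Definition neg_tree (G : plumbing) :=
  [/\ connected_graph G, acyclic_graph G & negative_definite G].

Lemma lap_inj (G : plumbing) (f g : G -> rat) : negative_definite G ->
  (forall u, lap f u = lap g u) -> forall u, f u = g u.
Proof.
move=> Gneg fg u; apply/eqP; rewrite -subr_eq0; apply/eqP.
suff H : forall w, (fun w => f w + (-1) * g w) w = 0 by have := H u; rewrite mulN1r.
apply: (@lap_uniq _ Gneg [set: G]%SET) => w; first by rewrite inE.
by rewrite lapD fg mulN1r subrr.
Qed.

(** The situation of a connected component A of G minus v. In a tree it has only
    one edge to v, and u is the end of this edge in A. *)
Definition is_branch (G : plumbing) (v : G) (A : {set G}) (u : G) :=
  [/\ v \notin A, u \in A, adj v u,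
      forall w x, w \in A -> adj w x -> x \in A \/ (x = v /\ w = u)
    & connected_graph (subplumbing A)].

Section Branch.
Variables (G : plumbing) (v : G).
Hypothesis Gtree : neg_tree G.

Section Components.

Let symd : connect_sym (del_adj v).
Proof.
apply: symmetric_from_pre => x y /connectP[p pp ->].
elim: p x pp => [|a p IH] x /=; first by move=> _; exact: connect0.
move=> /andP[/and3P[xw aw xa] /IH pa]; apply: connect_trans pa _.
by apply: connect1; apply/and3P; rewrite adj_sym.
Qed.

Let equiv : {in [set~ v]%SET & &, equivalence_rel (connect (del_adj v))}.
Proof.
by move=> x y z _ _ _; split=> [|xy]; [exact: connect0|exact: same_connect].
Qed.

Let partC : finset.partition (components v) [set~ v]%SET.
Proof. exact: equivalence_partitionP equiv. Qed.

Lemma mem_component (A : {set G}) x y : A \in components v -> x \in A ->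
  (y \in A) = (y != v) && connect (del_adj v) x y.
Proof.
move=> AP xA; have xv : x \in [set~ v]%SET.
  by rewrite -(cover_partition partC); apply/bigcupP; exists A.
have [/eqP yv|yv] := boolP (y == v).
  apply/negbTE/negP => yA; have : y \in [set~ v]%SET.
    by rewrite -(cover_partition partC); apply/bigcupP; exists A.
  by rewrite yv !inE eqxx.
rewrite -(def_pblock (partition_trivIset partC) AP xA).
by rewrite (pblock_equivalence_partition equiv) // !inE.
Qed.

Lemma component_cover x : x != v -> exists A : component v, x \in val A.
Proof.
move=> xv; have : x \in finset.cover (components v).
  by rewrite (cover_partition partC) !inE.
by move=> /bigcupP[A AP xA]; exists (exist _ A AP).
Qed.

Lemma component_uniq (A B : component v) x : x \in val A -> x \in val B -> A = B.
Proof.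
move=> xA xB; apply: val_inj; rewrite -(def_pblock (partition_trivIset partC) (valP A) xA).
exact: def_pblock (partition_trivIset partC) (valP B) xB.
Qed.

(** Two neighbours of v in one component would lie on a cycle through v. *)
Lemma component_branch (A : component v) : exists u, is_branch v (val A) u.
Proof.
have [conn acyc _] := Gtree; have AP := valP A.
have vA : v \notin val A.
  apply/negP => vA; have : v \in [set~ v]%SET.
    by rewrite -(cover_partition partC); apply/bigcupP; exists (val A).
  by rewrite !inE eqxx.
have [x xA] : exists x, x \in val A.
  apply/set0Pn/eqP => A0; have := partC; rewrite /finset.partition => /and3P[_ _].
  by rewrite -A0 AP.
have closed w y : w \in val A -> adj w y -> y != v -> y \in val A.
  move=> wA wy yv; rewrite (mem_component _ AP wA) yv connect1 //.
  apply/and3P; split=> //; apply/eqP => wv; by rewrite wv (negbTE vA) in wA.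
have [u uA vu] : exists2 u, u \in val A & adj v u.
  have /connectP[p pp lp] := conn x v.
  elim: p x xA pp lp => [|a p IH] x xA /=; first by move=> _ vx; rewrite -vx (negbTE vA) in xA.
  move=> /andP[xa pp] lp; have [av|av] := eqVneq a v.
    by exists x; rewrite // adj_sym -av.
  exact: IH (closed _ _ xA xa av) pp lp.
exists u; split=> // [w y wA wy|].
  have [yv|yv] := eqVneq y v; last by left; exact: closed wA wy yv.
  right; split=> //; apply: (@acyclic_neighbour_unique _ v) => //.
    by rewrite adj_sym -yv.
  by move: uA; rewrite (mem_component _ AP wA) => /andP[].
move=> [a aA] [b bA]; have := bA; rewrite (mem_component _ AP aA) => /andP[_].
move=> /connectP[p pp lp]; subst b; elim: p a aA pp bA => [|c p IH] a aA /=.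
  by move=> _ bA; rewrite (bool_irrelevance aA bA) connect0.
move=> /andP[/and3P[av cv ac] pp] lA; have cA := closed _ _ aA ac cv.
apply: connect_trans (IH c cA pp lA); apply: connect1.
by rewrite /= /sub_adj.
Qed.

End Components.

Variables (A : {set G}) (u : G).
Hypothesis br : is_branch v A u.

Let vA : v \notin A. Proof. by case: br. Qed.
Let uA : u \in A. Proof. by case: br. Qed.
Let vu : adj v u. Proof. by case: br. Qed.

Local Notation GA := (subplumbing A).

Lemma branch_adj_v w : w \in A -> adj w v = (w == u).
Proof.
move=> wA; apply/idP/eqP => [wv|->]; last by rewrite adj_sym.
have [_ _ _ cl _] := br; by have [|[]//] := cl _ _ wA wv; rewrite (negbTE vA).
Qed.

Lemma branch_adj w x : w \in A -> x \notin A -> adj w x = (w == u) && (x == v).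
Proof.
move=> wA xA; have [->|xv] := eqVneq x v; first by rewrite branch_adj_v ?andbT.
rewrite andbF; apply/negP => wx; have [_ _ _ cl _] := br.
by have [xA'|[xv' _]] := cl _ _ wA wx; [rewrite xA' in xA|rewrite xv' eqxx in xv].
Qed.

Lemma branch_neg_tree : neg_tree GA.
Proof.
have [conn acyc Gneg] := Gtree; have [_ _ _ _ connA] := br; split=> //.
  move=> s /andP[cs us]; rewrite -(size_map val); apply: acyc.
  by rewrite /ucycle cycle_map map_inj_uniq ?us ?andbT //; exact: val_inj.
move=> x x0; pose y : {ffun G -> int} := [ffun w => if insub w is Some a then x a else 0].
have yE a : y (val a) = x a by rewrite ffunE valK.
have y0 : y != 0.
  apply: contraNneq x0 => y0; apply/eqP/ffunP => a.
  by rewrite -yE y0 !ffunE.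
have yN w : w \notin A -> y w = 0 by move=> wA; rewrite ffunE insubN.
have restr (F : G -> int) : (forall w, w \notin A -> F w = 0) ->
    \sum_w F w = \sum_(a : GA) F (val a).
  move=> F0; rewrite (bigID (mem A)) /= [X in _ + X]big1 // addr0.
  exact: (big_sub (mem A)).
have := Gneg y y0; rewrite /iform restr => [|w wA]; last first.
  by rewrite big1 // => z _; rewrite yN // !mul0r.
congr (_ < 0); apply: eq_bigr => a _; rewrite restr => [|w wA]; last first.
  by rewrite (yN w) // mulr0 mul0r.
by apply: eq_bigr => b _; rewrite !yE.
Qed.

(** The only edge from A to its complement joins u to v. *)
Lemma lap_sub (f : G -> rat) (x : GA) :
  lap (fun a : GA => f (val a)) x = lap f (val x) - (val x == u)%:R * f v.
Proof.
rewrite !lapE /= -addrA; congr (_ + _); rewrite (bigID (mem A)) /=.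
rewrite [X in _ + X - _](_ : _ = (val x == u)%:R * f v); last first.
  rewrite (eq_bigl (fun w => (val x == u) && (w == v))) => [|w]; last first.
    case wA : (w \in A); last by rewrite andbT branch_adj ?wA ?(valP x).
    rewrite andbF; have [wv|_] := eqVneq w v; last by rewrite andbF.
    by move: wA; rewrite wv (negbTE vA).
  case: eqP => _; last by rewrite big_pred0 // mul0r.
  by rewrite big_pred1_eq mul1r.
rewrite addrK (eq_bigl (fun w => (w \in A) && adj (val x) w)) => [|w]; last by rewrite andbC.
by rewrite (big_sub_cond (mem A)).
Qed.

Lemma deg2_sub (x : GA) : deg2 (val x) = deg2 x + (val x == u)%:Z.
Proof.
rewrite /deg2 addrAC; congr (_ - _); rewrite -PoszD; congr (_%:Z).
have dE (K : plumbing) (w : K) : degree w = (\sum_(z | adj w z) 1)%N by rewrite sum1_card.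
rewrite !dE (bigID (mem A)) /=; congr (_ + _)%N.
  rewrite (eq_bigl (fun w => (w \in A) && adj (val x) w)) => [|w]; last by rewrite andbC.
  by rewrite (big_sub_cond (mem A)).
rewrite (eq_bigl (fun w => (val x == u) && (w == v))) => [|w]; last first.
  case wA : (w \in A); last by rewrite andbT branch_adj ?wA ?(valP x).
  rewrite andbF; have [wv|_] := eqVneq w v; last by rewrite andbF.
  by move: wA; rewrite wv (negbTE vA).
by case: eqP => _; rewrite ?big_pred1_eq ?big_pred0_eq.
Qed.

Let Gneg : negative_definite G. Proof. by case: Gtree. Qed.
Let Gconn : connected_graph G. Proof. by case: Gtree. Qed.
Let GAneg : negative_definite GA. Proof. by case: branch_neg_tree. Qed.

Let gvv : green v v != 0. Proof. exact: green_neq0. Qed.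

(** The multiple of green _ v that is subtracted makes green _ (val y) vanish at v
    and does not change its equation on A. *)
Lemma green_sub (x y : GA) :
  green x y = green (val x) (val y) - green (val x) v * green (val y) v / green v v.
Proof.
pose c := - (green (val y) v / green v v).
rewrite (lap_inj GAneg (f := fun x : GA => green x y)
  (g := fun x : GA => (fun w => green w (val y) + c * green w v) (val x))).
  by rewrite /c; ring.
move=> z; rewrite lap_green // [RHS](lap_sub (fun w => green w (val y) + c * green w v)) lapD !lap_green //.
have zv : val z != v by apply: contraNneq vA => <-; exact: (valP z).
rewrite (negbTE zv) (inj_eq val_inj) (green_sym Gneg v) /c.
by case: (z == y); case: (val z == u) => /=; field.
Qed.

Definition top : GA := exist _ u uA.

(** Seen from the branch, the value at v is a source at u. *)
Lemma green_sub_top (x : GA) : green (val x) v = green x top * green v v.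
Proof.
rewrite (lap_inj GAneg (f := fun x : GA => green (val x) v)
  (g := fun x : GA => (fun=> 0) x + green v v * green x top)) ?add0r; first by ring.
move=> z; rewrite lapD (lap_sub (fun w => green w v)) !lap_green //.
have zv : val z != v by apply: contraNneq vA => <-; exact: (valP z).
rewrite (negbTE zv) -(inj_eq val_inj) /= /lap big1 => [|w _]; last by rewrite mulr0.
by ring.
Qed.

(** Both functions are harmonic on A, and v is the only outer neighbour of A. *)
Lemma green_through (x : GA) z : z \notin A ->
  green (val x) z * green v v = green (val x) v * green v z.
Proof.
move=> zA; apply: (harmonic_proportional (A := A) (p := v) Gneg vA
  (f := fun w => green w z) (g := fun w => green w v)); last exact: (valP x).
- move=> w y wA wy; have [_ _ _ cl _] := br.
  by have [|[]] := cl _ _ wA wy; [left|right].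
- move=> w wA; rewrite lap_green //; case: eqP => [wz|_]; last by rewrite oppr0.
  by rewrite -wz wA in zA.
- move=> w wA; rewrite lap_green //; case: eqP => [wz|_]; last by rewrite oppr0.
  by move: wA; rewrite wz (negbTE vA).
Qed.

Lemma sum_sub (V : nmodType) (F : G -> V) :
  \sum_w F w = \sum_(w | w \notin A) F w + \sum_(a : GA) F (val a).
Proof. by rewrite (bigID (mem A)) /= addrC; congr (_ + _); exact: (big_sub (mem A)). Qed.

Lemma prod_sub (F : fieldType) (f : G -> F) :
  \prod_w f w = \prod_(w | w \notin A) f w * \prod_(a : GA) f (val a).
Proof. by rewrite (bigID (mem A)) /= mulrC; congr (_ * _); exact: (big_sub (mem A)). Qed.

Lemma sum_deg2_outside : \sum_(w | w \notin A) deg2 w = -1.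
Proof.
have [conn acyc _] := Gtree; have [connA acycA _] := branch_neg_tree.
have := sum_deg2_tree conn acyc v; rewrite sum_sub.
rewrite (eq_bigr (fun a : GA => deg2 a + (a == top)%:Z)) => [|a _]; last first.
  by rewrite deg2_sub -(inj_eq val_inj).
rewrite [X in _ + X]big_split (sum_deg2_tree connA acycA top) (bigD1 top) //= eqxx.
rewrite [X in _ + (_ + (_ + X))]big1 => [E|a /negbTE->//].
by apply: (@addIr _ (-1 : int)); exact: E.
Qed.

(** This is the quotient of prod_green_deg2 for G and v by prod_green_deg2 for the
    branch and u. *)
Lemma prod_green_outside :
  \prod_(w | w \notin A) green w v ^ deg2 w = (detG G)%:~R / (detG GA)%:~R.
Proof.
have [conn acyc _] := Gtree; have [connA acycA _] := branch_neg_tree.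
have [x0 y0] : green top top != 0 /\ (detG GA)%:~R != 0 :> rat.
  by rewrite green_neq0 // intr_eq0 gt_eqF // (detG_gt0 GAneg connA top).
have := prod_green_deg2 Gneg conn v acyc; rewrite prod_sub.
set P := \prod_(w | _) _.
rewrite (eq_bigr (fun a : GA => (green a top ^ deg2 a * green v v ^ deg2 a) *
   (if a == top then green top top * green v v else 1))) => [|a _]; last first.
  rewrite deg2_sub green_sub_top expfzDr ?mulf_neq0 ?green_neq0 // expfzMl.
  by rewrite -(inj_eq val_inj) /=; case: eqP => [E|_]; rewrite ?expr1z ?expr0z //; rewrite (_ : a = top) //; apply: val_inj.
rewrite big_split big_split (prod_green_deg2 GAneg connA top acycA).
have -> : \prod_(a : GA) green v v ^ deg2 a = (green v v ^+ 2)^-1.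
  rewrite (prodr_exprz _ _ _ gvv) (sum_deg2_tree connA acycA top).
  by [].
rewrite -big_mkcond /= big_pred1_eq => E.
have -> : P = P * (detG GA)%:~R / green v v * (green v v / (detG GA)%:~R).
  by field; rewrite gvv y0.
have <- : (detG G)%:~R / green v v = P * (detG GA)%:~R / green v v.
  by rewrite -E; field; rewrite gvv x0.
by field; rewrite gvv y0.
Qed.

End Branch.

(** * Products of Green functions over balanced sets *)

Section SubtreeRatio.
Variable G : plumbing.
Hypothesis Gneg : negative_definite G.
Variables (r : G) (par : G -> G) (dep : G -> nat).
Hypothesis rootP : rooted r par dep.

(** par x is the only outer neighbour of the subtree below x. *)
Lemma subtree_ratio (f g : G -> rat) x : x != r ->
  (forall y, below par dep x y -> lap f y = 0) ->
  (forall y, below par dep x y -> lap g y = 0) ->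
  f x * g (par x) = g x * f (par x).
Proof.
move=> xr hf hg; have [_ depS adjE] := rootP.
apply: (harmonic_proportional (A := [set y | below par dep x y]) Gneg).
- by rewrite inE; apply/negP => /(below_dep rootP); rewrite (depS _ xr) ltnn.
- move=> y w; rewrite !inE adjE => xy /orP[]/andP[nr /eqP E].
    move: xy; rewrite (belowE rootP _ nr) E => /orP[/eqP xy|]; last by left.
    by right; rewrite xy E.
  by left; rewrite (belowE rootP _ nr) E xy orbT.
- by move=> y; rewrite inE; exact: hf.
- by move=> y; rewrite inE; exact: hg.
- by rewrite inE below_refl.
Qed.

Lemma lap_green_below x z y : ~~ below par dep x z -> below par dep x y ->
  lap (fun w => green w z) y = 0.
Proof.
move=> xz xy; rewrite lap_green //; case: eqP => [E|_]; last by rewrite oppr0.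
by rewrite -E xy in xz.
Qed.

End SubtreeRatio.

(** Along an edge inside S the quotient of the two Green functions is constant:
    neither u nor u' is below this edge, so that both functions are harmonic
    there. *)
Lemma prod_green_good (G : plumbing) (S : {set G}) (u u' : G) : neg_tree G ->
  balanced S -> good S u -> good S u' -> \sum_(w in S) deg2 w = 0 ->
  \prod_(w in S) green w u ^ deg2 w = \prod_(w in S) green w u' ^ deg2 w.
Proof.
move=> [conn acyc neg] bal gu gu' o0; have [par [dep rootP]] := rooted_exists u conn acyc.
have g0 (a b : G) : green a b != 0 :> rat by exact: green_neq0.
have ex0 := excess0 rootP bal gu o0.
have h1 : \prod_(w in S) (green w u / green w u') ^ deg2 w = 1.
  apply: (prod_deg2_const rootP ex0) => [w _|x xS xu pS].
    by rewrite mulf_neq0 ?invr_eq0.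
  have nb := not_below_good rootP ex0 xS xu pS gu'.
  have nu : ~~ below par dep x u by rewrite (below_root rootP).
  have := subtree_ratio neg rootP xu (fun y => lap_green_below neg nu)
    (fun y => lap_green_below neg nb).
  by move=> /= E; apply/eqP; rewrite eqr_div // E mulrC.
transitivity (\prod_(w in S) (green w u / green w u') ^ deg2 w *
  \prod_(w in S) green w u' ^ deg2 w); last by rewrite h1 mul1r.
rewrite -big_split /=; apply: eq_bigr => w _.
by rewrite -expfzMl divfK.
Qed.

Section ThroughBranch.
Variables (G : plumbing) (v : G).
Hypothesis Gtree : neg_tree G.
Variables (A : {set G}) (u : G).
Hypothesis br : is_branch v A u.
Local Notation GA := (subplumbing A).
Variable S : {set G}.

Definition sub_set : {set GA} := [set a | val a \in S].

Let vA : v \notin A. Proof. by case: br. Qed.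

Lemma card_nonS_sub (a : GA) : v \in S ->
  #|[set x | adj a x & x \notin sub_set]| = #|[set x | adj (val a) x & x \notin S]|.
Proof.
move=> vS; rewrite -!sum1dep_card [RHS](bigID (mem A)) /= [X in (_ + X)%N]big1 => [|w].
  2:{ move=> /andP[/andP[aw wS] wA].
      move: aw; rewrite (branch_adj br (valP a) wA) => /andP[_ /eqP wv].
      by rewrite wv vS in wS. }
rewrite addn0 (eq_bigl (fun w => (w \in A) && (adj (val a) w && (w \notin S)))) => [|w].
  rewrite (big_sub_cond (mem A) (fun w => adj (val a) w && (w \notin S))).
  by apply: eq_bigl => b; rewrite inE.
by rewrite andbC.
Qed.

Lemma balanced_sub : v \in S -> (forall w, w \in A -> w \in S ->
    #|[set x | adj w x & x \notin S]| != 1%N) -> balanced sub_set.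
Proof. by move=> vS bal a; rewrite inE card_nonS_sub //; apply: bal; exact: (valP a). Qed.

Hypothesis outS : forall w, w \notin A -> w \in S.

Lemma ord_sub : \sum_(w in S) deg2 w =
  \sum_(a in sub_set) deg2 a + (u \in S)%:Z - 1.
Proof.
have uA : u \in A by case: br.
rewrite big_mkcond /= (sum_sub A) [X in X + _](eq_bigr (fun w => deg2 w)) => [|w /outS->//].
rewrite (sum_deg2_outside Gtree br) addrC; congr (_ + _).
rewrite (eq_bigr (fun a : GA => (if a \in sub_set then deg2 a else 0) +
  (if a == top br then (u \in S)%:Z else 0))); last first.
  move=> a _; rewrite inE (deg2_sub br) -(inj_eq val_inj) /=.
  case: eqP => [->|_]; last by rewrite !addr0.
  by case: ifP.
by rewrite big_split /= -!big_mkcond /= big_pred1_eq.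
Qed.

(** This is the case where v and its neighbours lie in S, so that v is not good.
    The quotient h of the Green functions of v and c is constant on the edges
    inside S, except on the path from v to c, where it telescopes. The same
    holds in the branch for the quotient k of the Green function of the branch
    by that of G. As green_sub, green_sub_top and green_through express all
    values through green in G, an identity between fractions remains. *)
Lemma prod_green_branch : balanced S -> u \in S -> S != [set: G] ->
  \sum_(w in S) deg2 w = 0 ->
  exists c : GA, [/\ good S (val c), good sub_set c &
    (\prod_(w in S) green w (val c) ^ deg2 w - \prod_(w in S) green w v ^ deg2 w)
      / (detG G)%:~R
    = \prod_(a in sub_set) green a c ^ deg2 a / (detG GA)%:~R].
Proof.
move=> bal uS ST o0.
have [conn acyc neg] := Gtree; have [connA acycA negA] := branch_neg_tree Gtree br.
have g0 (a b : G) : green a b != 0 :> rat by exact: green_neq0.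
have gA0 (a b : GA) : green a b != 0 :> rat by exact: green_neq0.
have d0 : (detG G)%:~R != 0 :> rat by rewrite intr_eq0 gt_eqF // (detG_gt0 neg conn v).
have dA0 : (detG GA)%:~R != 0 :> rat.
  by rewrite intr_eq0 gt_eqF // (detG_gt0 negA connA (top br)).
have balA := balanced_sub (outS vA) (fun w _ => bal w).
have oA0 : \sum_(a in sub_set) deg2 a = 0.
  by have := ord_sub; rewrite o0 uS => /esym; rewrite addrK.
have STA : sub_set != [set: GA]%SET.
  apply: contraNneq ST => /setP E; apply/eqP/setP => w; rewrite inE.
  case wA : (w \in A); last by rewrite outS ?wA.
  by have := E (exist _ w wA); rewrite !inE.
have tS : top br \in sub_set by rewrite inE.
have [c [cS tc [x cx xS]]] := exists_good connA STA tS.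
have gc : good S (val c).
  apply/orP; right; apply/existsP; exists (val x).
  by move: xS; rewrite inE => ->; rewrite andbT.
have gcA : good sub_set c by apply/orP; right; apply/existsP; exists x; rewrite cx.
exists c; split=> //.
have vS : v \in S by exact: outS.
have vu : adj v u by case: br.
have vc : connect (adj_within S) v (val c).
  apply: (connect_trans (y := u)); first by apply: connect1; apply/and3P.
  have /connectP[p pp ->] := tc; rewrite -[u]/(val (top br)).
  elim: p (top br) pp => [|b p IH] a /=; first by rewrite connect0.
  move=> /andP[/and3P[aS bS ab] /IH]; apply: connect_trans; apply: connect1.
  by apply/and3P; split=> //; [move: aS|move: bS]; rewrite inE.
have [par [dep rootP]] := rooted_exists (val c) conn acyc.
have [parA [depA rootA]] := rooted_exists c connA acycA.
have ex0 := excess0 rootP bal gc o0.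
have exA0 := excess0 rootA balA gcA oA0.
have cS' : val c \in S by move: cS; rewrite inE.
pose h w : rat := green w v / green w (val c).
have hE : \prod_(w in S) h w ^ deg2 w = h (val c) / h v.
  apply: (prod_deg2_path rootP ex0).
  - by move=> w; rewrite mulf_neq0 ?invr_eq0.
  - exact: (below_within rootP cS' vc).
  - move=> y yS yc pS nb.
    have nc : ~~ below par dep y (val c) by rewrite (below_root rootP).
    have /= E := subtree_ratio neg rootP yc (fun y => lap_green_below neg nc)
      (fun y => lap_green_below neg nb).
    by apply/eqP; rewrite eqr_div // mulrC E.
pose k (a : GA) : rat := green a c / green (val a) (val c).
have kE : \prod_(a in sub_set) k a ^ deg2 a = k c / k (top br).
  apply: (prod_deg2_path rootA exA0).
  - by move=> w; rewrite mulf_neq0 ?invr_eq0.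
  - exact: (below_within rootA cS tc).
  - move=> y yS yc pS nb.
    have nc : ~~ below parA depA y c by rewrite (below_root rootA).
    have /= E := subtree_ratio (g := fun a : GA => green (val a) (val c)) negA rootA yc
      (fun y => lap_green_below negA nc).
    apply/eqP; rewrite eqr_div // mulrC -E // => z yz.
    rewrite (lap_sub br (fun w => green w (val c))) lap_green //.
    rewrite (inj_eq val_inj).
    have -> : (z == c) = false by apply/eqP => zc; rewrite -zc yz in nc.
    have -> : (val z == u) = false.
      apply/eqP => zt; move/negP: nb; apply; suff <- : z = top br by [].
      exact: val_inj.
    by rewrite mul0r subr0 oppr0.
pose P := \prod_(w in S) green w (val c) ^ deg2 w.
pose Q := \prod_(a in sub_set) green a c ^ deg2 a.
have PvE : \prod_(w in S) green w v ^ deg2 w = P * (h (val c) / h v).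
  rewrite -hE -big_split /=; apply: eq_bigr => w _.
  by rewrite -expfzMl /h mulrC divfK.
have QE : \prod_(a in sub_set) green (val a) (val c) ^ deg2 a * (k c / k (top br)) = Q.
  rewrite -kE -big_split /=; apply: eq_bigr => a _.
  by rewrite -expfzMl /k mulrC divfK.
have out_c w : w \notin A -> green w (val c) = green w v * (green (val c) v / green v v).
  move=> wA; have := green_through Gtree br c wA; rewrite green_sym // => E.
  apply: (mulIf (g0 v v)); rewrite E (green_sym neg v w); field; exact: g0.
have PE : P = (green (val c) v / green v v)^-1 * ((detG G)%:~R / (detG GA)%:~R) *
    (\prod_(a in sub_set) green (val a) (val c) ^ deg2 a * green u (val c)).
  rewrite /P big_mkcond (prod_sub A) /=; congr (_ * _).
    rewrite (eq_bigr (fun w => green w v ^ deg2 w *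
      (green (val c) v / green v v) ^ deg2 w)) => [|w wA]; last first.
      by rewrite outS // out_c // expfzMl.
    rewrite big_split /= (prod_green_outside Gtree br) mulrC; congr (_ * _).
    have q0 : green (val c) v / green v v != 0 by rewrite mulf_neq0 ?invr_eq0.
    rewrite (prodr_exprz _ _ _ q0) (sum_deg2_outside Gtree br).
    by rewrite exprN1.
  rewrite (eq_bigr (fun a : GA => (if a \in sub_set then green (val a) (val c) ^ deg2 a else 1) *
     (if a == top br then green u (val c) else 1))) => [|a _].
    by rewrite big_split /= -!big_mkcond /= big_pred1_eq.
  rewrite inE (deg2_sub br) -(inj_eq val_inj) /=; case: eqP => [->|_].
    by rewrite uS expfzDr ?expr1z.
  by rewrite addr0 mulr1.
have kt : green (top br) c = green (val c) v / green v v.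
  by rewrite green_sym // (green_sub_top Gtree br) mulfK.
have kc : green c c = green (val c) (val c) - green (val c) v * green (val c) v / green v v.
  exact: (green_sub Gtree br).
rewrite PvE -/P -/Q -QE PE /h /k /= kt.
rewrite (green_sym neg v (val c)) in hE PvE *.
move: (gA0 c c) (g0 u (val c)) (g0 v v) (g0 (val c) v) (g0 (val c) (val c)) d0 dA0.
rewrite kc; move: (\prod_(a in sub_set) _) (green u (val c)) (green v v) => R guc gvv.
move: (green (val c) v) (green (val c) (val c)) (detG G)%:~R (detG GA)%:~R.
by move=> gcv gcc d dA _ n1 n2 n3 n4 n5 n6; field; rewrite n1 n2 n3 n4 n5 n6.
Qed.

End ThroughBranch.

(** * Characters of the discriminant group *)

Section Characters.
Local Open Scope classical_set_scope.
Variable C : numClosedFieldType.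

(** rho([l]) for the character rho with rho([E*_w]) = x w. *)
Definition monom (G : plumbing) (x : {ffun G -> C}) (l : {ffun G -> int}) : C :=
  \prod_w x w ^ l w.

(** The relations come from the generators E_u of L in the basis E*_w. *)
Definition is_char (G : plumbing) (x : {ffun G -> C}) :=
  (forall w, x w != 0) /\ (forall u, \prod_w x w ^ inter u w = 1).

Section OnGraph.
Variable G : plumbing.
Implicit Types (x : {ffun G -> C}) (l m : {ffun G -> int}).

Lemma monomD x l m : (forall w, x w != 0) -> monom x (l + m) = monom x l * monom x m.
Proof.
by move=> x0; rewrite -big_split /=; apply: eq_bigr => w _; rewrite ffunE expfzDr.
Qed.

Lemma monom_neq0 x l : (forall w, x w != 0) -> monom x l != 0.
Proof. by move=> x0; apply/prodf_neq0 => w _; rewrite expfz_neq0. Qed.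

Lemma monom_Estar x w : monom x (Estar w) = x w.
Proof.
rewrite /monom (bigD1 w) //= ffunE eqxx expr1z big1 ?mulr1 // => u uw.
by rewrite ffunE (negbTE uw) expr0z.
Qed.

Lemma monom_L x (c : {ffun G -> int}) : is_char x -> monom x (L_to_dual c) = 1.
Proof.
move=> [x0 xr]; rewrite /monom.
rewrite (eq_bigr (fun u => \prod_w x u ^ (c w * inter w u))) => [|u _]; last first.
  by rewrite ffunE -(prodr_exprz _ _ _ (x0 u)).
rewrite exchange_big big1 // => w _ /=.
rewrite (eq_bigr (fun u => (x u ^ inter w u) ^ c w)) => [|u _]; last first.
  by rewrite exprz_exp mulrC.
have M : {morph (fun y : C => y ^ c w) : a b / a * b >-> a * b}.
  by move=> a b; rewrite expfzMl.
by rewrite -(big_morph _ M (exp1rz C (c w))) xr exp1rz.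
Qed.

Lemma discr_classD l m : discr_class (l + m : dual_lattice G) =
  discr_class (l : dual_lattice G) + discr_class (m : dual_lattice G).
Proof. exact: raddfD. Qed.

Lemma discr_class_eq (l m : dual_lattice G) : discr_class l = discr_class m ->
  exists c, l = m + L_to_dual c.
Proof.
move=> /eqP; rewrite -Quotient.idealrBE => /asboolP[c cE].
by exists c; rewrite -cE addrC subrK.
Qed.

Lemma discr_class_repr (h : discr G) : discr_class (generic_quotient.repr h) = h.
Proof. by rewrite /discr_class generic_quotient.reprK. Qed.

Definition chval (rho : discr G -> C) : {ffun G -> C} :=
  [ffun w => rho (discr_class (Estar w))].

Lemma dual_group_neq0 (rho : discr G -> C) h : dual_group rho -> rho h != 0.
Proof.
move=> [r0 rD]; apply/eqP => h0; have := rD h (- h).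
by rewrite subrr r0 h0 mul0r => /eqP; rewrite oner_eq0.
Qed.

Lemma dual_group_monom (rho : discr G -> C) (l : dual_lattice G) : dual_group rho ->
  rho (discr_class l) = monom (chval rho) l.
Proof.
move=> dr; have [r0 rD] := dr.
have rN h : rho (- h) = (rho h)^-1.
  apply: (mulIf (dual_group_neq0 h dr)); rewrite mulVf ?dual_group_neq0 //.
  by rewrite -rD addNr.
have rMn h n : rho (h *+ n) = rho h ^+ n.
  by elim: n => [|n IH]; rewrite ?mulr0n ?expr0 // mulrS exprS rD IH.
have rMz h (n : int) : rho (h *~ n) = rho h ^ n.
  case: n => n; first exact: rMn.
  by rewrite NegzE mulrNz rN -pmulrn rMn exprnN.
have zE (a : {ffun G -> int}) (n : int) u : (a *~ n) u = a u *~ n.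
  case: n => n; first exact: ffunMnE.
  by rewrite !NegzE !mulrNz ffunE; congr (- _); exact: ffunMnE.
have {1}-> : l = \sum_w Estar w *~ l w.
  apply/ffunP => u; rewrite sum_ffunE (bigD1 u) //= big1 => [|w wu].
    by rewrite zE ffunE eqxx addr0 intz.
  by rewrite zE ffunE eq_sym (negbTE wu) mul0rz.
have dS (I : Type) (s : seq I) (F : I -> dual_lattice G) :
    rho (discr_class (\sum_(i <- s) F i)) = \prod_(i <- s) rho (discr_class (F i)).
  elim: s => [|i s IH]; first by rewrite !big_nil /discr_class raddf0 r0.
  by rewrite !big_cons -IH discr_classD rD.
rewrite dS /monom; apply: eq_bigr => w _; rewrite ffunE -rMz; congr rho.
exact: raddfMz.
Qed.

Lemma discr_class_L (c : {ffun G -> int}) : discr_class (L_to_dual c) = 0.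
Proof.
have -> : 0 = discr_class (0 : dual_lattice G) by rewrite /discr_class raddf0.
by apply/eqP; rewrite -Quotient.idealrBE subr0; apply/asboolP; exists c.
Qed.

Lemma chval_char (rho : discr G -> C) : dual_group rho -> is_char (chval rho).
Proof.
move=> dr; split=> [w|u]; first by rewrite ffunE dual_group_neq0.
have := dual_group_monom (L_to_dual [ffun w => (w == u)%:R]) dr.
rewrite discr_class_L dr.1 => E; rewrite [RHS]E; apply: eq_bigr => w _; congr (_ ^ _).
rewrite ffunE (bigD1 u) //= ffunE eqxx mul1r big1 ?addr0 // => z zu.
by rewrite ffunE (negbTE zu) mul0r.
Qed.

Lemma chval_inj (rho rho' : discr G -> C) : dual_group rho -> dual_group rho' ->
  chval rho = chval rho' -> rho = rho'.
Proof.
move=> dr dr' E; apply: funext => h; rewrite -(discr_class_repr h).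
by rewrite !dual_group_monom // E.
Qed.

Lemma chval_surj (x : {ffun G -> C}) : is_char x -> exists2 rho, dual_group rho & chval rho = x.
Proof.
move=> xc; have [x0 xr] := xc; pose rho (h : discr G) := monom x (generic_quotient.repr h).
have rhoE (l : dual_lattice G) : rho (discr_class l) = monom x l.
  have [c cE] := discr_class_eq (discr_class_repr (discr_class l)).
  by rewrite /rho cE monomD // monom_L // mulr1.
exists rho; last by apply/ffunP => w; rewrite ffunE rhoE monom_Estar.
split=> [|g h].
  by rewrite -(discr_class_L 0) rhoE monom_L.
rewrite -(discr_class_repr g) -(discr_class_repr h) -discr_classD !rhoE.
exact: monomD.
Qed.

Definition one_char : {ffun G -> C} := [ffun=> 1].

Lemma one_is_char : is_char one_char.
Proof.
split=> [w|u]; first by rewrite ffunE oner_neq0.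
by rewrite big1 // => w _; rewrite ffunE exp1rz.
Qed.

Lemma trivial_dual : dual_group (@trivial_char C G).
Proof. by split=> // *; rewrite /trivial_char mulr1. Qed.

Lemma chval_trivial : chval (@trivial_char C G) = one_char.
Proof. by apply/ffunP => w; rewrite !ffunE. Qed.

(** The matrix d I^-1 is integral, so that d annihilates L'/L. *)
Lemma char_root x w : negative_definite G -> is_char x -> x w ^ detG G = 1.
Proof.
move=> neg xc; pose c : {ffun G -> int} := [ffun z => - Num.floor ((detG G)%:~R * green z w)].
have cE z : (c z)%:~R = - ((detG G)%:~R * green z w) :> rat.
  rewrite ffunE rmorphN /=; congr (- _); apply/esym/eqP.
  by rewrite eq_sym -intrEfloor; exact: detG_green_int.
rewrite -(monom_L c xc) /monom (bigD1 w) //=.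
have E u : L_to_dual c u = if u == w then detG G else 0.
  apply: (@intr_inj rat); rewrite ffunE rmorph_sum /=.
  transitivity (- (detG G)%:~R * lap (fun z => green z w) u).
    rewrite /lap mulr_sumr; apply: eq_bigr => z _.
    by rewrite rmorphM /= cE (inter_sym z); ring.
  by rewrite lap_green //; case: eqP => _ /=; rewrite ?mulrNN ?mulr1 ?oppr0 ?mulr0.
rewrite E eqxx big1 ?mulr1 // => u /negbTE uw.
by rewrite E uw expr0z.
Qed.

Definition char_set : set {ffun G -> C} := [set x | is_char x].

Lemma char_set_finite : negative_definite G -> 0 < detG G -> finite_set char_set.
Proof.
move=> neg; case dE : (detG G) => [n|//] n0.
have [rs rsE] := closed_field_poly_normal ('X^n - 1 : {poly C}).
pose s := [seq [ffun w => val (f w)] | f : {ffun G -> seq_sub rs}].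
apply: (@sub_finite_set _ _ [set` s]); last by apply/finite_seqP; exists s.
move=> x xc /=; have xr w : x w \in rs.
  have : root ('X^n - 1) (x w).
    rewrite rootE !hornerE; have := char_root w neg xc.
    by rewrite dE exprnP => ->; rewrite subrr.
  have m1 : lead_coef ('X^n - 1 : {poly C}) = 1.
    by rewrite lead_coefDl ?lead_coefXn // size_polyXn size_polyN size_poly1 ltnS.
  by rewrite rsE m1 scale1r root_prod_XsubC.
apply/mapP; exists [ffun w => SeqSub (xr w)]; first by rewrite mem_enum.
by apply/ffunP => w; rewrite !ffunE.
Qed.

Definition chars : seq {ffun G -> C} := finmap.enum_fset (fset_set char_set).

Lemma chars_uniq : uniq chars. Proof. exact: finmap.fset_uniq. Qed.

Hypothesis Gtree : neg_tree G.

Let fin : finite_set char_set.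
Proof.
have [conn acyc neg] := Gtree.
have [v _|G0] := pickP (@predT G).
  exact: char_set_finite neg (detG_gt0 neg conn v acyc).
apply: (sub_finite_set _ (finite_set1 one_char)) => x _ /=.
by apply/ffunP => w; have := G0 w.
Qed.

Lemma mem_chars x : (x \in chars) = `[< is_char x >].
Proof. by rewrite -[LHS]/(x \in fset_set char_set) in_fset_set. Qed.

Lemma sum_dual_group (V : nmodType) (F : (discr G -> C) -> V) (F' : {ffun G -> C} -> V) :
  (forall rho, dual_group rho -> F rho = F' (chval rho)) ->
  \sum_(rho \in @dual_group C G) F rho = \sum_(x <- chars) F' x.
Proof.
move=> FE; rewrite -[RHS](fsbig_finite _ _ fin) (reindex_fsbig chval (@dual_group C G)).
  by apply: eq_fsbigr => rho /set_mem /FE.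
split.
- by move=> rho /chval_char.
- by move=> rho rho' /set_mem dr /set_mem dr'; exact: chval_inj.
- by move=> x /chval_surj[rho dr <-]; exists rho.
Qed.

Lemma sum_dual_group_nontrivial (V : nmodType) (F : (discr G -> C) -> V)
    (F' : {ffun G -> C} -> V) :
  (forall rho, dual_group rho -> rho <> @trivial_char C G -> F rho = F' (chval rho)) ->
  \sum_(rho \in @dual_group C G `\ @trivial_char C G) F rho =
  \sum_(x <- chars | x != one_char) F' x.
Proof.
move=> FE; have fin' : finite_set (char_set `\ one_char) by exact: finite_setD.
rewrite -[RHS]big_filter.
have -> : \sum_(x <- [seq x <- chars | x != one_char]) F' x =
    \sum_(x <- fset_set (char_set `\ one_char)) F' x.
  apply: perm_big; apply: uniq_perm; rewrite ?filter_uniq ?chars_uniq ?finmap.fset_uniq //.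
  move=> x; rewrite mem_filter mem_chars in_fset_set //.
  apply/andP/idP => [[x1 /asboolP xc]|]; first by apply/mem_set; split=> //; exact/eqP.
  by move=> /set_mem[xc /eqP x1]; split=> //; exact/asboolP.
rewrite -(fsbig_finite _ _ fin').
rewrite (reindex_fsbig chval (@dual_group C G `\ @trivial_char C G)).
  by apply: eq_fsbigr => rho /set_mem [dr /FE]; apply.
split.
- move=> rho [dr rt]; split; first exact: chval_char.
  by rewrite -chval_trivial => /(chval_inj dr trivial_dual).
- by move=> rho rho' /set_mem[dr _] /set_mem[dr' _]; exact: chval_inj.
- move=> x [/chval_surj[rho dr <-] x1]; exists rho => //; split=> // rt.
  by apply: x1; rewrite rt chval_trivial.
Qed.

End OnGraph.
End Characters.

(** * Values and jets of rational functions *)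

Section FieldIdentities.
Variable K : fieldType.
Implicit Types x y z q d c f g h k : K.

Lemma cancel_coord q x d z : x != 0 -> d != 0 -> z != 0 ->
  q * x / d / (z^-1 * x) = z * q / d.
Proof. by move=> *; field; do ?[apply/andP; split]. Qed.

Lemma divXn2 y c g : y != 0 -> (c * y ^+ 2 + y ^+ 3 * g) / y ^+ 2 = c + y * g.
Proof. by move=> y0; field. Qed.

Lemma jetD_identity (c0 c1 c2 d0 d1 d2 h k y : K) :
  c0 + c1 * y + c2 * y ^+ 2 + y ^+ 3 * h + (d0 + d1 * y + d2 * y ^+ 2 + y ^+ 3 * k) =
  c0 + d0 + (c1 + d1) * y + (c2 + d2) * y ^+ 2 + y ^+ 3 * (h + k).
Proof. by ring. Qed.

Lemma jetM_identity (c0 c1 c2 d0 d1 d2 h k y : K) :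
  (c0 + c1 * y + c2 * y ^+ 2 + y ^+ 3 * h) * (d0 + d1 * y + d2 * y ^+ 2 + y ^+ 3 * k) =
  c0 * d0 + (c0 * d1 + c1 * d0) * y + (c0 * d2 + c1 * d1 + c2 * d0) * y ^+ 2 +
  y ^+ 3 * ((c1 * d2 + c2 * d1) + c2 * d2 * y + (c0 + c1 * y + c2 * y ^+ 2) * k
    + h * (d0 + d1 * y + d2 * y ^+ 2) + y ^+ 3 * (h * k)).
Proof. by ring. Qed.

Lemma jetV_identity (f c0 c1 c2 e0 e1 e2 h y : K) : f != 0 ->
  f = c0 + c1 * y + c2 * y ^+ 2 + y ^+ 3 * h ->
  c0 * e0 = 1 -> c0 * e1 + c1 * e0 = 0 -> c0 * e2 + c1 * e1 + c2 * e0 = 0 ->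
  f^-1 = e0 + e1 * y + e2 * y ^+ 2 + y ^+ 3 *
    (- (((c1 * e2 + c2 * e1) + c2 * e2 * y + h * (e0 + e1 * y + e2 * y ^+ 2)) * f^-1)).
Proof.
move=> f0 fE E0 E1 E2; apply: (mulfI f0); rewrite mulfV //.
set R := _ + h * _.
rewrite mulrDr mulrN mulrN (_ : f * (y ^+ 3 * (R * f^-1)) = y ^+ 3 * R); last by field.
rewrite fE; apply/eqP; rewrite eq_sym -subr_eq0; apply/eqP.
transitivity ((c0 * e0 - 1) + (c0 * e1 + c1 * e0) * y
  + (c0 * e2 + c1 * e1 + c2 * e0) * y ^+ 2); first by rewrite /R; ring.
by rewrite E0 E1 E2; ring.
Qed.

End FieldIdentities.

Section RationalFunctions.
Variable C : numClosedFieldType.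
Local Notation F := {fraction {poly C}}.
Local Notation "c %:K" := (@ratfun_const C c) (at level 2, format "c %:K").
Local Notation XF := (tofrac 'X : F).
Implicit Types (f g : F) (c e z : C) (p q n d : {poly C}).

Lemma constD c e : (c + e)%:K = c%:K + e%:K.
Proof. by rewrite /ratfun_const polyCD tofracD. Qed.
Lemma constM c e : (c * e)%:K = c%:K * e%:K.
Proof. by rewrite /ratfun_const polyCM tofracM. Qed.
Lemma constN c : (- c)%:K = - c%:K.
Proof. by rewrite /ratfun_const polyCN tofracN. Qed.
Lemma const0 : 0%:K = 0. Proof. by rewrite /ratfun_const polyC0 tofrac0. Qed.
Lemma const1 : 1%:K = 1. Proof. by rewrite /ratfun_const polyC1 tofrac1. Qed.
Lemma const_eq0 c : (c%:K == 0) = (c == 0).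
Proof. by rewrite /ratfun_const tofrac_eq0 polyC_eq0. Qed.

HB.instance Definition _ := GRing.isZmodMorphism.Build C F (@ratfun_const C)
  (fun x y => etrans (constD x (- y)) (congr1 (fun w => x%:K + w) (constN y))).
HB.instance Definition _ := GRing.isMonoidMorphism.Build C F (@ratfun_const C)
  (const1, constM).

Section AtPoint.
Variable z : C.

(** f has no pole at z, and its value there is c. *)
Definition regv f c := exists n d, [/\ d.[z] != 0, f = tofrac n / tofrac d & c = n.[z] / d.[z]].

Definition isreg f := exists c, regv f c.

Let d_neq0 d : d.[z] != 0 -> tofrac d != 0.
Proof. by move=> dz; rewrite tofrac_eq0; apply: contraNneq dz => ->; rewrite horner0. Qed.

Lemma regv_tofrac p : regv (tofrac p) p.[z].
Proof. by exists p, 1; rewrite hornerC oner_neq0 tofrac1 !divr1. Qed.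

Lemma regv_const c : regv c%:K c.
Proof. by have := regv_tofrac c%:P; rewrite hornerC. Qed.

Lemma regvD f g c e : regv f c -> regv g e -> regv (f + g) (c + e).
Proof.
move=> [n [d [dz -> ->]]] [n' [d' [dz' -> ->]]].
exists (n * d' + n' * d), (d * d'); rewrite hornerD !hornerM; split.
- by rewrite mulf_neq0.
- by rewrite tofracD !tofracM addf_div ?d_neq0.
- by rewrite addf_div.
Qed.

Lemma regvM f g c e : regv f c -> regv g e -> regv (f * g) (c * e).
Proof.
move=> [n [d [dz -> ->]]] [n' [d' [dz' -> ->]]].
exists (n * n'), (d * d'); rewrite !hornerM mulf_neq0 //; split=> //.
  by rewrite !tofracM mulf_div.
by rewrite mulf_div.
Qed.

Lemma regvV f c : c != 0 -> regv f c -> regv f^-1 c^-1.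
Proof.
move=> c0 [n [d [dz -> cE]]]; exists d, n; split.
- by apply: contraNneq c0; rewrite cE => ->; rewrite mul0r.
- by rewrite invf_div.
- by rewrite cE invf_div.
Qed.

Lemma regvN f c : regv f c -> regv (- f) (- c).
Proof. by move=> /(regvM (regv_const (-1))); rewrite constN const1 !mulN1r. Qed.

Lemma regvB f g c e : regv f c -> regv g e -> regv (f - g) (c - e).
Proof. by move=> fc /regvN; exact: regvD. Qed.

Lemma regvXn f c k : regv f c -> regv (f ^+ k) (c ^+ k).
Proof.
move=> fc; elim: k => [|k IH]; last by rewrite !exprS; exact: regvM.
by rewrite !expr0 -const1; exact: regv_const.
Qed.

Lemma regvXz f c (k : int) : c != 0 -> regv f c -> regv (f ^ k) (c ^ k).
Proof.
move=> c0 fc; case: k => k; first exact: regvXn.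
by rewrite NegzE -!exprnN; apply: regvV; [rewrite expf_neq0|exact: regvXn].
Qed.

Lemma regv_sum (I : Type) (s : seq I) (P : pred I) (h : I -> F) (v : I -> C) :
  (forall i, P i -> regv (h i) (v i)) -> regv (\sum_(i <- s | P i) h i) (\sum_(i <- s | P i) v i).
Proof.
move=> hv; apply: (big_rec2 (fun c f => regv f c)) => [|i c f /hv]; last exact: regvD.
by rewrite -const0; exact: regv_const.
Qed.

Lemma regv_prod (I : Type) (s : seq I) (P : pred I) (h : I -> F) (v : I -> C) :
  (forall i, P i -> regv (h i) (v i)) -> regv (\prod_(i <- s | P i) h i) (\prod_(i <- s | P i) v i).
Proof.
move=> hv; apply: (big_rec2 (fun c f => regv f c)) => [|i c f /hv]; last exact: regvM.
by rewrite -const1; exact: regv_const.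
Qed.

Lemma regv_tofrac_inj p c : regv (tofrac p) c -> c = p.[z].
Proof.
move=> [n [d [dz pE ->]]]; have : tofrac (p * d) = tofrac n.
  by rewrite tofracM pE divfK ?d_neq0.
move=> /eqP; rewrite tofrac_eq => /eqP <-; rewrite hornerM mulfK //.
Qed.

Lemma regv_neq0 f c : c != 0 -> regv f c -> f != 0.
Proof.
move=> c0 [n [d [dz -> cE]]]; rewrite mulf_neq0 ?invr_eq0 ?d_neq0 //.
by apply: contraNneq c0; rewrite cE => ->; rewrite mul0r.
Qed.

Hypothesis z0 : z != 0.

(** The local coordinate X / z, whose value at z is 1. *)
Definition coordT : F := tofrac (z^-1 *: 'X).
Local Notation T := coordT.

Lemma coordTE : XF = z%:K * T.
Proof.
by rewrite /coordT /ratfun_const -tofracM -mul_polyC mulrA -polyCM mulfV // mul1r.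
Qed.

Lemma regvT : regv T 1.
Proof. by have := regv_tofrac (z^-1 *: 'X); rewrite !hornerE mulVf. Qed.

Lemma coordT1 : T - 1 = tofrac (z^-1 *: ('X - z%:P)).
Proof.
by rewrite /coordT -tofrac1 -tofracB scalerBr -!mul_polyC -polyCM mulVf.
Qed.

Lemma coordT_neq1 : T - 1 != 0.
Proof.
by rewrite coordT1 tofrac_eq0 scaler_eq0 invr_eq0 (negbTE z0) polyXsubC_eq0.
Qed.

Lemma isreg_div f : regv f 0 -> isreg (f / (T - 1)).
Proof.
move=> [n [d [dz -> nE]]].
have /factor_theorem[q ->] : root n z.
  by rewrite rootE; move/esym/eqP: nE; rewrite mulf_eq0 invr_eq0 (negbTE dz) orbF.
exists (z * q.[z] / d.[z]); exists (z *: q), d; split=> //; last by rewrite hornerZ.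
have xz : tofrac ('X - z%:P) != 0 :> F by rewrite tofrac_eq0 polyXsubC_eq0.
rewrite coordT1 -!mul_polyC !tofracM -/(ratfun_const _) -/(ratfun_const _) fmorphV /=.
apply: cancel_coord; [exact: xz|exact: d_neq0|].
by rewrite const_eq0.
Qed.

(** Expansion to second order at z in the local parameter T - 1. *)
Definition jet f c0 c1 c2 := exists2 g, isreg g &
  f = c0%:K + c1%:K * (T - 1) + c2%:K * (T - 1) ^+ 2 + (T - 1) ^+ 3 * g.

Lemma isregD f g : isreg f -> isreg g -> isreg (f + g).
Proof. by move=> [c fc] [e ge]; exists (c + e); exact: regvD. Qed.
Lemma isregM f g : isreg f -> isreg g -> isreg (f * g).
Proof. by move=> [c fc] [e ge]; exists (c * e); exact: regvM. Qed.
Lemma isreg_const c : isreg c%:K. Proof. by exists c; exact: regv_const. Qed.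
Lemma isregY : isreg (T - 1).
Proof. by exists (1 - 1); apply: regvB regvT _; rewrite -const1; exact: regv_const. Qed.
Lemma isregN f : isreg f -> isreg (- f).
Proof. by move=> [c fc]; exists (- c); exact: regvN. Qed.
Lemma isregXn f k : isreg f -> isreg (f ^+ k).
Proof. by move=> [c fc]; exists (c ^+ k); exact: regvXn. Qed.

Lemma regvY : regv (T - 1) 0.
Proof. by rewrite -(subrr 1); apply: regvB regvT _; rewrite -const1; exact: regv_const. Qed.

Lemma jet_regv f c0 c1 c2 : jet f c0 c1 c2 -> regv f c0.
Proof.
move=> [g [e ge] ->].
have := regvD (regvD (regvD (regv_const c0) (regvM (regv_const c1) regvY))
  (regvM (regv_const c2) (regvXn 2 regvY))) (regvM (regvXn 3 regvY) ge).
by rewrite !expr0n /= !mulr0 mul0r !addr0.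
Qed.

Lemma jet_div f c2 : jet f 0 0 c2 -> regv (f / (T - 1) ^+ 2) c2.
Proof.
move=> [g [e ge] ->]; rewrite const0 mul0r !add0r.
rewrite divXn2 ?coordT_neq1 //.
by have := regvD (regv_const c2) (regvM regvY ge); rewrite mul0r addr0.
Qed.

Lemma jet_eq f c0 c1 c2 e0 e1 e2 : jet f c0 c1 c2 -> c0 = e0 -> c1 = e1 -> c2 = e2 ->
  jet f e0 e1 e2.
Proof. by move=> + <- <- <-. Qed.

Lemma jetD f g c0 c1 c2 e0 e1 e2 : jet f c0 c1 c2 -> jet g e0 e1 e2 ->
  jet (f + g) (c0 + e0) (c1 + e1) (c2 + e2).
Proof.
move=> [h hr ->] [k kr ->]; exists (h + k); first exact: isregD.
by rewrite !constD jetD_identity.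
Qed.

Lemma jet_const c : jet c%:K c 0 0.
Proof. by exists 0; [rewrite -const0; exact: isreg_const|rewrite const0 !mul0r mulr0 !addr0]. Qed.

Lemma jetT : jet T 1 1 0.
Proof. exists 0; first by rewrite -const0; exact: isreg_const.
by rewrite const0 const1 mul1r mul0r mulr0 !addr0 addrC subrK. Qed.

Lemma jetM f g c0 c1 c2 e0 e1 e2 : jet f c0 c1 c2 -> jet g e0 e1 e2 ->
  jet (f * g) (c0 * e0) (c0 * e1 + c1 * e0) (c0 * e2 + c1 * e1 + c2 * e0).
Proof.
move=> [h hr ->] [k kr ->].
exists ((c1%:K * e2%:K + c2%:K * e1%:K) + c2%:K * e2%:K * (T - 1)
  + (c0%:K + c1%:K * (T - 1) + c2%:K * (T - 1) ^+ 2) * k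
  + h * (e0%:K + e1%:K * (T - 1) + e2%:K * (T - 1) ^+ 2) + (T - 1) ^+ 3 * (h * k)).
  by repeat (first [assumption|exact: isregY|apply: isreg_const|apply: isregXn|apply: isregM|apply: isregD]).
by rewrite !(constD, constM) jetM_identity.
Qed.

Lemma jetV f c0 c1 c2 : c0 != 0 -> jet f c0 c1 c2 ->
  jet f^-1 c0^-1 (- c1 / c0 ^+ 2) ((c1 ^+ 2 - c0 * c2) / c0 ^+ 3).
Proof.
move=> c00 fj; have fc := jet_regv fj; have f0 := regv_neq0 c00 fc.
have fi : isreg f^-1 by exists c0^-1; exact: regvV.
case: fj => h hr fE.
set e0 := c0^-1; set e1 := - c1 / _; set e2 := _ / c0 ^+ 3.
have E0 : c0%:K * e0%:K = 1 by rewrite -constM -const1; congr (_%:K); rewrite /e0 mulfV.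
have E1 : c0%:K * e1%:K + c1%:K * e0%:K = 0.
  by rewrite -!constM -constD -const0; congr (_%:K); rewrite /e0 /e1; field.
have E2 : c0%:K * e2%:K + c1%:K * e1%:K + c2%:K * e0%:K = 0.
  by rewrite -!constM -!constD -const0; congr (_%:K); rewrite /e0 /e1 /e2; field.
exists (- (((c1%:K * e2%:K + c2%:K * e1%:K) + c2%:K * e2%:K * (T - 1)
  + h * (e0%:K + e1%:K * (T - 1) + e2%:K * (T - 1) ^+ 2)) * f^-1)).
  by apply: isregN; repeat (first [assumption|exact: isregY|apply: isreg_const|apply: isregXn|apply: isregM|apply: isregD]).
exact: jetV_identity f0 fE E0 E1 E2.
Qed.

(** The jet of c exp (l1 Y + l2 Y^2) with Y = T - 1. In this form the coefficients
    of a product with integral exponents are linear in the exponents. *)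
Definition logjet f c l1 l2 := c != 0 /\ jet f c (c * l1) (c * (l1 ^+ 2 / 2 + l2)).

Lemma logjetM f g c l1 l2 e m1 m2 : logjet f c l1 l2 -> logjet g e m1 m2 ->
  logjet (f * g) (c * e) (l1 + m1) (l2 + m2).
Proof.
move=> [c0 fj] [e0 gj]; split; first by rewrite mulf_neq0.
by apply: jet_eq (jetM fj gj) _ _ _ => //; [ring|field].
Qed.

Lemma logjetV f c l1 l2 : logjet f c l1 l2 -> logjet f^-1 c^-1 (- l1) (- l2).
Proof.
move=> [c0 fj]; split; first by rewrite invr_eq0.
by apply: jet_eq (jetV c0 fj) _ _ _ => //; field.
Qed.

Lemma logjet1 : logjet 1 1 0 0.
Proof.
split; first exact: oner_neq0.
by rewrite -{1}const1; apply: jet_eq (jet_const 1) _ _ _ => //; ring.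
Qed.

Lemma logjetXn f c l1 l2 k : logjet f c l1 l2 ->
  logjet (f ^+ k) (c ^+ k) (k%:R * l1) (k%:R * l2).
Proof.
move=> fj; elim: k => [|k IH]; first by rewrite !expr0 !mul0r; exact: logjet1.
rewrite !exprS -add1n natrD !mulrDl !mul1r; exact: logjetM.
Qed.

Lemma logjetXz f c l1 l2 (k : int) : logjet f c l1 l2 ->
  logjet (f ^ k) (c ^ k) (k%:~R * l1) (k%:~R * l2).
Proof.
move=> fj; case: k => k; first exact: logjetXn.
by rewrite NegzE -!exprnN rmorphN /= !mulNr; apply/logjetV/logjetXn.
Qed.

Lemma logjet_prod (I : finType) (h : I -> F) (c l1 l2 : I -> C) :
  (forall i, logjet (h i) (c i) (l1 i) (l2 i)) ->
  logjet (\prod_i h i) (\prod_i c i) (\sum_i l1 i) (\sum_i l2 i).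
Proof.
move=> hj; elim: (index_enum I) => [|i s IH]; first by rewrite !big_nil; exact: logjet1.
by rewrite !big_cons; exact: logjetM.
Qed.

(** log T = Y - Y^2 / 2 + O(Y^3), where Y = T - 1. *)
Lemma logjetT : logjet T 1 1 (- 1 / 2).
Proof.
split; first exact: oner_neq0.
by apply: jet_eq jetT _ _ _ => //; field.
Qed.

Lemma logjetTn k : logjet (T ^+ k) 1 k%:R (- k%:R / 2).
Proof.
have := logjetXn k logjetT; rewrite expr1n mulr1.
by rewrite (_ : k%:R * (- 1 / 2) = - k%:R / 2 :> C) //; field.
Qed.

Lemma jet_geometric a : jet (\sum_(j < a) T ^+ j) a%:R (a%:R * (a%:R - 1) / 2)
   (a%:R * (a%:R - 1) * (a%:R - 2) / 6).
Proof.
elim: a => [|a IH].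
  rewrite big_ord0 -const0; apply: jet_eq (jet_const 0) _ _ _ => //; by rewrite !mul0r.
rewrite big_ord_recr /=; have [_ jT] := logjetTn a.
have E : a.+1%:R = a%:R + 1 :> C by rewrite -addn1 natrD.
by apply: jet_eq (jetD IH jT) _ _ _; rewrite E //; field.
Qed.

Lemma logjet_geometric a : (0 < a)%N -> logjet (\sum_(j < a) T ^+ j) a%:R
  ((a%:R - 1) / 2) ((a%:R - 1) * (a%:R - 5) / 24).
Proof.
move=> a0; split; first by rewrite pnatr_eq0 -lt0n.
by apply: jet_eq (jet_geometric a) _ _ _ => //; field.
Qed.

End AtPoint.

(** In lowest terms, a nonconstant denominator has a root, where the numerator does
    not vanish. *)
Lemma regular_polynomial f : (forall z, isreg z f) -> exists p, f = tofrac p.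
Proof.
move=> fr; have [_ [n [d [d0 fE _]]]] := fr 0.
have dn0 : d != 0 by apply: contraNneq d0 => ->; rewrite horner0.
pose g := gcdp n d; pose n' := n %/ g; pose d' := d %/ g.
have g0 : g != 0 by rewrite gcdp_eq0 negb_and dn0 orbT.
have nE : n = n' * g by rewrite divpK ?dvdp_gcdl.
have dE : d = d' * g by rewrite divpK ?dvdp_gcdr.
have d'0 : d' != 0 by apply: contraNneq dn0; rewrite dE => ->; rewrite mul0r.
have cop : coprimep d' n' by rewrite coprimep_sym coprimep_div_gcd // dn0 orbT.
have fE' : f = tofrac n' / tofrac d'.
  by rewrite fE nE dE !tofracM -mulf_div mulfV ?mulr1 // tofrac_eq0.
have [/size_poly1P[c c0 dc]|] := boolP (size d' == 1%N).
  exists (c^-1 *: n'); rewrite fE' dc -mul_polyC tofracM mulrC.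
  by rewrite -/(ratfun_const _) -/(ratfun_const _) fmorphV /=.
move=> /closed_rootP[z dz]; have [_ [m [e [ez fE2 _]]]] := fr z.
have e0 : tofrac e != 0 :> F.
  by rewrite tofrac_eq0; apply: contraNneq ez => ->; rewrite horner0.
have : tofrac (n' * e) = tofrac (m * d').
  have d't : tofrac d' != 0 :> F by rewrite tofrac_eq0.
  by apply/eqP; rewrite !tofracM -(eqr_div _ _ d't e0) -fE' -fE2.
move=> /eqP; rewrite tofrac_eq => /eqP/(congr1 (horner^~ z)).
rewrite !hornerM (eqP (dz : d'.[z] == 0)) mulr0 => /eqP.
rewrite mulf_eq0 (negbTE ez) orbF => nz.
by have := coprimep_root cop dz; rewrite nz.
Qed.

(** Negative degree, the zero function included. *)
Definition proper_frac f := exists n d, [/\ d != 0, (size n < size d)%N & f = tofrac n / tofrac d].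

Lemma proper_fracD f g : proper_frac f -> proper_frac g -> proper_frac (f + g).
Proof.
move=> [n [d [d0 nd ->]]] [n' [d' [d0' nd' ->]]].
exists (n * d' + n' * d), (d * d'); split; first by rewrite mulf_neq0.
  rewrite size_mul //; apply: leq_ltn_trans (size_polyD _ _) _.
  have s0 : (0 < size d)%N by rewrite size_poly_gt0.
  have s0' : (0 < size d')%N by rewrite size_poly_gt0.
  have h1 := size_polyMleq n d'; have h2 := size_polyMleq n' d.
  rewrite gtn_max; apply/andP; split.
    have aux a b k : (a < b -> 0 < k -> (a + k).-1 < (b + k).-1)%N by lia.
    exact: leq_ltn_trans h1 (aux _ _ _ nd s0').
  have aux a b k : (a < b -> 0 < k -> (a + k).-1 < (k + b).-1)%N by lia.
  exact: leq_ltn_trans h2 (aux _ _ _ nd' s0).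
by rewrite tofracD !tofracM addf_div ?tofrac_eq0.
Qed.

Lemma proper_frac0 : proper_frac 0.
Proof.
by exists 0, 1; rewrite oner_neq0 size_poly0 size_poly1 tofrac0 mul0r.
Qed.

Lemma proper_fracMc c f : proper_frac f -> proper_frac (c%:K * f).
Proof.
move=> [n [d [d0 nd ->]]]; exists (c *: n), d; split=> //.
  by apply: leq_ltn_trans nd; exact: size_scale_leq.
by rewrite -mul_polyC tofracM mulrA.
Qed.

Lemma proper_fracN f : proper_frac f -> proper_frac (- f).
Proof. by move=> /(proper_fracMc (-1)); rewrite constN const1 mulN1r. Qed.

Lemma proper_frac_sum (I : Type) (s : seq I) (P : pred I) (h : I -> F) :
  (forall i, P i -> proper_frac (h i)) -> proper_frac (\sum_(i <- s | P i) h i).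
Proof.
move=> hP; apply: (big_ind proper_frac) => //; [exact: proper_frac0|exact: proper_fracD].
Qed.

Lemma proper_frac_polynomial p : proper_frac (tofrac p) -> p = 0.
Proof.
move=> [n [d [d0 nd pE]]]; apply/eqP; apply: contraLR nd => p0.
have /eqP : tofrac (p * d) = tofrac n by rewrite tofracM pE divfK // tofrac_eq0.
rewrite tofrac_eq => /eqP <-; rewrite size_mul // -leqNgt.
have aux a b : (0 < a -> b <= (a + b).-1)%N by lia.
by apply: aux; rewrite size_poly_gt0.
Qed.

Lemma polynomial_partE f g p : proper_frac g -> f = tofrac p + g -> polynomial_part f = p.
Proof.
move=> gp fE; have pp : is_polynomial_part f p.
  by have [n [d [d0 nd gE]]] := gp; exists n, d; rewrite fE addrAC subrr add0r.
rewrite /polynomial_part; case: xgetP => [q qE|/(_ p)//] [n [d [d0 nd qd]]].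
apply/eqP; rewrite -subr_eq0; apply/eqP/proper_frac_polynomial.
have -> : tofrac (q - p) = g - (f - tofrac q) by rewrite fE tofracB; ring.
by apply: proper_fracD => //; apply: proper_fracN; exists n, d.
Qed.

End RationalFunctions.

(** * The torsion as a sum of regularised products *)

Section RegularizedProduct.
Variables (C : numClosedFieldType) (G : plumbing).
Implicit Types (z : {ffun G -> C}) (a : G -> nat).

Definition ones z : {set G} := [set w | z w == 1].
(** The order of vanishing at t = 1 of Pprod z a below. *)
Definition ord z : int := \sum_(w in ones z) deg2 w.

(** The value at t = 1 of Pprod z a t / (1 - t) ^ ord z. *)
Definition Preg z a : C :=
  \prod_w (if z w == 1 then (a w)%:R else 1 - z w) ^ deg2 w.

(** The limit of Pprod z a at t = 1 when ord z >= 0. *)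
Definition pval z a : C := if ord z == 0 then Preg z a else 0.

Section Field.
Variables (K : fieldType) (iota : {rmorphism C -> K}).

Definition Pprod z a (t : K) : K := \prod_w (1 - iota (z w) * t ^+ a w) ^ deg2 w.

(** Pprod without its factors 1 - t. *)
Definition Pfac z a (t : K) : K :=
  \prod_w (if z w == 1 then \sum_(j < a w) t ^+ j else 1 - iota (z w) * t ^+ a w) ^ deg2 w.

Lemma Pprod_factor z a t : t != 1 -> Pprod z a t = (1 - t) ^ ord z * Pfac z a t.
Proof.
move=> t1; have t0 : 1 - t != 0 by rewrite subr_eq0 eq_sym.
rewrite /ord -(prodr_exprz _ _ _ t0).
rewrite big_mkcond -big_split /=; apply: eq_bigr => w _; rewrite inE.
case: ifP => [/eqP->|_]; last by rewrite mul1r.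
by rewrite rmorph1 mul1r -expfzMl -opprB subrX1 -mulNr opprB.
Qed.

End Field.

Lemma Preg_split z a : Preg z a =
  \prod_(w in ones z) (a w)%:R ^ deg2 w * \prod_(w | w \notin ones z) (1 - z w) ^ deg2 w.
Proof.
rewrite /Preg (bigID (mem (ones z))) /=; congr (_ * _); apply: eq_bigr => w.
  by rewrite inE => ->.
by rewrite inE => /negbTE->.
Qed.

Section Regular.
Variable p : C.
Hypothesis p0 : p != 0.
Local Notation T := (coordT p).

Lemma regv_geometric n : regv p (\sum_(j < n) T ^+ j) n%:R.
Proof.
rewrite (_ : n%:R = \sum_(j < n) 1 ^+ j :> C).
  by apply: regv_sum => j _; apply: regvXn; exact: regvT.
by rewrite (eq_bigr (fun=> 1)) => [|j _]; rewrite ?expr1n // sumr_const card_ord.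
Qed.

Lemma regv_Pfac z a : (forall w, (0 < a w)%N) -> regv p (Pfac (@ratfun_const C) z a T) (Preg z a).
Proof.
move=> a0; apply: regv_prod => w _; case: (z w =P 1) => [_|/eqP z1].
  by apply: regvXz; [rewrite pnatr_eq0 -lt0n a0|exact: regv_geometric].
apply: regvXz; first by rewrite subr_eq0 eq_sym.
apply: regvB; first by rewrite -const1; exact: regv_const.
by have := regvM (regv_const p (z w)) (regvXn (a w) (regvT p0)); rewrite expr1n mulr1.
Qed.

Lemma regv_pow_pval (V : {fraction {poly C}}) (n : int) (c : C) : 0 <= n -> regv p V c ->
  regv p ((1 - T) ^ n * V) (if n == 0 then c else 0).
Proof.
case: n => // n _ Vc; have [/eqP nE|nE] := boolP (Posz n == 0).
  by rewrite nE expr0z mul1r.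
have Y0 : regv p (1 - T) (1 - 1).
  by apply: regvB (regvT p0); rewrite -const1; exact: regv_const.
have := regvM (regvXn n Y0) Vc; rewrite subrr expr0n.
by rewrite (_ : (n == 0)%N = false) ?mul0r //; apply/negbTE.
Qed.

Lemma regv_Pprod z a : (forall w, (0 < a w)%N) -> 0 <= ord z ->
  regv p (Pprod (@ratfun_const C) z a T) (pval z a).
Proof.
move=> a0 o0; rewrite Pprod_factor; last by rewrite -subr_eq0 coordT_neq1.
by apply: regv_pow_pval => //; exact: regv_Pfac.
Qed.

End Regular.

Local Open Scope classical_set_scope.

Lemma cvg_exprn (F : set_system C) (FF : ProperFilter F) (f : C -> C) (c : C) k :
  f t @[t --> F] --> c -> f t ^+ k @[t --> F] --> c ^+ k.
Proof.
move=> fc; elim: k => [|k IH].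
  by under eq_fun do rewrite expr0; rewrite expr0; exact: cvg_cst.
by under eq_fun do rewrite exprS; rewrite exprS; exact: cvgM.
Qed.

Lemma cvg_exprz (F : set_system C) (FF : ProperFilter F) (f : C -> C) (c : C) (n : int) :
  c != 0 -> f t @[t --> F] --> c -> f t ^ n @[t --> F] --> c ^ n.
Proof.
move=> c0 fc.
case: n => n; first exact: cvg_exprn.
rewrite NegzE -exprnN; under eq_fun do rewrite -exprnN.
by apply: cvgV; [rewrite expf_neq0|exact: cvg_exprn].
Qed.

Lemma cvg_prod_seq (F : set_system C) (FF : ProperFilter F) (I : Type) (s : seq I)
    (f : I -> C -> C) (c : I -> C) :
  (forall i, f i t @[t --> F] --> c i) ->
  \prod_(i <- s) f i t @[t --> F] --> \prod_(i <- s) c i.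
Proof.
move=> fc; elim: s => [|i s IH].
  by under eq_fun do rewrite big_nil; rewrite big_nil; exact: cvg_cst.
by under eq_fun do rewrite big_cons; rewrite big_cons; exact: cvgM.
Qed.

Lemma cvg_sum_seq (F : set_system C) (FF : ProperFilter F) (I : Type) (s : seq I)
    (f : I -> C -> C) (c : I -> C) :
  (forall i, f i t @[t --> F] --> c i) ->
  \sum_(i <- s) f i t @[t --> F] --> \sum_(i <- s) c i.
Proof.
move=> fc; elim: s => [|i s IH].
  by under eq_fun do rewrite big_nil; rewrite big_nil; exact: cvg_cst.
by under eq_fun do rewrite big_cons; rewrite big_cons; exact: cvgD.
Qed.

Lemma lim_Pprod z a : (forall w, (0 < a w)%N) -> 0 <= ord z ->
  lim (Pprod idfun z a t @[t --> (1 : C)^']) = pval z a.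
Proof.
move=> a0 o0; apply: cvg_lim; first exact: norm_hausdorff.
have t1 : t @[t --> (1 : C)^'] --> (1 : C) by exact: nbhs_dnbhs.
have E : {near (1 : C)^', (fun t => (1 - t) ^ ord z * Pfac idfun z a t) =1
    (fun t => Pprod idfun z a t)}.
  near=> t; rewrite Pprod_factor //; near: t; exact: nbhs_dnbhs_neq.
apply: cvg_trans; first exact: near_eq_cvg E.
have fac : Pfac idfun z a t @[t --> (1 : C)^'] --> Preg z a.
  apply: cvg_prod_seq => w; case: (z w =P 1) => [_|/eqP z1].
    apply: cvg_exprz; first by rewrite pnatr_eq0 -lt0n a0.
    rewrite (_ : (a w)%:R = \sum_(j < a w) 1 ^+ j :> C).
      by apply: cvg_sum_seq => j; exact: cvg_exprn.
    by rewrite (eq_bigr (fun=> 1)) => [|j _]; rewrite ?expr1n // sumr_const card_ord.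
  apply: cvg_exprz; first by rewrite subr_eq0 eq_sym.
  apply: cvgB; first exact: cvg_cst.
  have E1 : z w = z w * 1 ^+ a w by rewrite expr1n mulr1.
  by rewrite [X in _ --> X]E1; apply: cvgM; [exact: cvg_cst|exact: cvg_exprn].
rewrite /pval; move: o0; case oE : (ord z) => [n|//] _.
have [/eqP nE|nE] := boolP (Posz n == 0).
  by rewrite nE; under eq_fun do rewrite expr0z mul1r.
rewrite -(mul0r (Preg z a)); apply: cvgM fac.
have -> : (0 : C) = (1 - 1) ^+ n.
  by rewrite subrr expr0n (_ : (n == 0)%N = false) //; apply/negbTE.
by apply: cvg_exprn; apply: cvgB => //; exact: cvg_cst.
Unshelve. all: by end_near.
Qed.

End RegularizedProduct.

Section CharacterOrders.
Local Open Scope classical_set_scope.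
Variables (C : numClosedFieldType) (G : plumbing).
Implicit Types (x z : {ffun G -> C}).

Definition nonone_neighbours z w : {set G} := [set u | adj w u & u \notin ones z].

Lemma relation_neighbours z w : z w = 1 ->
  \prod_u z u ^ inter w u = \prod_(u in nonone_neighbours z w) z u.
Proof.
move=> zw; rewrite [RHS]big_mkcond /=; apply: eq_bigr => u _.
rewrite !inE /inter; have [<-|wu] := eqVneq w u; first by rewrite zw eqxx adj_irr exp1rz.
case: (adj w u) => //=.
by case: (z u =P 1) => [->|_] //=; rewrite exp1rz.
Qed.

Lemma relation_balanced z w : z w = 1 -> \prod_u z u ^ inter w u = 1 ->
  #|nonone_neighbours z w| != 1%N.
Proof.
move=> zw; rewrite relation_neighbours // => E; apply/negP => /cards1P[u uE].
have : u \in nonone_neighbours z w by rewrite uE inE.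
by rewrite !inE => /andP[_ /eqP[]]; move: E; rewrite uE big_set1.
Qed.

Lemma char_balanced x : is_char x -> balanced (ones x).
Proof. by move=> [_ xr] w; rewrite inE => /eqP xw; exact: relation_balanced. Qed.

Lemma ones_setT z : (ones z == [set: G]%SET) = (z == one_char C G).
Proof.
apply/eqP/eqP => [/setP E|->]; last by apply/setP => w; rewrite !inE ffunE eqxx.
by apply/ffunP => w; have := E w; rewrite !inE ffunE => /eqP.
Qed.

Hypothesis Gtree : neg_tree G.

(** The factors d that relate acoef to green cancel, as the exponents sum to 0. *)
Lemma ratr_acoef_prod (S : {set G}) u : \sum_(w in S) deg2 w = 0 ->
  \prod_(w in S) (acoef w u)%:R ^ deg2 w = ratr (\prod_(w in S) green w u ^ deg2 w) :> C.
Proof.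
have [conn acyc neg] := Gtree => o0.
have d0 : (detG G)%:~R != 0 :> rat by rewrite intr_eq0 gt_eqF // (detG_gt0 neg conn u).
have -> : \prod_(w in S) green w u ^ deg2 w =
    \prod_(w in S) ((acoef w u)%:R : rat) ^ deg2 w.
  transitivity (\prod_(w in S) ((detG G)%:~R : rat) ^ deg2 w * \prod_(w in S) green w u ^ deg2 w).
    rewrite (prodr_exprz _ _ _ d0) o0 expr0z mul1r //.
  by rewrite -big_split /=; apply: eq_bigr => w _; rewrite acoefE // expfzMl.
rewrite rmorph_prod; apply: eq_bigr => w _.
by rewrite fmorphXz /= ratr_nat.
Qed.

(** This makes the terms of the torsion independent of the choice of u_rho. *)
Lemma pval_good z u u' : balanced (ones z) -> good (ones z) u -> good (ones z) u' ->
  pval z (fun w => acoef w u) = pval z (fun w => acoef w u').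
Proof.
move=> bal gu gu'; rewrite /pval; case: eqP => // o0.
by rewrite !Preg_split !ratr_acoef_prod // (prod_green_good Gtree bal gu gu').
Qed.

Lemma char_ord_ge0 x : is_char x -> x != one_char C G -> 0 <= ord x.
Proof.
have [conn acyc neg] := Gtree.
by move=> xc x1; apply: ord_ge0 => //; [exact: char_balanced|rewrite ones_setT].
Qed.

Lemma torsion_choice_good (uG : (discr G -> C) -> G) rho : torsion_choice uG ->
  dual_group rho -> rho <> @trivial_char C G -> good (ones (chval rho)) (uG rho).
Proof.
move=> huG dr rt; rewrite /good inE ffunE.
have [/eqP ->//|[w uw /eqP rw]] := huG rho dr rt.
by apply/orP; right; apply/existsP; exists w; rewrite uw inE ffunE.
Qed.

Lemma torsionE (uG : (discr G -> C) -> G) (s : spincX G) (g : {ffun G -> C} -> G) :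
  torsion_choice uG ->
  (forall x, is_char x -> x != one_char C G -> good (ones x) (g x)) ->
  torsion uG (spinc_boundary s) = (detG G)%:~R^-1 *
    \sum_(x <- chars C G | x != one_char C G)
       (monom x (spincX_coord s))^-1 * pval x (fun w => acoef w (g x)).
Proof.
move=> huG gP; have [conn acyc neg] := Gtree; rewrite /torsion; congr (_ * _).
apply: (sum_dual_group_nontrivial Gtree) => rho dr rt.
have xc := chval_char dr.
have x1 : chval rho != one_char C G.
  apply/eqP; rewrite -chval_trivial => E; apply: rt.
  exact: chval_inj dr (trivial_dual C G) E.
rewrite /torsion_hat /spinc_boundary /spincM_act /= addr0 dual_group_monom //.
congr (_ * _); rewrite -(pval_good (char_balanced xc) (torsion_choice_good huG dr rt) (gP _ xc x1)).
rewrite -(@lim_Pprod C G (chval rho)).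
- have -> // : [eta Prat id rho (uG rho)] =
      Pprod idfun (chval rho) (fun w => acoef w (uG rho)) :> (C -> C).
  by apply: funext => t; apply: eq_bigr => w _; rewrite ffunE.
- by move=> w; rewrite acoef_gt0.
- exact: char_ord_ge0.
Qed.

End CharacterOrders.

(** * Characters supported on a branch *)

Section BranchCharacters.
Variables (C : numClosedFieldType) (G : plumbing) (v : G).
Hypothesis Gtree : neg_tree G.
Variables (A : {set G}) (u : G).
Hypothesis br : is_branch v A u.
Local Notation GA := (subplumbing A).
Implicit Types (z : {ffun G -> C}) (y : {ffun GA -> C}).

Let vA : v \notin A. Proof. by case: br. Qed.
Let uA : u \in A. Proof. by case: br. Qed.
Let vu : adj v u. Proof. by case: br. Qed.

Definition ext y : {ffun G -> C} :=
  [ffun w => if insub w is Some a then y a else 1].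
Definition restr z : {ffun GA -> C} := [ffun a => z (val a)].

Lemma ext_in y (a : GA) : ext y (val a) = y a.
Proof. by rewrite ffunE valK. Qed.

Lemma ext_out y w : w \notin A -> ext y w = 1.
Proof. by move=> wA; rewrite ffunE insubN. Qed.

Lemma ext_top y : ext y u = y (top br).
Proof. exact: (ext_in y (top br)). Qed.

Lemma ext_inj : injective ext.
Proof. by move=> y y' E; apply/ffunP => a; rewrite -!ext_in E. Qed.

Lemma restrK z : (forall w, w \notin A -> z w = 1) -> ext (restr z) = z.
Proof.
move=> z1; apply/ffunP => w; case wA: (w \in A); last by rewrite ext_out ?z1 ?wA.
by rewrite -[w]/(val (exist _ w wA : GA)) ext_in ffunE.
Qed.

Lemma ext_neq0 y : (forall a, y a != 0) -> forall w, ext y w != 0.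
Proof. by move=> y0 w; rewrite ffunE; case: insubP => [a _ _|_]; rewrite ?oner_neq0. Qed.

Lemma inter_branch w x : w \in A -> x \notin A -> inter w x = ((w == u) && (x == v))%:R.
Proof.
move=> wA xA; rewrite /inter (branch_adj br wA xA).
by case: eqP => // wx; rewrite -wx wA in xA.
Qed.

Lemma ext_prod y (f : G -> int) :
  \prod_w ext y w ^ f w = \prod_(a : GA) y a ^ f (val a).
Proof.
rewrite (prod_sub A) big1 ?mul1r => [|w wA]; last by rewrite ext_out // exp1rz.
by apply: eq_bigr => a _; rewrite ext_in.
Qed.

Lemma ext_rel y w : is_char y -> w != v -> \prod_x ext y x ^ inter w x = 1.
Proof.
move=> [y0 yr] wv; rewrite ext_prod; case wA: (w \in A); last first.
  rewrite big1 // => a _; rewrite inter_sym inter_branch ?wA ?(valP a) ?(negbTE wv) ?andbF //.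
rewrite -[RHS](yr (exist _ w wA)); apply: eq_bigr => a _; congr (_ ^ _).
Qed.

Lemma ext_rel_v y : \prod_x ext y x ^ inter v x = y (top br).
Proof.
rewrite ext_prod (bigD1 (top br)) //= big1 ?mulr1 => [|a au].
  by rewrite inter_sym inter_branch ?eqxx.
rewrite inter_sym inter_branch ?(valP a) // (_ : (val a == u) = false) //.
by apply/negbTE; apply: contraNneq au => E; apply/eqP/val_inj.
Qed.

Lemma restr_char z : (forall w, z w != 0) ->
  (forall w, w != v -> \prod_x z x ^ inter w x = 1) ->
  (forall w, w \notin A -> z w = 1) -> is_char (restr z).
Proof.
move=> z0 zr z1; split=> [a|a]; first by rewrite ffunE.
have av : val a != v by apply: contraNneq vA => <-; exact: (valP a).
rewrite -[RHS](zr _ av) -[in RHS](restrK z1) ext_prod; apply: eq_bigr => b _.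
by rewrite /inter -(inj_eq val_inj).
Qed.

Lemma monom_ext y (l : dual_lattice G) : monom (ext y) l = monom y (dual_restrict A l).
Proof. by rewrite /monom ext_prod; apply: eq_bigr => a _; rewrite ffunE. Qed.

Lemma ext_one y : (ext y == one_char C G) = (y == one_char C GA).
Proof.
apply/eqP/eqP => [E|->].
  by apply/ffunP => a; rewrite -ext_in E !ffunE.
by apply/ffunP => w; rewrite !ffunE; case: insubP => // a _ _; rewrite ffunE.
Qed.

Lemma ones_out y w : w \notin A -> w \in ones (ext y).
Proof. by move=> wA; rewrite inE ext_out. Qed.

Lemma ones_ext y : sub_set A (ones (ext y)) = ones y.
Proof. by apply/setP => a; rewrite !inE ext_in. Qed.

Lemma ord_ext y : ord (ext y) = ord y + (y (top br) == 1)%:Z - 1.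
Proof.
by rewrite /ord (ord_sub Gtree br (@ones_out y)) ones_ext inE ext_top.
Qed.

(** By green_sub_top, acoef _ v is a multiple of acoef _ (top br) on the branch, and
    the constant cancels as ord y = 0. The vertices outside A contribute
    prod_green_outside. The factor 1 - y (top br) is there because the top
    vertex has one neighbour more in G. *)
Lemma Preg_ext y : y (top br) != 1 -> ord y = 0 ->
  Preg (ext y) (fun w => acoef w v) =
  (1 - y (top br)) * Preg y (fun a => acoef a (top br)) / (detG GA)%:~R.
Proof.
move=> yu oy; have [conn acyc neg] := Gtree.
have GAtree := branch_neg_tree Gtree br; have [connA acycA negA] := GAtree.
have d0 : (detG G)%:~R != 0 :> rat by rewrite intr_eq0 gt_eqF // (detG_gt0 neg conn v).
have dA0 : (detG GA)%:~R != 0 :> rat.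
  by rewrite intr_eq0 gt_eqF // (detG_gt0 negA connA (top br)).
have yu0 : 1 - y (top br) != 0 by rewrite subr_eq0 eq_sym.
have gvv : green v v != 0 by exact: green_neq0.
have out : \prod_(w | w \notin A) (acoef w v)%:R ^ deg2 w = (detG GA)%:~R^-1 :> C.
  rewrite -ratr_int -fmorphV.
  transitivity (ratr (\prod_(w | w \notin A) (acoef w v)%:R ^ deg2 w) : C).
    by rewrite rmorph_prod; apply: eq_bigr => w _; rewrite fmorphXz /= ratr_nat.
  congr ratr; rewrite (eq_bigr (fun w => ((detG G)%:~R : rat) ^ deg2 w * green w v ^ deg2 w)); last first.
    by move=> w _; rewrite acoefE // expfzMl.
  rewrite big_split /= (prod_green_outside Gtree br).
  rewrite (prodr_exprz _ _ _ d0) (sum_deg2_outside Gtree br) exprN1.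
  by rewrite mulrA mulVf // mul1r.
rewrite /Preg (prod_sub A) (eq_bigr (fun w => (acoef w v)%:R ^ deg2 w)); last first.
  by move=> w wA; rewrite ext_out // eqxx.
rewrite out mulrC; congr (_ * _).
pose r : C := ratr ((detG G)%:~R * green v v / (detG GA)%:~R).
have r0 : r != 0 by rewrite fmorph_eq0 !mulf_neq0 ?invr_eq0.
have aE (a : GA) : (acoef (val a) v)%:R = r * (acoef a (top br))%:R :> C.
  rewrite -[LHS](ratr_nat _) -[X in _ * X](ratr_nat _) -rmorphM !acoefE //; congr ratr.
  by rewrite (green_sub_top Gtree br); field.
transitivity ((\prod_(a : GA | a \in ones y) r ^ deg2 a) *
   (\prod_(a : GA) ((if y a == 1 then (acoef a (top br))%:R else 1 - y a) ^ deg2 a *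
   (if a == top br then 1 - y (top br) else 1)))); last first.
  rewrite (prodr_exprz _ _ _ r0) -/(ord y) oy expr0z mul1r.
  by rewrite big_split /= -big_mkcond /= big_pred1_eq mulrC.
rewrite [X in _ = X * _]big_mkcond -big_split /=; apply: eq_bigr => a _.
rewrite ext_in inE (deg2_sub br) -(inj_eq val_inj) /=.
have [E|_] := eqVneq (val a) u.
  have -> : a = top br by exact: val_inj.
  by rewrite (negbTE yu) mul1r expfzDr // expr1z.
rewrite addr0 mulr1; case: ifP => _; last by rewrite mul1r.
by rewrite aE expfzMl.
Qed.

End BranchCharacters.

(** * The possible poles *)

Section Classification.
Variables (G : plumbing) (v : G).
Hypothesis Gtree : neg_tree G.

(** The exponents deg2 on A sum to - 1, and on the branch itself they differ from
    those in G only at u. *)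
Lemma ord_union (A : {set G}) (u : G) (S : {set G}) : is_branch v A u -> v \in S ->
  \sum_(w in S) deg2 w = \sum_(w in S :|: A) deg2 w + 1 +
     (\sum_(a in sub_set A S) deg2 a + (u \in S)%:Z).
Proof.
move=> br vS; have [conn acyc _] := Gtree.
have uA : u \in A by case: br.
have AE : \sum_(w in A) deg2 w = -1.
  have := sum_deg2_tree conn acyc v; rewrite (bigID (mem A)) /=.
  by rewrite (sum_deg2_outside Gtree br) => E; apply: (@addIr _ (-1 : int)); exact: E.
have SE : \sum_(w in S) deg2 w = \sum_(w in S :\: A) deg2 w +
   (\sum_(a in sub_set A S) deg2 a + (u \in S)%:Z).
  rewrite (big_setID A) /= addrC; congr (_ + _).
  rewrite (eq_bigl (fun w => (w \in A) && (w \in S))) => [|w]; last by rewrite inE andbC.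
  rewrite (big_sub_cond (mem A)) big_mkcond /=.
  rewrite (eq_bigr (fun a : subplumbing A => (if a \in sub_set A S then deg2 a else 0) +
     (if a == top br then (u \in S)%:Z else 0))); last first.
    move=> a _; rewrite inE (deg2_sub br) -(inj_eq val_inj) /=.
    case: eqP => [->|_]; last by rewrite !addr0.
    by case: ifP.
  by rewrite big_split /= -!big_mkcond /= big_pred1_eq.
have UE : \sum_(w in S :|: A) deg2 w = \sum_(w in S :\: A) deg2 w - 1.
  rewrite (big_setID A) /= addrC; congr (_ + _).
    by apply: eq_bigl => w; rewrite !inE; case: (w \in A); rewrite ?orbF ?andbF.
  rewrite -AE; apply: eq_bigl => w.
  by rewrite !inE; case: (w \in A); rewrite ?orbT ?andbF.
by rewrite SE UE subrK.
Qed.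

(** S with A filled in, and S within the branch, are both balanced. They omit w0
    and a0 respectively, so that their orders are nonnegative. By ord_union the
    order of S is larger by at least 1 than the sum of the two. *)
Lemma ord_two_branches (A : {set G}) (u : G) (S : {set G}) w0 a0 : is_branch v A u ->
  v \in S -> (forall w, w \in S -> w != v -> #|[set x | adj w x & x \notin S]| != 1%N) ->
  (forall x, adj v x -> x \notin A -> x \in S) ->
  w0 \notin A -> w0 \notin S -> a0 \in A -> a0 \notin S ->
  1 <= \sum_(w in S) deg2 w.
Proof.
move=> br vS bal nbr w0A w0S a0A a0S; have [conn acyc _] := Gtree.
have [connA acycA _] := branch_neg_tree Gtree br.
have vA : v \notin A by case: br.
rewrite (ord_union br vS).
have h1 : 0 <= \sum_(w in S :|: A) deg2 w.
  apply: ord_ge0 => //; last first.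
    by apply: contraNneq w0S => /setP/(_ w0); rewrite !inE (negbTE w0A) orbF.
  move=> w; have empty : (forall x, adj w x -> x \in S :|: A) ->
      #|[set x | adj w x & x \notin S :|: A]| != 1%N.
    move=> H; rewrite (_ : [set x | _ & _] = finset.set0) ?cards0 //.
    apply/setP => x; rewrite finset.in_set finset.in_set0; apply/negbTE; rewrite negb_and negbK.
    by case wx : (adj w x) => //=; exact: H.
  have [wA _|wA] := boolP (w \in A).
    apply: empty => x wx; rewrite inE.
    have [xA|xA] := boolP (x \in A); first by rewrite orbT.
    by move: wx; rewrite (branch_adj br wA xA) => /andP[_ /eqP->]; rewrite vS.
  rewrite inE (negbTE wA) orbF => wS; have [wv|wv] := eqVneq w v.
    apply: empty => x; rewrite wv inE => vx.
    by have [xA|xA] := boolP (x \in A); [rewrite orbT|rewrite nbr].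
  rewrite (_ : [set x | _ & _] = [set x | adj w x & x \notin S]); first exact: bal.
  apply/setP => x; rewrite !inE negb_or; have [xA|xA] := boolP (x \in A); last by rewrite andbT.
  by rewrite adj_sym (branch_adj br xA wA) (negbTE wv) andbF.
have h2 : 0 <= \sum_(a in sub_set A S) deg2 a.
  apply: ord_ge0 => //.
    apply: (balanced_sub br vS) => w wA wS; apply: bal => //.
    by apply: contraNneq vA => <-.
  by apply: contraNneq a0S => /setP/(_ (exist _ a0 a0A)); rewrite !inE.
move: (\sum_(w in _) _) (\sum_(a in _) _) h1 h2 => p q h1 h2.
by case: (u \in S); lia.
Qed.

Variables (C : numClosedFieldType) (ut : component v -> G).
Hypothesis utP : forall i, is_branch v (val i) (ut i).

(** The only relation that z may violate is the one at v. If S = ones z is balanced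
    at v as well, the order is nonnegative unless z = 1. Otherwise v has a
    single neighbour outside S, in a component val i, and ord_two_branches
    applies if z differs from 1 also somewhere outside this component. *)
Lemma pole_cases (z : {ffun G -> C}) :
  (forall w, w != v -> \prod_x z x ^ inter w x = 1) ->
  [\/ z = one_char C G,
      exists i : component v, z (ut i) != 1 /\ forall w, w \notin val i -> z w = 1
    | 0 <= ord z].
Proof.
move=> zr; have [conn acyc _] := Gtree.
have bal w : w \in ones z -> w != v -> #|[set x | adj w x & x \notin ones z]| != 1%N.
  by rewrite inE => /eqP zw wv; exact: relation_balanced (zr w wv).
have [vbal|] := boolP ((v \in ones z) ==> (#|[set x | adj v x & x \notin ones z]| != 1%N)).
  have [|ST] := eqVneq (ones z) [set: G]%SET.
    by move=> /eqP; rewrite ones_setT => /eqP ->; constructor 1.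
  constructor 3; apply: ord_ge0 => // w wS.
  have [wv|wv] := eqVneq w v; last exact: bal.
  by move: vbal; rewrite wv -{1}wv wS.
rewrite negb_imply negbK => /andP[vS /cards1P[u uE]].
have : u \in [set x | adj v x & x \notin ones z] by rewrite uE !inE.
rewrite inE => /andP[vu uS].
have uv : u != v by apply: contraNneq uS => ->.
have [i ui] := component_cover uv.
have utu : ut i = u.
  by have := branch_adj_v (utP i) ui; rewrite adj_sym vu => /esym/eqP.
have [/existsP[w0 /andP[w0A w0S]]|/existsPn out] :=
    boolP [exists w, (w \notin val i) && (w \notin ones z)].
  constructor 3; apply: le_trans (_ : 1 <= _) => //.
  apply: (ord_two_branches (utP i) vS bal _ w0A w0S ui uS) => x vx xA.
  apply: contraNT xA => xS; have : x \in [set x | adj v x & x \notin ones z].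
    by rewrite inE vx.
  by rewrite uE inE => /eqP ->.
constructor 2; exists i; split; first by rewrite utu; move: uS; rewrite inE.
move=> w wA; have := out w; rewrite wA /= negbK inE => /eqP //.
Qed.

End Classification.

(** * Change of the base vertex in the torsion *)

Lemma sum_seq_single (V : nmodType) (T : eqType) (s : seq T) (P : pred T) (F : T -> V) y0 :
  uniq s -> y0 \in s -> P y0 -> (forall y, y \in s -> P y -> y = y0) ->
  \sum_(y <- s | P y) F y = F y0.
Proof.
move=> us ys Py only; rewrite big_mkcond (bigD1_seq y0) //= Py big1_seq ?addr0 //.
move=> y /andP[yy0 ys']; case: ifP => // /(only _ ys') E.
by rewrite E eqxx in yy0.
Qed.

Section TorsionDifference.
Variables (C : numClosedFieldType) (G : plumbing) (v : G).
Hypothesis Gtree : neg_tree G.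

Lemma ext_char (A : {set G}) u (br : is_branch v A u) (y : {ffun subplumbing A -> C}) :
  is_char y -> y (top br) = 1 -> is_char (ext y).
Proof.
move=> yc y1; split=> [w|w]; first by apply: ext_neq0; case: yc.
have [->|wv] := eqVneq w v; first by rewrite (ext_rel_v br).
exact: (ext_rel br yc wv).
Qed.

Lemma not_good_v (x : {ffun G -> C}) w : ~~ good (ones x) v -> adj v w -> x w = 1.
Proof.
rewrite negb_or negbK => /andP[_ /existsPn H] vw; have := H w.
by rewrite vw /= negbK inE => /eqP.
Qed.

Lemma not_good_v_self (x : {ffun G -> C}) : ~~ good (ones x) v -> x v = 1.
Proof. by rewrite negb_or negbK inE => /andP[/eqP]. Qed.

(** Both sides are independent of the good vertices g and gA, which may be replaced
    by the vertex c of prod_green_branch, good for both. *)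
Lemma pval_through_branch (A : {set G}) u (br : is_branch v A u)
    (y : {ffun subplumbing A -> C}) g gA :
  is_char y -> y (top br) = 1 -> y != one_char C _ ->
  good (ones (ext y)) g -> good (ones y) gA ->
  (pval (ext y) (fun w => acoef w g) - pval (ext y) (fun w => acoef w v)) / (detG G)%:~R =
  pval y (fun a => acoef a gA) / (detG (subplumbing A))%:~R.
Proof.
move=> yc y1 y_neq1 gg ggA; have GAtree := branch_neg_tree Gtree br.
have xc := ext_char yc y1; have bal := char_balanced xc.
have oE : ord (ext y) = ord y by rewrite (ord_ext Gtree br) y1 eqxx addrK.
have [z0|z0] := eqVneq (ord y) 0; last first.
  by rewrite /pval oE (negbTE z0) subrr !mul0r.
have ox0 : \sum_(w in ones (ext y)) deg2 w = 0 by rewrite -/(ord _) oE z0.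
have uS : u \in ones (ext y) by rewrite inE (ext_top br) y1.
have ST : ones (ext y) != [set: G]%SET by rewrite ones_setT ext_one.
have [c [gc gcA E]] := prod_green_branch Gtree br (@ones_out _ _ _ y) bal uS ST ox0.
rewrite ones_ext in gcA E.
rewrite (pval_good Gtree bal gg gc) (pval_good GAtree (char_balanced yc) ggA gcA).
rewrite /pval oE z0 eqxx !Preg_split !(ratr_acoef_prod _ Gtree) //.
rewrite (ratr_acoef_prod _ GAtree) //.
have -> : \prod_(w | w \notin ones (ext y)) (1 - ext y w) ^ deg2 w =
    \prod_(a | a \notin ones y) (1 - y a) ^ deg2 a.
  rewrite big_mkcond (prod_sub A) big1 ?mul1r => [|w wA]; last by rewrite ones_out.
  rewrite [RHS]big_mkcond; apply: eq_bigr => a _; rewrite !inE ext_in.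
  case: eqP => //= ya; rewrite (deg2_sub br) (_ : (val a == u) = false) ?addr0 //.
  by apply/negbTE; apply/eqP => au; apply: ya; rewrite -y1; congr (y _); exact: val_inj.
rewrite -mulrBl -rmorphB mulrAC [RHS]mulrAC; congr (_ * _).
have rd (n : int) : n%:~R = ratr n%:~R :> C by rewrite ratr_int.
by rewrite !rd -!fmorph_div E.
Qed.

Variables (ut : component v -> G).
Hypothesis utP : forall i, is_branch v (val i) (ut i).
Variable l : dual_lattice G.

(** A term on the left vanishes if v is good for x. If v is not good, x is 1 at v
    and at its neighbours. If moreover the order is 0, ord_two_branches confines
    the places where x differs from 1 to one component, so that x = ext y. *)
Lemma torsion_difference (g : {ffun G -> C} -> G)
    (gi : forall i : component v, {ffun comp_plumbing i -> C} -> comp_plumbing i) :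
  (forall x, is_char x -> x != one_char C G -> good (ones x) (g x)) ->
  (forall i y, is_char y -> y != one_char C (comp_plumbing i) -> good (ones y) (gi i y)) ->
  (detG G)%:~R^-1 * \sum_(x <- chars C G | x != one_char C G)
     (monom x l)^-1 * (pval x (fun w => acoef w (g x)) - pval x (fun w => acoef w v)) =
  \sum_i (detG (comp_plumbing i))%:~R^-1 *
    \sum_(y <- chars C (comp_plumbing i) |
        (y != one_char C _) && (y (top (utP i)) == 1))
     (monom y (dual_restrict (val i) l))^-1 * pval y (fun a => acoef a (gi i y)).
Proof.
move=> gP giP.
pose F i (y : {ffun comp_plumbing i -> C}) := (detG (comp_plumbing i))%:~R^-1 *
  ((monom y (dual_restrict (val i) l))^-1 * pval y (fun a => acoef a (gi i y))).
pose Q i (y : {ffun comp_plumbing i -> C}) := (y != one_char C _) && (y (top (utP i)) == 1).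
have Gitree i : neg_tree (comp_plumbing i) := branch_neg_tree Gtree (utP i).
transitivity (\sum_i \sum_(y <- chars C (comp_plumbing i) | Q i y) F i y); last first.
  by apply: eq_bigr => i _; rewrite mulr_sumr.
transitivity (\sum_(x <- chars C G | x != one_char C G)
   \sum_i \sum_(y <- chars C (comp_plumbing i) | Q i y) if ext y == x then F i y else 0);
  last first.
  rewrite exchange_big; apply: eq_bigr => i _ /=; rewrite exchange_big /=.
  rewrite !(big_seq_cond (fun y => Q i y)); apply: eq_bigr => y.
  rewrite (mem_chars (Gitree i)) => /andP[/asboolP yc /andP[y1 /eqP yt]].
  rewrite -big_mkcondr (@sum_seq_single _ _ _ _ _ (ext y)) ?eqxx ?chars_uniq ?ext_one ?y1 //.
    by rewrite (mem_chars Gtree); apply/asboolP; exact: ext_char yc yt.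
  by move=> x _ /andP[_ /eqP].
rewrite mulr_sumr !(big_seq_cond (fun x => x != one_char C G)); apply: eq_bigr => x.
rewrite (mem_chars Gtree) => /andP[/asboolP xc x1].
under eq_bigr do rewrite -big_mkcondr.
have [gv|nv] := boolP (good (ones x) v).
  rewrite (pval_good Gtree (char_balanced xc) (gP x xc x1) gv) subrr !mulr0.
  rewrite big1 // => i _; rewrite big1_seq // => y /andP[/andP[/andP[_ /eqP yt] /eqP xE] _].
  have [vA uA vu cl _] := utP i; move: gv; rewrite /good -xE ones_out //=.
  move=> /existsP[w /andP[vw]]; have [wA|wA] := boolP (w \in val i); last by rewrite ones_out.
  move: vw; rewrite adj_sym (branch_adj_v (utP i) wA) => /eqP ->.
  by rewrite inE (ext_top (utP i)) yt eqxx.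
have xv := not_good_v_self nv; have xn w := @not_good_v x w nv.
have [z0|z0] := eqVneq (ord x) 0; last first.
  rewrite {1 2}/pval (negbTE z0) subrr !mulr0 big1 // => i _.
  rewrite big1_seq // => y /andP[/andP[/andP[_ /eqP yt] /eqP xE] _].
  have oE : ord y = ord x by rewrite -xE (ord_ext Gtree (utP i)) yt eqxx addrK.
  by rewrite /F /pval oE (negbTE z0) !mulr0.
have [w wS] : exists w, w \notin ones x.
  apply/existsP; apply: contraR x1 => /existsPn H; rewrite -ones_setT.
  by apply/eqP/setP => w; have := H w; rewrite negbK => ->; rewrite inE.
have vS : v \in ones x by rewrite inE xv.
have wv : w != v by apply: contraNneq wS => ->.
have [i wi] := component_cover wv.
have out z : z \notin val i -> x z = 1.
  move=> zi; apply/eqP; apply: contraT => zS.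
  have : 1 <= \sum_(w in ones x) deg2 w.
    apply: (ord_two_branches Gtree (utP i) vS _ _ zi _ wi wS); last by rewrite inE.
      by move=> b bS _; exact: char_balanced xc b bS.
    by move=> b vb _; rewrite inE xn.
  by rewrite -/(ord x) z0.
have [x0 xr] := xc; have [vA uA vu _ _] := utP i.
pose y := restr (val i) x.
have yE : ext y = x by exact: restrK.
have yc : is_char y by apply: (restr_char (utP i) x0 _ out) => b _; exact: xr.
have yt : y (top (utP i)) = 1 by rewrite ffunE /= xn.
have y1 : y != one_char C _ by rewrite -ext_one yE.
rewrite (bigD1 i) //= [X in _ = _ + X]big1 ?addr0 => [|j ji]; last first.
  rewrite big1_seq // => y' /andP[/andP[_ /eqP y'E] _].
  have wj : w \notin val j.
    by apply: contraNN ji => wj; apply/eqP; exact: component_uniq wj wi.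
  by move: wS; rewrite -y'E ones_out.
rewrite (@sum_seq_single _ _ _ _ _ y) ?chars_uniq //; first last.
- by move=> y' _ /andP[_ /eqP y'E]; apply: (@ext_inj C G (val i)); rewrite y'E yE.
- by rewrite /Q y1 yt yE !eqxx.
- by rewrite (mem_chars (Gitree i)); apply/asboolP.
rewrite /F -(monom_ext y l) yE mulrCA [RHS]mulrCA; congr (_ * _).
have gx := gP x xc x1; rewrite -{1}yE in gx.
rewrite mulrC [RHS]mulrC.
by have := pval_through_branch yc yt y1 gx (giP i y yc y1); rewrite yE.
Qed.

End TorsionDifference.

(** * The polar parts *)

Section PoleIdentities.
Variable K : fieldType.
Implicit Types t x y : K.

Lemma simple_pole_identity (e m V c g t g0 : K) : t - 1 != 0 -> g != 0 ->
  e * (m * ((1 - t)^-1 * V)) - c * g0 / ((1 - t) * g) =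
  - ((e * m * V - c * (g0 / g)) / (t - 1)).
Proof.
move=> t1 g_neq0; have t1' : 1 - t != 0 by rewrite -opprB oppr_eq0.
by field; rewrite t1 t1' g_neq0.
Qed.

Lemma double_pole_identity (e q U A B g t h : K) : t - 1 != 0 -> g != 0 ->
  e * (q * (((1 - t) ^+ 2)^-1 * U)) - q * h * (A + B * ((1 - t) * g)) / ((1 - t) * g) ^+ 2 =
  q * ((e * U + (- A) * (h / g ^+ 2) + B * ((t - 1) * (h / g))) / (t - 1) ^+ 2).
Proof.
move=> t1 g_neq0; have t1' : 1 - t != 0 by rewrite -opprB oppr_eq0.
by field; rewrite t1 t1' g_neq0.
Qed.

End PoleIdentities.

Section Poles.
Variables (C : numClosedFieldType) (G : plumbing) (v : G).
Hypothesis Gtree : neg_tree G.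
Variables (l : dual_lattice G) (k d : nat).
Hypothesis dE : detG G = d%:Z.
Hypothesis kd : (k < d)%N.
Hypothesis kE : \sum_w l w * (acoef w v)%:Z = k%:Z.
Local Notation F := {fraction {poly C}}.
Local Notation "c %:K" := (@ratfun_const C c) (at level 2, format "c %:K").
Local Notation XF := (tofrac 'X : F).
Local Notation a := (fun w => acoef w v).
Implicit Types (x z : {ffun G -> C}) (p : C).

Let d0 : (0 < d)%N. Proof. by case: d kd. Qed.
Let a0 w : (0 < a w)%N.
Proof. by have [conn acyc neg] := Gtree; exact: acoef_gt0. Qed.

Lemma acoef_inter u : \sum_w inter u w * (acoef w v)%:Z = - (if u == v then d%:Z else 0).
Proof.
have [conn acyc neg] := Gtree; apply: (@intr_inj rat); rewrite rmorph_sum /=.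
transitivity ((detG G)%:~R * lap (fun w => green w v) u).
  rewrite /lap mulr_sumr; apply: eq_bigr => w _; rewrite rmorphM /= -pmulrn acoefE //.
  by ring.
by rewrite lap_green // dE rmorphN /=; case: eqP => _ /=; rewrite ?mulrN1 ?oppr0 ?mulr0.
Qed.

(** The values at X = p of the monomials x w X ^ a w that occur in the term of x.
    Only the relation at v changes: its value becomes p ^- d. *)
Definition twist p x : {ffun G -> C} := [ffun w => x w * p ^+ a w].

Section Shift.
Variable p : C.
Hypothesis p0 : p != 0.
Local Notation T := (coordT p).

Lemma prod_twist x (f : G -> int) : \prod_w twist p x w ^ f w =
  \prod_w x w ^ f w * p ^ (\sum_w f w * (a w)%:Z).
Proof.
rewrite -(prodr_exprz _ _ _ p0).
rewrite -big_split /=; apply: eq_bigr => w _.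
by rewrite ffunE expfzMl exprnP exprz_exp mulrC (mulrC (f w)) mulrC.
Qed.

Lemma twist_neq0 x w : x w != 0 -> twist p x w != 0.
Proof. by move=> xw; rewrite ffunE mulf_neq0 // expf_neq0. Qed.

Lemma twist_rel x u : is_char x ->
  \prod_w twist p x w ^ inter u w = if u == v then p ^- d else 1.
Proof.
move=> [_ xr]; rewrite prod_twist xr mul1r acoef_inter.
by case: eqP => _; rewrite ?oppr0 ?expr0z // -exprnN.
Qed.

Lemma monom_twist x : monom (twist p x) l = monom x l * p ^+ k.
Proof. by rewrite /monom prod_twist kE. Qed.

Lemma Pprod_twist x : Pprod (@ratfun_const C) x a XF = Pprod (@ratfun_const C) (twist p x) a T.
Proof.
apply: eq_bigr => w _; rewrite ffunE rmorphM rmorphXn /= (coordTE p0) exprMn.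
by rewrite mulrA.
Qed.

End Shift.

Lemma twistK p x : p != 0 -> twist p (twist p^-1 x) = x.
Proof.
by move=> p0; apply/ffunP => w; rewrite !ffunE -mulrA -exprMn mulVf // expr1n mulr1.
Qed.

Lemma twist1 x : twist 1 x = x.
Proof. by apply/ffunP => w; rewrite ffunE expr1n mulr1. Qed.

Lemma untwist_char p z : p != 0 -> (forall w, z w != 0) ->
  (forall w, w != v -> \prod_u z u ^ inter w u = 1) ->
  \prod_u z u ^ inter v u = p ^- d -> is_char (twist p^-1 z).
Proof.
move=> p0 z0 zr zv; have pi0 : p^-1 != 0 by rewrite invr_eq0.
split=> [w|w]; first exact: twist_neq0.
rewrite prod_twist // acoef_inter; have [->|wv] := eqVneq w v; last first.
  by rewrite zr // oppr0 expr0z mulr1.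
by rewrite zv -exprnN exprVn invrK mulVf // expf_neq0.
Qed.

Definition char_term x : F :=
  ((detG G)%:~R^-1)%:K * (((monom x l)^-1)%:K * Pprod (@ratfun_const C) x a XF).

Lemma char_term_regv p x : p != 0 -> 0 <= ord (twist p x) ->
  regv p (char_term x) ((detG G)%:~R^-1 * ((monom x l)^-1 * pval (twist p x) a)).
Proof.
move=> p0 o0; rewrite /char_term (Pprod_twist p0).
apply: regvM (regv_const _ _) (regvM (regv_const _ _) _).
exact: regv_Pprod.
Qed.

Lemma regvX p : regv p XF p.
Proof. by have := regv_tofrac p 'X; rewrite hornerX. Qed.

Lemma char_term_reg0 x : isreg 0 (char_term x).
Proof.
exists ((detG G)%:~R^-1 * ((monom x l)^-1 * \prod_w (1 - x w * 0 ^+ a w) ^ deg2 w)).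
apply: regvM (regv_const _ _) (regvM (regv_const _ _) _).
apply: regv_prod => w _; apply: regvXz.
  by rewrite expr0n gtn_eqF ?a0 // mulr0 subr0 oner_neq0.
apply: regvB; first by rewrite -const1; exact: regv_const.
exact: regvM (regv_const _ _) (regvXn _ (regvX 0)).
Qed.

Lemma one_sub_pow (t : F) : 1 - t ^+ d = (1 - t) * \sum_(j < d) t ^+ j.
Proof. by rewrite -opprB subrX1 -mulNr opprB. Qed.

(** For y != 0, a function of negative degree as k < d, with simple poles at the
    d-th roots of y^-1. *)
Definition simple_part (c y : C) : F := c%:K * XF ^+ k / (1 - y%:K * XF ^+ d).

Lemma simple_part_proper c y : y != 0 -> proper_frac (simple_part c y).
Proof.
move=> y0; exists (c *: 'X^k), (1 - y *: 'X^d).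
have sd : size (1 - y *: 'X^d : {poly C}) = d.+1.
  by rewrite addrC size_polyDl size_polyN size_scale // size_polyXn // size_poly1.
split; first by rewrite -size_poly_eq0 sd.
- rewrite sd ltnS; apply: leq_trans (size_scale_leq _ _) _.
  by rewrite size_polyXn.
- by rewrite /simple_part -!mul_polyC !(rmorphB, rmorphM, rmorph1, rmorphXn).
Qed.

Lemma simple_part_regv p c y : y * p ^+ d != 1 ->
  regv p (simple_part c y) (c * p ^+ k / (1 - y * p ^+ d)).
Proof.
move=> yp; apply: regvM.
  by apply: regvM (regv_const _ _) _; exact: regvXn (regvX p).
apply: regvV; first by rewrite subr_eq0 eq_sym.
apply: regvB; first by rewrite -const1; exact: regv_const.
by apply: regvM (regv_const _ _) _; exact: regvXn (regvX p).
Qed.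

(** A function of negative degree as k < d, with poles of order at most two at the
    d-th roots of unity. *)
Definition double_part (A B : C) : F :=
  XF ^+ k * (A%:K + B%:K * (1 - XF ^+ d)) / (1 - XF ^+ d) ^+ 2.

Lemma double_part_proper A B : proper_frac (double_part A B).
Proof.
exists ('X^k * (A%:P + B%:P * (1 - 'X^d))), ((1 - 'X^d) ^+ 2).
have sd : size (1 - 'X^d : {poly C}) = d.+1.
  by rewrite addrC size_polyDl size_polyN size_polyXn // size_poly1.
have n0 : 1 - 'X^d != 0 :> {poly C} by rewrite -size_poly_eq0 sd.
split; first by rewrite expf_neq0.
- have s2 : size ((1 - 'X^d) * (1 - 'X^d) : {poly C}) = (d.+1 + d.+1).-1.
    exact: etrans (size_mul n0 n0) (congr1 (fun m => (m + m).-1) sd).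
  rewrite expr2 s2.
  apply: (@leq_ltn_trans (k.+1 + d.+1).-1); last first.
    by rewrite !addSn !addnS /= !ltnS ltn_add2r.
  apply: leq_trans (size_polyMleq _ _) _; rewrite size_polyXn.
  rewrite -!subn1 leq_sub2r // leq_add2l; apply: leq_trans (size_polyD _ _) _.
  rewrite geq_max; apply/andP; split.
    by apply: leq_trans (size_polyC_leq1 _) _.
  by rewrite mul_polyC; apply: leq_trans (size_scale_leq _ _) _; rewrite sd.
- by rewrite /double_part !(rmorphB, rmorphM, rmorph1, rmorphXn, rmorphD).
Qed.

Lemma double_part_reg p A B : p ^+ d != 1 -> isreg p (double_part A B).
Proof.
move=> pd; exists (p ^+ k * (A + B * (1 - p ^+ d)) / (1 - p ^+ d) ^+ 2).
have X1 : regv p (1 - XF ^+ d) (1 - p ^+ d).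
  apply: regvB; last exact: regvXn (regvX p).
  by rewrite -const1; exact: regv_const.
apply: regvM.
  apply: regvM; first exact: regvXn (regvX p).
  apply: regvD; first exact: regv_const.
  exact: regvM (regv_const _ _) X1.
apply: regvV; last exact: regvXn X1.
by rewrite expf_neq0 // subr_eq0 eq_sym.
Qed.

End Poles.

Section LocalPoles.
Variables (C : numClosedFieldType) (G : plumbing) (v : G).
Hypothesis Gtree : neg_tree G.
Variables (l : dual_lattice G) (k d : nat).
Hypothesis dE : detG G = d%:Z.
Hypothesis kd : (k < d)%N.
Hypothesis kE : \sum_w l w * (acoef w v)%:Z = k%:Z.
Local Notation F := {fraction {poly C}}.
Local Notation "c %:K" := (@ratfun_const C c) (at level 2, format "c %:K").
Local Notation XF := (tofrac 'X : F).
Local Notation a := (fun w => acoef w v).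
Implicit Types (x z : {ffun G -> C}) (p : C).

Let d0 : (0 < d)%N. Proof. by case: d kd. Qed.
Let a0 w : (0 < a w)%N.
Proof. by have [conn acyc neg] := Gtree; exact: acoef_gt0. Qed.
Let dn0 : (d%:R : C) != 0. Proof. by rewrite pnatr_eq0 -lt0n. Qed.

Variable p : C.
Hypothesis p0 : p != 0.
Local Notation T := (coordT p).

Let XFn n : XF ^+ n = (p ^+ n)%:K * T ^+ n.
Proof. by rewrite (coordTE p0) exprMn rmorphXn. Qed.

Let T1 : T - 1 != 0. Proof. exact: coordT_neq1. Qed.
Let T1' : T != 1. Proof. by rewrite -subr_eq0. Qed.

Let geo_neq0 : \sum_(j < d) T ^+ j != 0.
Proof. exact: regv_neq0 dn0 (regv_geometric p0 d). Qed.

(** The torsion term of y in the branch when y (top br) != 1, in which case the top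
    vertex may serve as u_rho. *)
Definition branch_weight (A : {set G}) (u : G) (br : is_branch v A u)
    (y : {ffun subplumbing A -> C}) : C :=
  (detG (subplumbing A))%:~R^-1 * ((monom y (dual_restrict A l))^-1 *
     pval y (fun w => acoef w (top br))).

(** In the coordinate T both terms are regular functions divided by 1 - T. By
    Preg_ext the two regular functions have the same value at p. *)
Lemma simple_pole (A : {set G}) (u : G) (br : is_branch v A u)
    (y : {ffun subplumbing A -> C}) x :
  is_char x -> is_char y -> y (top br) != 1 -> ext y = twist v p x ->
  isreg p (char_term v l x -
    simple_part k d ((1 - y (top br)) * branch_weight br y) (y (top br))).
Proof.
move=> xc yc y1 yE; set c := (1 - _) * _.
have yp : y (top br) * p ^+ d = 1.
  have := twist_rel v Gtree dE p0 v xc; rewrite eqxx -yE (ext_rel_v br) => ->.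
  by rewrite mulVf // expf_neq0.
have oE : ord (ext y) = -1 + ord y.
  by rewrite (ord_ext Gtree br) (negbTE y1) addr0 addrC.
have oy0 : 0 <= ord y.
  apply: (char_ord_ge0 (branch_neg_tree Gtree br) yc).
  by apply: contraNneq y1 => ->; rewrite ffunE.
have U1 : 1 - T != 0 by rewrite -opprB oppr_eq0 T1.
have tE : char_term v l x = ((detG G)%:~R^-1)%:K * (((monom x l)^-1)%:K *
    ((1 - T)^-1 * ((1 - T) ^ ord y * Pfac (@ratfun_const C) (ext y) a T))).
  rewrite /char_term (Pprod_twist v p0) -yE Pprod_factor; last exact: T1'.
  by rewrite oE (expfzDr _ _ U1) exprN1 -[in LHS]mulrA.
have sE : simple_part k d c (y (top br)) = (c * p ^+ k)%:K * T ^+ k /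
    ((1 - T) * \sum_(j < d) T ^+ j).
  have e1 : c%:K * ((p ^+ k)%:K * T ^+ k) = (c * p ^+ k)%:K * T ^+ k.
    by rewrite mulrA -constM.
  have e2 : (y (top br))%:K * ((p ^+ d)%:K * T ^+ d) = T ^+ d.
    by rewrite mulrA -constM yp const1 mul1r.
  by rewrite /simple_part !XFn e1 e2 one_sub_pow.
have E := simple_pole_identity (((detG G)%:~R^-1)%:K) (((monom x l)^-1)%:K)
  ((1 - T) ^ ord y * Pfac (@ratfun_const C) (ext y) a T) ((c * p ^+ k)%:K) (T ^+ k) T1 geo_neq0.
rewrite tE sE E; apply: isregN; apply: (isreg_div p0).
have mE : (monom x l)^-1 = (monom y (dual_restrict A l))^-1 * p ^+ k.
  rewrite -monom_ext yE (monom_twist kE p0) invfM mulfVK ?expf_neq0 //.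
have vV := regv_pow_pval p0 oy0 (regv_Pfac p0 (ext y) a0).
have vR := regvM (regv_const p (c * p ^+ k))
  (regvM (regvXn k (regvT p0)) (regvV dn0 (regv_geometric p0 d))).
have vL := regvM (regvM (regv_const p (detG G)%:~R^-1) (regv_const p (monom x l)^-1)) vV.
have := regvB vL vR; rewrite expr1n mul1r.
set val := (X in regv _ _ X) => R; suff vz : val = 0 by rewrite vz in R; exact: R.
rewrite /val mE /c dE -pmulrn /branch_weight /pval; case: eqP => [z0|_]; last by ring.
by rewrite (Preg_ext Gtree y1 z0); ring.
Qed.

Definition linear_moment : C := \sum_w (deg2 w)%:~R * (acoef w v)%:R.
Definition square_moment : C := \sum_w (deg2 w)%:~R * (acoef w v)%:R ^+ 2.
Definition gvv : C := ratr (green v v).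
(** A and B are determined by the first two coefficients of the expansion of the
    trivial term at its double pole, and double_value is what is left over. *)
Definition double_A : C := gvv^-1.
Definition double_B : C :=
  (d%:R * gvv)^-1 * (k%:R - d%:R - linear_moment / 2).
Definition double_value : C := (d%:R ^+ 2 * gvv)^-1 *
  ((k%:R - d%:R / 2 - linear_moment / 2) ^+ 2 / 2 + square_moment / 24 - d%:R ^+ 2 / 24).

Let gvv0 : gvv != 0.
Proof.
by have [conn acyc neg] := Gtree; rewrite fmorph_eq0 green_neq0.
Qed.

(** The logarithmic jets of the geometric sums are added with weights deg2 w, whose
    sum is - 2. The leading coefficient is prod_green_deg2. *)
Lemma logjet_Pfac_one : logjet p (Pfac (@ratfun_const C) (one_char C G) a T)
  (d%:R * gvv)^-1 ((linear_moment + 2) / 2)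
  ((square_moment - 6 * linear_moment - 10) / 24).
Proof.
have [conn acyc neg] := Gtree.
have s0 : \sum_(w : G) (deg2 w)%:~R = - 2 :> C.
  transitivity ((\sum_(w : G) deg2 w)%:~R : C); first by rewrite rmorph_sum.
  by rewrite (sum_deg2_tree conn acyc v) rmorphN.
have := @logjet_prod C p p0 G (fun w => (\sum_(j < a w) T ^+ j) ^ deg2 w) _ _ _
  (fun w => logjetXz p0 (deg2 w) (logjet_geometric p0 (a0 w))).
have -> : \prod_w (a w)%:R ^ deg2 w = (d%:R * gvv)^-1 :> C.
  have dr0 : (d%:R : rat) != 0 by rewrite pnatr_eq0 -lt0n.
  have gr0 : green v v != 0 by exact: green_neq0.
  transitivity (ratr (\prod_w (a w)%:R ^ deg2 w) : C).
    by rewrite rmorph_prod; apply: eq_bigr => w _; rewrite fmorphXz /= ratr_nat.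
  rewrite (eq_bigr (fun w => (d%:R : rat) ^ deg2 w * green w v ^ deg2 w)) => [|w _].
    rewrite big_split /= (prod_green_deg2 neg conn v acyc) dE -pmulrn.
    rewrite (prodr_exprz _ _ _ dr0) (sum_deg2_tree conn acyc v).
    rewrite -[d%:R in RHS](ratr_nat _) /gvv -rmorphM -fmorphV; congr ratr.
    by rewrite -[(d%:R : rat) ^ (-2)]/((d%:R ^+ 2)^-1); field; rewrite dr0 gr0.
  by rewrite acoefE // dE -pmulrn expfzMl.
have -> : \sum_w (deg2 w)%:~R * (((a w)%:R - 1) / 2) = (linear_moment + 2) / 2 :> C.
  rewrite (eq_bigr (fun w => 2^-1 * ((deg2 w)%:~R * (a w)%:R) + (- 2^-1) * (deg2 w)%:~R)).
    by rewrite big_split -!mulr_sumr /= s0 -/linear_moment; field.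
  by move=> w _; field.
have -> : \sum_w (deg2 w)%:~R * (((a w)%:R - 1) * ((a w)%:R - 5) / 24) =
    (square_moment - 6 * linear_moment - 10) / 24 :> C.
  rewrite (eq_bigr (fun w => 24^-1 * ((deg2 w)%:~R * (a w)%:R ^+ 2) +
     (- 4^-1) * ((deg2 w)%:~R * (a w)%:R) + (5 / 24) * (deg2 w)%:~R)).
    by rewrite !big_split -!mulr_sumr /= s0 -/linear_moment -/square_moment; field.
  by move=> w _; field.
have -> : Pfac (@ratfun_const C) (one_char C G) a T =
    \prod_w (\sum_(j < a w) T ^+ j) ^ deg2 w.
  by apply: eq_bigr => w _; rewrite ffunE eqxx.
exact.
Qed.

(** At every d-th root of unity p one character is twisted to 1. Its term and the
    double part have the same expansion in T up to the factor p ^+ k, so that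
    the same A and B serve for all p. *)
Lemma double_pole x : is_char x -> twist v p x = one_char C G ->
  regv p (char_term v l x - double_part k d double_A double_B) (p ^+ k * double_value).
Proof.
move=> xc x1; have [conn acyc neg] := Gtree.
have pd : p ^+ d = 1.
  have := twist_rel v Gtree dE p0 v xc; rewrite eqxx x1 big1 => [E|w _].
    by rewrite -[p ^+ d]invrK -E invr1.
  by rewrite ffunE exp1rz.
have mE : (monom x l)^-1 = p ^+ k.
  have := monom_twist kE p0 x; rewrite x1 {1}/monom big1 => [E|w _]; last by rewrite ffunE exp1rz.
  apply: (mulfI (monom_neq0 l xc.1)); rewrite mulfV; first exact: E.
  exact: monom_neq0 l xc.1.
have oE : ord (one_char C G) = -2.
  rewrite /ord (_ : ones _ = [set: G]%SET); last by apply/eqP; rewrite ones_setT.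
  rewrite -(sum_deg2_tree conn acyc v); apply: eq_bigl => w.
  by rewrite inE.
have tE : char_term v l x = ((detG G)%:~R^-1)%:K * ((p ^+ k)%:K *
    (((1 - T) ^+ 2)^-1 * Pfac (@ratfun_const C) (one_char C G) a T)).
  rewrite /char_term (Pprod_twist v p0) x1 Pprod_factor; last exact: T1'.
  by rewrite oE mE.
have sE : double_part k d double_A double_B = (p ^+ k)%:K * T ^+ k *
   (double_A%:K + double_B%:K * ((1 - T) * \sum_(j < d) T ^+ j)) /
   ((1 - T) * \sum_(j < d) T ^+ j) ^+ 2.
  have e2 : XF ^+ d = T ^+ d by rewrite XFn pd const1 mul1r.
  by rewrite /double_part e2 XFn one_sub_pow.
rewrite tE sE (double_pole_identity _ _ _ _ _ _ T1 geo_neq0).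
apply: regvM (regv_const _ _) (jet_div p0 _).
have [_ jU] := logjet_Pfac_one.
have [_ j2] := logjetM p0 (logjetTn p0 k) (logjetV p0 (logjetXn p0 2 (logjet_geometric p0 d0))).
have [_ j1] := logjetM p0 (logjetTn p0 k) (logjetV p0 (logjet_geometric p0 d0)).
have jY : jet p (T - 1) 0 1 0.
  exists 0; first by rewrite -const0; exact: isreg_const.
  by rewrite const0 const1 mul1r mul0r mulr0 !addr0 add0r.
rewrite -constN; have J := jetD (jetD (jetM p0 (jet_const p (detG G)%:~R^-1) jU)
  (jetM p0 (jet_const p (- double_A)) j2)) (jetM p0 (jet_const p double_B) (jetM p0 jY j1)).
apply: jet_eq J _ _ _; rewrite dE -pmulrn /double_A /double_B.
- by field; rewrite dn0 gvv0.
- by field; rewrite dn0 gvv0.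
- by rewrite /double_value; field; rewrite dn0 gvv0.
Qed.

End LocalPoles.

(** * The polynomial part *)

Section PolynomialPart.
Variables (C : numClosedFieldType) (G : plumbing) (v : G).
Hypothesis Gtree : neg_tree G.
Variables (ut : component v -> G).
Hypothesis utP : forall i, is_branch v (val i) (ut i).
Variables (l : dual_lattice G) (k d : nat).
Hypothesis dE : detG G = d%:Z.
Hypothesis kd : (k < d)%N.
Hypothesis kE : \sum_w l w * (acoef w v)%:Z = k%:Z.
Local Notation F := {fraction {poly C}}.
Local Notation "c %:K" := (@ratfun_const C c) (at level 2, format "c %:K").
Local Notation tp i := (top (utP i)).

Let Gitree i : neg_tree (comp_plumbing i) := branch_neg_tree Gtree (utP i).

Definition branch_part (i : component v) (y : {ffun comp_plumbing i -> C}) : F :=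
  simple_part k d ((1 - y (tp i)) * branch_weight l (utP i) y) (y (tp i)).

Definition branch_poles : F :=
  \sum_i \sum_(y <- chars C (comp_plumbing i) | y (tp i) != 1) branch_part y.

Definition central_pole : F := double_part k d (double_A C v) (double_B C v k d).

Definition H_series : F := \sum_(x <- chars C G) char_term v l x.

Lemma in_chars (K : plumbing) (y : {ffun K -> C}) : neg_tree K -> y \in chars C K -> is_char y.
Proof. by move=> KT; rewrite (mem_chars KT) => /asboolP. Qed.

Lemma Hrat_series (s : spincX G) : spincX_coord s = l ->
  Hrat C (spinc_boundary s) v = H_series.
Proof.
move=> sl; rewrite /Hrat /H_series.
rewrite (sum_dual_group Gtree (F' := fun x : {ffun G -> C} =>
  ((monom x l)^-1)%:K * Pprod (@ratfun_const C) x (fun w => acoef w v) (tofrac 'X))).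
  by rewrite mulr_sumr.
move=> rho dr; rewrite /spinc_boundary /spincM_act /= addr0 (dual_group_monom _ dr) sl.
by congr (_ * _); apply: eq_bigr => w _; rewrite ffunE.
Qed.

Lemma poles_proper : proper_frac (branch_poles + central_pole).
Proof.
apply: proper_fracD; last exact: double_part_proper.
apply: proper_frac_sum => i _; rewrite big_seq_cond; apply: proper_frac_sum => y /andP[ys _].
by apply: simple_part_proper => //; have [y0 _] := in_chars (Gitree i) ys; exact: y0.
Qed.

Lemma isreg_sum_seq (p : C) (T : eqType) (s : seq T) (P : pred T) (h : T -> F) :
  (forall i, i \in s -> P i -> isreg p (h i)) -> isreg p (\sum_(i <- s | P i) h i).
Proof.
move=> hr; rewrite big_seq_cond; apply: (big_ind (isreg p)).
- by rewrite -const0; exact: isreg_const.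
- by move=> f g; exact: isregD.
- by move=> i /andP[]; exact: hr.
Qed.

Lemma regv_sum_seq (p : C) (T : eqType) (s : seq T) (P : pred T) (h : T -> F) (c : T -> C) :
  (forall i, i \in s -> P i -> regv p (h i) (c i)) ->
  regv p (\sum_(i <- s | P i) h i) (\sum_(i <- s | P i) c i).
Proof.
move=> hr; rewrite big_seq_cond [X in regv _ _ X]big_seq_cond; apply: regv_sum.
by move=> i /andP[]; exact: hr.
Qed.

Section AtPoint.
Variable p : C.
Hypothesis p0 : p != 0.

(** The polar parts that compensate a simple pole of the term of x at p. *)
Definition matching x : F :=
  \sum_i \sum_(y <- chars C (comp_plumbing i) | (y (tp i) != 1) && (ext y == twist v p x))
    branch_part y.

Lemma matching_empty x :
  (forall i (y : {ffun comp_plumbing i -> C}), y (tp i) != 1 -> ext y = twist v p x -> False) ->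
  matching x = 0.
Proof.
move=> no; rewrite /matching big1 // => i _; rewrite big1 // => y /andP[y1 /eqP yE].
by case: (no i y y1 yE).
Qed.

Lemma local_regular x : is_char x ->
  isreg p (char_term v l x - matching x -
    (if twist v p x == one_char C G then central_pole else 0)).
Proof.
move=> xc; have x0 := xc.1.
have zr w : w != v -> \prod_u twist v p x u ^ inter w u = 1.
  by move=> wv; rewrite (twist_rel v Gtree dE p0 w xc) (negbTE wv).
case: ifP => [/eqP z1|z1].
  rewrite matching_empty ?subr0 => [|i y y1 yE].
    by exists (p ^+ k * double_value C v k d); exact: (double_pole Gtree dE kd kE p0 xc z1).
  by move: y1; rewrite -(ext_top (utP i)) yE z1 ffunE eqxx.
rewrite subr0.
have [[i [zu zo]]|no] := pselect (exists i : component v,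
    twist v p x (ut i) != 1 /\ forall w, w \notin val i -> twist v p x w = 1).
  pose y := restr (val i) (twist v p x).
  have yE : ext y = twist v p x by exact: restrK.
  have yc : is_char y.
    by apply: (restr_char (utP i) _ zr zo) => w; exact: twist_neq0.
  have y1 : y (tp i) != 1 by rewrite -(ext_top (utP i)) yE.
  rewrite (_ : matching x = branch_part y).
    exact: (simple_pole Gtree dE kd kE p0 xc yc y1 yE).
  rewrite /matching (bigD1 i) //= [X in _ + X]big1 ?addr0 => [|j ji]; last first.
    rewrite big1 // => y' /andP[_ /eqP y'E].
    have uj : ut i \notin val j.
      apply: contraNN ji => uj; apply/eqP; apply: component_uniq uj _.
      by have [] := utP i.
    by move: zu; rewrite -y'E ext_out // eqxx.
  rewrite (@sum_seq_single _ _ _ _ _ y) ?chars_uniq ?y1 ?yE ?eqxx //.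
    by rewrite (mem_chars (Gitree i)); apply/asboolP.
  by move=> y' _ /andP[_ /eqP y'E]; apply: (@ext_inj C G (val i)); rewrite y'E yE.
rewrite matching_empty ?subr0 => [|i y y1 yE]; last first.
  apply: no; exists i; split; first by rewrite -yE (ext_top (utP i)).
  by move=> w wA; rewrite -yE ext_out.
have [z1'|ex|o0] := pole_cases Gtree utP zr.
- by rewrite z1' eqxx in z1.
- by case: no.
- by eexists; apply: (char_term_regv Gtree l p0 o0).
Qed.

(** A branch part with a pole at p compensates exactly one term, that of the
    character obtained by untwisting ext y. *)
Lemma sum_matching : \sum_(x <- chars C G) matching x =
  \sum_i \sum_(y <- chars C (comp_plumbing i) | (y (tp i) != 1) && (y (tp i) * p ^+ d == 1))
    branch_part y.
Proof.
rewrite /matching exchange_big; apply: eq_bigr => i _ /=.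
under eq_bigr do rewrite big_mkcondr.
rewrite exchange_big [RHS]big_mkcondr /=.
rewrite big_seq_cond [RHS]big_seq_cond; apply: eq_bigr => y /andP[ys y1].
have yc := in_chars (Gitree i) ys.
rewrite -big_mkcond; case: eqP => [yp|np].
  have yv : y (tp i) = p ^- d.
    by apply: (mulIf (expf_neq0 d p0)); rewrite yp mulVf // expf_neq0.
  have xc : is_char (twist v p^-1 (ext y)).
    apply: (untwist_char Gtree dE p0).
    - by apply: ext_neq0; case: yc.
    - by move=> w wv; exact: (ext_rel (utP i) yc wv).
    - by rewrite (ext_rel_v (utP i)).
  rewrite (@sum_seq_single _ _ _ _ _ (twist v p^-1 (ext y))) ?chars_uniq ?twistK //.
    by rewrite (mem_chars Gtree); apply/asboolP.
  move=> x _ /eqP yE; rewrite yE; apply/ffunP => w.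
  by rewrite !ffunE -mulrA -exprMn mulfV // expr1n mulr1.
rewrite big_seq_cond big1 // => x /andP[xs /eqP yE]; case: np.
have := twist_rel v Gtree dE p0 v (in_chars Gtree xs).
rewrite eqxx -yE (ext_rel_v (utP i)) => ->.
by rewrite mulVf // expf_neq0.
Qed.

Lemma sum_central : \sum_(x <- chars C G) (if twist v p x == one_char C G then central_pole else 0)
  = if p ^+ d == 1 then central_pole else 0.
Proof.
rewrite -big_mkcond; case: eqP => [pd|np].
  have xc : is_char (twist v p^-1 (one_char C G)).
    apply: (untwist_char Gtree dE p0).
    - by move=> w; rewrite ffunE oner_neq0.
    - by move=> w _; case: (one_is_char C G).
    - by rewrite pd invr1; case: (one_is_char C G).
  rewrite (@sum_seq_single _ _ _ _ _ (twist v p^-1 (one_char C G))) ?chars_uniq ?twistK //.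
    by rewrite (mem_chars Gtree); apply/asboolP.
  move=> x _ /eqP yE; rewrite -yE; apply/ffunP => w.
  by rewrite !ffunE -mulrA -exprMn mulfV // expr1n mulr1.
rewrite big_seq_cond big1 // => x /andP[xs /eqP yE]; case: np.
have := twist_rel v Gtree dE p0 v (in_chars Gtree xs).
rewrite eqxx yE; have [_ ->] := one_is_char C G.
by move=> E; rewrite -[p ^+ d]invrK -E invr1.
Qed.

Lemma difference_regular_at : isreg p (H_series - (branch_poles + central_pole)).
Proof.
pose rest := \sum_i \sum_(y <- chars C (comp_plumbing i) |
   (y (tp i) != 1) && (y (tp i) * p ^+ d != 1)) branch_part y.
have bE : branch_poles = \sum_(x <- chars C G) matching x + rest.
  rewrite sum_matching /rest -big_split; apply: eq_bigr => i _ /=.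
  by rewrite (bigID (fun y : {ffun comp_plumbing i -> C} => y (tp i) * p ^+ d == 1)).
have cE : central_pole = \sum_(x <- chars C G)
    (if twist v p x == one_char C G then central_pole else 0) +
    (if p ^+ d == 1 then 0 else central_pole).
  by rewrite sum_central; case: ifP; rewrite ?addr0 ?add0r.
have -> : H_series - (branch_poles + central_pole) =
    \sum_(x <- chars C G) (char_term v l x - matching x -
      (if twist v p x == one_char C G then central_pole else 0))
    + (- rest + - (if p ^+ d == 1 then 0 else central_pole)).
  have zid (V : zmodType) (h m z r c : V) : h - (m + r + (z + c)) = h - m - z + (- r + - c).
    by rewrite !opprD (addrACA (- m)) !addrA.
  by rewrite !sumrB -zid -cE -bE.
apply: isregD.
  by apply: isreg_sum_seq => x xs _; apply: local_regular; exact: in_chars xs.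
apply: isregD; apply: isregN.
  rewrite /rest; apply: (big_ind (isreg p)) => [|f g|i _]; [|exact: isregD|].
    by rewrite -const0; exact: isreg_const.
  apply: isreg_sum_seq => y ys /andP[_ yp].
  rewrite /branch_part; eexists; exact: (simple_part_regv k _ yp).
case: eqP => [_|/eqP np]; last exact: double_part_reg.
by rewrite -const0; exact: isreg_const.
Qed.

End AtPoint.

Lemma difference_regular p : isreg p (H_series - (branch_poles + central_pole)).
Proof.
have [->|p0] := eqVneq p 0; last exact: difference_regular_at.
have d_gt0 : (0 < d)%N by apply: leq_ltn_trans kd.
have z1 (c : C) : c * 0 ^+ d != 1 by rewrite expr0n gtn_eqF // mulr0 eq_sym oner_neq0.
apply: isregD.
  by apply: isreg_sum_seq => x xs _; exact: char_term_reg0.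
apply/isregN/isregD.
  rewrite /branch_poles; apply: (big_ind (isreg 0)) => [|f g|i _]; [|exact: isregD|].
    by rewrite -const0; exact: isreg_const.
  apply: isreg_sum_seq => y ys _.
  rewrite /branch_part; eexists; exact: (simple_part_regv k _ (z1 _)).
by apply: double_part_reg; have := z1 1; rewrite mul1r.
Qed.

(** H minus the polar parts is regular everywhere, so that it is a polynomial, and
    the polar parts have negative degree. At 1 the trivial character leaves
    double_value, and a branch part has the value of its weight. *)
Lemma polynomial_part_at_1 (s : spincX G) : spincX_coord s = l ->
  (polynomial_part (Hrat C (spinc_boundary s) v)).[1] =
  double_value C v k d +
  \sum_(x <- chars C G | x != one_char C G)
     (detG G)%:~R^-1 * ((monom x l)^-1 * pval x (fun w => acoef w v)) -
  \sum_i \sum_(y <- chars C (comp_plumbing i) | y (tp i) != 1) branch_weight l (utP i) y.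
Proof.
move=> sl; rewrite (Hrat_series sl).
have [q qE] := regular_polynomial difference_regular.
have HE : H_series = tofrac q + (branch_poles + central_pole) by rewrite -qE subrK.
rewrite (polynomial_partE poles_proper HE).
have n1 : (1 : C) != 0 by exact: oner_neq0.
have d_gt0 : (0 < d)%N by apply: leq_ltn_trans kd.
have oc := one_is_char C G.
have o_in : one_char C G \in chars C G by rewrite (mem_chars Gtree); apply/asboolP.
symmetry; apply: (@regv_tofrac_inj C 1).
have fE : tofrac q = (char_term v l (one_char C G) - central_pole) +
    \sum_(x <- chars C G | x != one_char C G) char_term v l x - branch_poles.
  rewrite -qE /H_series (bigD1_seq _ o_in (chars_uniq C G)) /=.
  have zid (V : zmodType) (t s' b c : V) : t + s' - (b + c) = t - c + s' - b.
    by rewrite opprD addrA addrAC (addrAC t).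
  exact: zid.
rewrite fE; apply: regvB; first apply: regvD.
- have := double_pole Gtree dE kd kE n1 oc (twist1 v _).
  by rewrite expr1n mul1r.
- apply: regv_sum_seq => x xs x1; have xc := in_chars Gtree xs.
  have o : 0 <= ord (twist v 1 x) by rewrite twist1; exact: char_ord_ge0.
  by have := char_term_regv Gtree l n1 o; rewrite twist1.
- rewrite /branch_poles; apply: regv_sum => i _; apply: regv_sum_seq => y ys y1.
  have y1' : y (tp i) * 1 ^+ d != 1 by rewrite expr1n mulr1.
  have := simple_part_regv k ((1 - y (tp i)) * branch_weight l (utP i) y) y1'.
  rewrite !expr1n !mulr1 mulrAC mulfV ?mul1r //.
  by rewrite subr_eq0 eq_sym.
Qed.

End PolynomialPart.

(** * The Casson-Walker and c_1^2 terms *)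

Section RationalIdentity.
Variables (G : plumbing) (v : G).
Hypothesis Gtree : neg_tree G.
Variables (ut : component v -> G).
Hypothesis utP : forall i, is_branch v (val i) (ut i).
Variables (s : spincX G) (k d : nat).
Local Notation l := (spincX_coord s).
Hypothesis dE : detG G = d%:Z.
Hypothesis d0 : (0 < d)%N.
Hypothesis kE : \sum_w l w * (acoef w v)%:Z = k%:Z.
Local Notation tp i := (top (utP i)).

Let conn : connected_graph G. Proof. by case: Gtree. Qed.
Let acyc : acyclic_graph G. Proof. by case: Gtree. Qed.
Let neg : negative_definite G. Proof. by case: Gtree. Qed.
Let Gitree i : neg_tree (comp_plumbing i) := branch_neg_tree Gtree (utP i).
Let gvv0 : green v v != 0. Proof. exact: green_neq0. Qed.
Let dr0 : (d%:R : rat) != 0. Proof. by rewrite pnatr_eq0 -lt0n. Qed.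

Lemma sum_components (V : nmodType) (F : G -> V) :
  \sum_w F w = F v + \sum_(i : component v) \sum_(a : comp_plumbing i) F (val a).
Proof.
rewrite (bigD1 v) //=; congr (_ + _).
transitivity (\sum_(w | w != v) \sum_(i : component v) if w \in val i then F w else 0).
  apply: eq_bigr => w wv; have [i wi] := component_cover wv.
  rewrite (bigD1 i) //= wi big1 ?addr0 // => j ji; case: ifP => // wj.
  by rewrite (component_uniq wj wi) eqxx in ji.
rewrite exchange_big; apply: eq_bigr => i _ /=.
rewrite -big_mkcondr (eq_bigl (mem (val i))) => [|w]; first exact: (big_sub (mem (val i))).
rewrite /=; have [->|//] := eqVneq w v.
by apply/esym/negbTE; have [] := utP i.
Qed.

Lemma sum_neighbours_v (F : G -> rat) : \sum_(w | adj v w) F w = \sum_i F (ut i).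
Proof.
rewrite big_mkcond sum_components adj_irr add0r; apply: eq_bigr => i _.
rewrite (bigD1 (tp i)) //= big1 ?addr0 => [|a at'].
  by have [_ _ -> _ _] := utP i.
rewrite adj_sym (branch_adj_v (utP i) (valP a)) (_ : (val a == ut i) = false) //.
by apply/negbTE; apply: contraNneq at' => E; apply/eqP/val_inj.
Qed.

(** The Green function of G minus v: it vanishes at v and has the Green functions of
    the components as diagonal blocks. *)
Definition reduced_green u w : rat := green u w - green u v * green w v / green v v.

Lemma reduced_green_v u : reduced_green u v = 0.
Proof. by rewrite /reduced_green mulfK // subrr. Qed.

Lemma reduced_green_sym u w : reduced_green u w = reduced_green w u.
Proof. by rewrite /reduced_green (green_sym neg u w) (mulrC (green u v)). Qed.

Lemma reduced_green_in (i : component v) (a b : comp_plumbing i) : reduced_green (val a) (val b) = green a b.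
Proof. by rewrite (green_sub Gtree (utP i)). Qed.

Lemma reduced_green_out (i : component v) (a : comp_plumbing i) w : w \notin val i ->
  reduced_green (val a) w = 0.
Proof.
move=> wi; have E := green_through Gtree (utP i) a wi.
by rewrite /reduced_green (green_sym neg w) -E mulfK // subrr.
Qed.

(** The number - (c_1, E*_v). *)
Definition c1_pairing : rat := \sum_w green w v * (c1 s w)%:~R.

Lemma c1_restrict (i : component v) : c1 (spincX_restrict (val i) s) = [ffun a => c1 s (val a)].
Proof.
by apply/ffunP => a; rewrite !ffunE /= addr0.
Qed.

Lemma c1_square_drop : dual_form (c1 s) (c1 s) -
    \sum_(i : component v) dual_form (c1 (spincX_restrict (val i) s)) (c1 (spincX_restrict (val i) s)) =
  - (c1_pairing ^+ 2 / green v v).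
Proof.
pose c w : rat := (c1 s w)%:~R.
have E : \sum_(u : G) \sum_(w : G) reduced_green u w * c w * c u =
    - \sum_(i : component v) dual_form (c1 (spincX_restrict (val i) s)) (c1 (spincX_restrict (val i) s)).
  rewrite sum_components [X in X + _]big1 ?add0r => [|w _]; last first.
    by rewrite reduced_green_sym reduced_green_v !mul0r.
  rewrite -sumrN; apply: eq_bigr => i _; have [_ _ negi] := Gitree i.
  rewrite dual_formE // opprK; apply: eq_bigr => a _.
  rewrite (sum_sub (val i)) big1 ?add0r => [|w wi]; last first.
    by rewrite reduced_green_out // !mul0r.
  have cE b : c1 (spincX_restrict (val i) s) b = c1 s (val b) by rewrite c1_restrict ffunE.
  by apply: eq_bigr => b _; rewrite reduced_green_in !cE.
rewrite -[X in _ + X]E dual_formE // -sumrN -big_split /= /c1_pairing expr2.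
rewrite mulr_suml mulr_suml -sumrN; apply: eq_bigr => u _.
rewrite -sumrN -big_split /= mulr_sumr mulr_suml -sumrN; apply: eq_bigr => w _.
by rewrite /reduced_green /c; field.
Qed.

(** The passage from green to reduced_green gives the sum on the right-hand side.
    The rest comes from the degree of each top vertex, which is smaller by one
    in its component: the sum of the green (tp i) (tp i) is evaluated by the
    equation of green _ v at v. *)
Lemma trace_drop : \sum_(w : G) (deg2 w)%:~R * green w w -
    \sum_(i : component v) \sum_(a : comp_plumbing i) (deg2 a)%:~R * green a a =
  \sum_(w : G) (deg2 w)%:~R * green w v ^+ 2 / green v v - (euler v)%:~R - (green v v)^-1.
Proof.
have E : \sum_(w : G) (deg2 w)%:~R * reduced_green w w =
    \sum_(i : component v) \sum_(a : comp_plumbing i) (deg2 a)%:~R * green a a + \sum_i green (tp i) (tp i).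
  rewrite sum_components reduced_green_v mulr0 add0r -big_split; apply: eq_bigr => i _ /=.
  rewrite (eq_bigr (fun a : comp_plumbing i => (deg2 a)%:~R * green a a +
    if a == tp i then green (tp i) (tp i) else 0)) => [|a _].
    by rewrite big_split /= -big_mkcond big_pred1_eq.
  rewrite (deg2_sub (utP i)) reduced_green_in rmorphD mulrDl -(inj_eq val_inj) /=.
  have [at'|_] := eqVneq (val a) (ut i); last by rewrite mul0r.
  by rewrite (_ : a = tp i) ?mul1r //; exact: val_inj.
have tE : \sum_i green (tp i) (tp i) = - (euler v)%:~R - (green v v)^-1.
  have := lap_green neg v v; rewrite lapE eqxx sum_neighbours_v.
  rewrite (eq_bigr (fun i => green (tp i) (tp i) * green v v)) => [|i _].
    rewrite -mulr_suml => /(congr1 (fun q => q / green v v)).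
    by rewrite mulrDl !mulfK // mulN1r => <-; ring.
  exact: (green_sub_top Gtree (utP i) (tp i)).
have SE : \sum_(w : G) (deg2 w)%:~R * green w w = \sum_(w : G) (deg2 w)%:~R * reduced_green w w +
    \sum_(w : G) (deg2 w)%:~R * green w v ^+ 2 / green v v.
  by rewrite -big_split /=; apply: eq_bigr => w _; rewrite /reduced_green; field.
by rewrite SE E tE; ring.
Qed.

Definition rat_linear : rat := \sum_(w : G) (deg2 w)%:~R * (acoef w v)%:R.
Definition rat_square : rat := \sum_(w : G) (deg2 w)%:~R * (acoef w v)%:R ^+ 2.
Definition rat_value : rat := (d%:R ^+ 2 * green v v)^-1 *
  ((k%:R - d%:R / 2 - rat_linear / 2) ^+ 2 / 2 + rat_square / 24 - d%:R ^+ 2 / 24).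

Lemma acoef_green w : (acoef w v)%:R = d%:R * green w v :> rat.
Proof. by rewrite acoefE // dE. Qed.

(** At w, c_1 is (b_w + degree w) - deg2 w + 2 l w. The first summand is the image of
    the constant function 1 under I, so that it pairs to - 1 with green _ v. *)
Lemma c1_pairingE : d%:R * c1_pairing = 2 * k%:R - d%:R - rat_linear.
Proof.
have kR : \sum_w (l w)%:~R * (acoef w v)%:R = k%:R :> rat.
  have := congr1 (fun n : int => n%:~R : rat) kE; rewrite rmorph_sum /= pmulrn => <-.
  by apply: eq_bigr => w _; rewrite rmorphM.
have dR : \sum_w (acoef w v)%:R * ((euler w)%:~R + (degree w)%:R) = - d%:R :> rat.
  transitivity (\sum_u lap (fun w => (acoef w v)%:R) u).
    rewrite /lap exchange_big; apply: eq_bigr => w _ /=; rewrite -mulr_suml mulrC.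
    congr (_ * _); rewrite (bigD1 w) //= /inter eqxx; congr (_ + _).
    rewrite /degree -sum1_card natr_sum [LHS]big_mkcond [RHS]big_mkcond /=.
    apply: eq_bigr => u _; rewrite !inE adj_sym.
    have [->|uw] := eqVneq u w; first by rewrite adj_irr.
    by case: (adj u w); rewrite /= ?mulr0z ?mulr1z.
  rewrite (bigD1 v) //= [X in _ + X]big1 ?addr0 => [|u uv].
    rewrite /lap (eq_bigr (fun w => d%:R * ((inter v w)%:~R * green w v))) => [|w _].
      by rewrite -mulr_sumr -/(lap _ v) (lap_green neg v v) eqxx mulrN1.
    by rewrite acoef_green; ring.
  rewrite /lap (eq_bigr (fun w => d%:R * ((inter u w)%:~R * green w v))) => [|w _].
    by rewrite -mulr_sumr -/(lap _ u) (lap_green neg v u) (negbTE uv) oppr0 mulr0.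
  by rewrite acoef_green; ring.
transitivity (\sum_(w : G) ((acoef w v)%:R * ((euler w)%:~R + (degree w)%:R) +
    (2 * ((l w)%:~R * (acoef w v)%:R) - (deg2 w)%:~R * (acoef w v)%:R)) : rat).
  rewrite /c1_pairing mulr_sumr; apply: eq_bigr => w _.
  by rewrite mulrA -acoef_green /c1 !ffunE /deg2 !(rmorphD, rmorphB) /=; ring.
by rewrite big_split /= sumrB dR -mulr_sumr kR /rat_linear; ring.
Qed.

Lemma rat_valueE : rat_value = c1_pairing ^+ 2 / (8 * green v v) +
  (\sum_(w : G) (deg2 w)%:~R * green w v ^+ 2 / green v v) / 24 - (24 * green v v)^-1.
Proof.
have sE : rat_square = d%:R ^+ 2 * green v v *
    \sum_(w : G) (deg2 w)%:~R * green w v ^+ 2 / green v v.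
  rewrite /rat_square mulr_sumr; apply: eq_bigr => w _.
  by rewrite acoef_green; field.
have kE' : k%:R - d%:R / 2 - rat_linear / 2 = d%:R * c1_pairing / 2 :> rat.
  by rewrite c1_pairingE; field.
rewrite /rat_value sE kE'; set q := \sum_w _.
by field; rewrite gvv0 dr0.
Qed.

Definition rat_part (K : plumbing) (t : spincX K) : rat :=
  casson_walker K / (detG K)%:~R + c1_term t.

Lemma casson_walkerE (K : plumbing) (w0 : K) : neg_tree K ->
  casson_walker K / (detG K)%:~R = - (1 / 24) *
    ((\sum_(w : K) euler w)%:~R + 3 * #|K|%:R + \sum_(w : K) (deg2 w)%:~R * green w w).
Proof.
move=> [connK acycK negK].
have D0 : (detG K)%:~R != 0 :> rat by rewrite intr_eq0 gt_eqF // (detG_gt0 negK connK w0).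
have -> : \sum_(w : K) (deg2 w)%:~R * green w w =
    (detG K)%:~R^-1 * \sum_(w : K) ((degree w)%:R - 2) * (acoef w w)%:R.
  rewrite mulr_sumr; apply: eq_bigr => w _; rewrite acoefE // /deg2 rmorphB /= -pmulrn.
  by field.
by rewrite /casson_walker; field.
Qed.

(** The drop of c_1^2 gives the square in rat_valueE. The trace of green, which enters
    through the Casson-Walker invariant, gives the other two terms together
    with the sum of the Euler numbers and the number of vertices. *)
Lemma rat_part_drop : rat_part s + rat_value =
  \sum_(i : component v) rat_part (spincX_restrict (val i) s).
Proof.
have cardE : #|G|%:R = 1 + \sum_(i : component v) #|comp_plumbing i|%:R :> rat.
  rewrite -sum1_card natr_sum sum_components; congr (_ + _); apply: eq_bigr => i _.
  by rewrite -sum1_card natr_sum.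
have eulE : (\sum_(w : G) euler w)%:~R = (euler v)%:~R +
    \sum_(i : component v) (\sum_(a : comp_plumbing i) euler a)%:~R :> rat.
  rewrite sum_components rmorphD /= rmorph_sum /=; congr (_ + _).
have -> : \sum_(i : component v) rat_part (spincX_restrict (val i) s) =
    - (1 / 24) * (\sum_(i : component v) (\sum_(a : comp_plumbing i) euler a)%:~R
      + 3 * (\sum_(i : component v) #|comp_plumbing i|%:R)
      + \sum_(i : component v) \sum_(a : comp_plumbing i) (deg2 a)%:~R * green a a)
    + (\sum_(i : component v) dual_form (c1 (spincX_restrict (val i) s))
          (c1 (spincX_restrict (val i) s)) + \sum_(i : component v) #|comp_plumbing i|%:R) / 8.
  rewrite [3 * _]mulr_sumr -[in RHS]big_split -[in RHS]big_split /= mulr_sumr.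
  rewrite -[in RHS]big_split /= mulr_suml -[in RHS]big_split; apply: eq_bigr => i _ /=.
  by rewrite /rat_part (casson_walkerE (tp i) (Gitree i)) /c1_term; ring.
have QE := c1_square_drop; have ME := trace_drop.
rewrite rat_valueE /rat_part (casson_walkerE v Gtree) /c1_term cardE eulE.
move: QE ME.
set Q := dual_form _ _; set Qi := \sum_(i : component v) dual_form _ _.
set M := \sum_(w : G) (deg2 w)%:~R * green w w; set Mi := \sum_(i : component v) _.
set X := \sum_(w : G) _; set E := \sum_(i : component v) _.
set N := \sum_(i : component v) _.
move=> /(canRL (subrK _)) -> /(canRL (subrK _)) ->.
by field.
Qed.

End RationalIdentity.

(** * The surgery formula *)

Section Conclusion.
Variables (C : numClosedFieldType) (G : plumbing) (v : G).
Hypothesis Gtree : neg_tree G.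

Lemma double_value_rat k d : double_value C v k d = ratr (rat_value v k d).
Proof.
have lE : linear_moment C v = ratr (rat_linear v).
  rewrite /linear_moment rmorph_sum; apply: eq_bigr => w _.
  by rewrite rmorphM /= ratr_int ratr_nat.
have qE : square_moment C v = ratr (rat_square v).
  rewrite /square_moment rmorph_sum; apply: eq_bigr => w _.
  by rewrite rmorphM rmorphXn /= ratr_int ratr_nat.
rewrite /double_value /rat_value lE qE /gvv rmorphM fmorphV rmorphM rmorphB rmorphD.
by rewrite !fmorph_div !rmorphXn !rmorphB !fmorph_div /= !ratr_nat.
Qed.

(** k is - d (l', E*_v), which the hypothesis confines to the interval [0, d[. *)
Lemma coset_exponent (s : spincX G) :
  -1 < iform [ffun u => toLQ (c1 s - c1 (spincX_can G)) u / 2] (toLQ (Estar v)) <= 0 ->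
  exists k d : nat, [/\ detG G = d%:Z, (k < d)%N &
    \sum_w spincX_coord s w * (acoef w v)%:Z = k%:Z].
Proof.
have [conn acyc neg] := Gtree; have d_gt0 := detG_gt0 neg conn v acyc.
set K : int := \sum_w _ => hs.
have E : iform [ffun u => toLQ (c1 s - c1 (spincX_can G)) u / 2] (toLQ (Estar v)) =
    - (K%:~R / (detG G)%:~R).
  rewrite iform_toLQ // (bigD1 v) //= [X in _ + X]big1 ?addr0 => [|w wv]; last first.
    by rewrite [Estar v w]ffunE (negbTE wv) mulr0.
  rewrite [Estar v v]ffunE eqxx mulr1 ffunE toLQ_green mulNr; congr (- _).
  rewrite rmorph_sum !mulr_suml; apply: eq_bigr => w _ /=.
  have -> : (c1 s - c1 (spincX_can G)) w = spincX_coord s w + spincX_coord s w.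
    by rewrite !ffunE /=; ring.
  rewrite rmorphM rmorphD /= -pmulrn acoefE // (green_sym neg v w).
  by field; rewrite intr_eq0 gt_eqF.
have dr : 0 < (detG G)%:~R :> rat by rewrite ltr0z.
move: hs; rewrite {}E ltrN2 oppr_le0 ltr_pdivrMr // mul1r ltr_int.
rewrite ler_pdivlMr // mul0r ler0z => /andP[].
move: d_gt0; case: (detG G) => // d _; case: K => // k kd _.
by exists k, d; split.
Qed.

End Conclusion.

Lemma good_choice (C : numClosedFieldType) (K : plumbing) (w0 : K) :
  exists g : {ffun K -> C} -> K,
    forall x, is_char x -> x != one_char C K -> good (ones x) (g x).
Proof.
have H (x : {ffun K -> C}) : exists u, is_char x -> x != one_char C K -> good (ones x) u.
  have [w wS|all1] := pickP (fun w => w \notin ones x).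
    by exists w => _ _; rewrite /good wS.
  exists w0 => _; rewrite -ones_setT => /eqP[]; apply/setP => w.
  by have /negbFE -> := all1 w; rewrite inE.
by have [g gP] := boolp.choice H; exists g.
Qed.

(** The top vertex is good for the characters that are not 1 there, so that their
    terms are the branch weights. *)
Lemma torsion_branch (C : numClosedFieldType) (G : plumbing) (v : G) (l : dual_lattice G)
    (Gtree : neg_tree G) (A : {set G}) u (br : is_branch v A u) (s : spincX (subplumbing A))
    (uA : (discr (subplumbing A) -> C) -> subplumbing A)
    (g : {ffun subplumbing A -> C} -> subplumbing A) :
  spincX_coord s = dual_restrict A l -> torsion_choice uA ->
  (forall y, is_char y -> y != one_char C (subplumbing A) -> good (ones y) (g y)) ->
  torsion uA (spinc_boundary s) =
  (detG (subplumbing A))%:~R^-1 *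
    \sum_(y <- chars C (subplumbing A) | (y != one_char C _) && (y (top br) == 1))
      (monom y (dual_restrict A l))^-1 * pval y (fun w => acoef w (g y)) +
  \sum_(y <- chars C (subplumbing A) | y (top br) != 1) branch_weight l br y.
Proof.
move=> sE hu gP; have Atree := branch_neg_tree Gtree br.
rewrite (torsionE Atree s hu gP) sE.
rewrite (bigID (fun y : {ffun subplumbing A -> C} => y (top br) == 1)) mulrDr.
congr (_ + _); rewrite mulr_sumr.
have t1 (y : {ffun subplumbing A -> C}) : y (top br) != 1 -> y != one_char C _.
  by apply: contraNneq => ->; rewrite ffunE.
rewrite [LHS]big_seq_cond [RHS]big_seq_cond; apply: eq_big => y.
  by congr (_ && _); rewrite andb_idl //; exact: t1.
move=> /and3P[ys _ yt]; have yc := in_chars Atree ys.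
have gt : good (ones y) (top br) by rewrite /good inE yt.
have E := pval_good Atree (char_balanced yc) (gP y yc (t1 y yt)) gt.
exact: (congr1 (fun z => (detG (subplumbing A))%:~R^-1 * ((monom y (dual_restrict A l))^-1 * z)) E).
Qed.

(** In the torsion of a component, the characters equal to 1 at the top vertex give
    the change of the base vertex in the torsion of G, and the other characters
    give the values of the simple polar parts. *)
Lemma surgery_formula (C : numClosedFieldType) (G : plumbing) (v : G) (s : spincX G)
  (Gtree : neg_tree G)
  (hs : -1 < iform [ffun u => toLQ (c1 s - c1 (spincX_can G)) u / 2]
                   (toLQ (Estar v)) <= 0)
  (uG : (discr G -> C) -> G) (huG : torsion_choice uG)
  (uC : forall i : component v, (discr (comp_plumbing i) -> C) -> comp_plumbing i)
  (huC : forall i : component v, torsion_choice (uC i)) :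
  sw uG (spinc_boundary s) + ratr (c1_term s) =
  - (polynomial_part (Hrat C (spinc_boundary s) v)).[1] +
  \sum_(i : component v)
    (sw (uC i) (spinc_boundary (spincX_restrict (val i) s)) +
     ratr (c1_term (spincX_restrict (val i) s))).
Proof.
have [k [d [dE kd kE]]] := coset_exponent Gtree hs.
have d0 : (0 < d)%N by apply: leq_ltn_trans kd.
have [ut utP] := boolp.choice (fun i : component v => component_branch Gtree i).
have Gitree (i : component v) : neg_tree (comp_plumbing i) := branch_neg_tree Gtree (utP i).
have [g gP] := good_choice C v.
have [gi giP] : exists gi : forall i : component v, {ffun comp_plumbing i -> C} -> comp_plumbing i,
    forall i y, is_char y -> y != one_char C (comp_plumbing i) -> good (ones y) (gi i y).
  pose gi i := sval (cid (good_choice C (top (utP i)))).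
  by exists gi => i; exact: svalP (cid (good_choice C (top (utP i)))).
have sG (K : plumbing) (t : spincX K) u : sw u (spinc_boundary t) + ratr (c1_term t) =
    ratr (rat_part t) - torsion u (spinc_boundary t) :> C.
  by rewrite /sw /rat_part rmorphD addrAC.
rewrite sG (eq_bigr (fun i => ratr (rat_part (spincX_restrict (val i) s)) -
  torsion (uC i) (spinc_boundary (spincX_restrict (val i) s)))) => [|i _]; last exact: sG.
have rE : \sum_(i : component v) ratr (rat_part (spincX_restrict (val i) s)) =
    ratr (rat_part s) + double_value C v k d.
  by rewrite double_value_rat -[RHS]rmorphD (rat_part_drop Gtree utP dE d0 kE) rmorph_sum.
rewrite sumrB rE.
rewrite (polynomial_part_at_1 C Gtree utP dE kd kE (erefl _)).
rewrite (torsionE Gtree s huG gP).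
have TD := torsion_difference Gtree utP (spincX_coord s) gP giP.
set W := \sum_(i : component v) \sum_(y <- _ | _) _.
set TG := (detG G)%:~R^-1 * \sum_(x <- _ | _) _.
set Px := \sum_(x <- _ | _) _.
set Ti := \sum_(i : component v) torsion _ _.
have TiE : Ti = (TG - Px) + W.
  transitivity ((detG G)%:~R^-1 * \sum_(x <- chars C G | x != one_char C G)
     (monom x (spincX_coord s))^-1 *
     (pval x (fun w => acoef w (g x)) - pval x (fun w => acoef w v)) + W); last first.
    congr (_ + _); rewrite /TG /Px -mulr_sumr -mulrBr -sumrB; congr (_ * _).
    by apply: eq_bigr => x _; rewrite mulrBr.
  rewrite TD /W -big_split; apply: eq_bigr => i _.
  by apply: (torsion_branch Gtree (utP i) _ (huC i) (giP i)); rewrite /= addr0.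
rewrite TiE; ring.
Qed.

Theorem theorem1p0p1 (R : realType) (G : plumbing)
  (Gconn : connected_graph G)
  (Gtree : acyclic_graph G)
  (Gneg : negative_definite G)
  (v : G) (s : spincX G)
  (hs : -1 < iform [ffun u => toLQ (c1 s - c1 (spincX_can G)) u / 2]
                   (toLQ (Estar v)) <= 0)
  (uG : (discr G -> R[i]) -> G)
  (huG : torsion_choice uG)
  (uC : forall i : component v,
          (discr (comp_plumbing i) -> R[i]) -> comp_plumbing i)
  (huC : forall i : component v, torsion_choice (uC i)) :
  sw uG (spinc_boundary s) + ratr (c1_term s) =
  - (polynomial_part (Hrat R[i] (spinc_boundary s) v)).[1] +
  \sum_(i : component v)
    (let s_i : spincX (comp_plumbing i) := spincX_restrict (val i) s in
     sw (uC i) (spinc_boundary s_i) + ratr (c1_term s_i)).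
Proof.
exact: (surgery_formula (And3 Gconn Gtree Gneg) hs huG huC).
Qed.
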